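(* Let $\mathbf G$ be a Carnot group with horizontal vector fields $X_1,\dots,X_m$ and let $\Omega\subset\mathbf G$ be a bounded domain. Assume that $f\in C^2(\mathbb R^m,\mathbb R_+)$ is strictly convex, homogeneous of degree $\alpha\ge1$, and $f(p)>0$ for $p\ne0$. Then, for any $\phi\in W^{1,\infty}_{cc}(\Omega)$, the Dirichlet problem $$-\sum_{i,j=1}^m f_{p_i}(Xu)f_{p_j}(Xu)X_iX_ju=0\ \text{ in }\Omega,\qquad u=\phi\ \text{ on }\partial\Omega,$$ has at most one viscosity solution in $C(\bar\Omega)$.
   Context: Carnot group of step $r\ge1$: a simply connected Lie group $\mathbf G$ whose Lie algebra decomposes as $\mathfrak g=V^1\oplus\cdots\oplus V^r$ with $[V^1,V^j]=V^{j+1}$ for $1\le j\le r-1$ and $[V^j,V^r]=0$ for $1\le j\le r$. $\mathbf G$ is identified with $\mathfrak g\cong\mathbb R^n$ via the exponential map. $m=\dim V^1$, and $X_1,\dots,X_m$ are the left-invariant vector fields forming a basis of $V^1$, orthonormal for a fixed Euclidean norm on $\mathfrak g$ making the $V^j$ mutually orthogonal. $Xu=(X_1u,\dots,X_mu)$. $W^{1,\infty}_{cc}(\Omega)$ is the space of $u$ with $u,Xu\in L^\infty(\Omega)$; it is identified with the space of functions on $\Omega$ Lipschitz with respect to the Carnot-Carathéodory metric $d_{cc}$ on $\mathbf G$ generated by $X_1,\dots,X_m$ ($d_{cc}(p,q)$ = infimum of $\delta>0$ such that $p,q$ are joined by a curve $\gamma:[0,\delta]\to\mathbf G$ with $\gamma'=\sum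 a_iX_i(\gamma)$, $\sum a_i^2\le1$), and boundary values are those of the continuous extension to $\bar\Omega$. Strictly convex: there is $C_0>0$ with $D^2f\ge C_0 I$ on $\mathbb R^m$. Homogeneous of degree $\alpha$: $f(tp)=t^\alpha f(p)$ for $t>0$. $\mathbb R_+=[0,\infty)$. Viscosity solution: let $(D^2\psi)^*_{ij}=\frac12(X_iX_j+X_jX_i)\psi$ and $A[\psi]=-\sum_{i,j}f_{p_i}(X\psi)f_{p_j}(X\psi)(D^2\psi)^*_{ij}$. A continuous $u$ is a viscosity subsolution of $A[u]=0$ in $\Omega$ if $A[\psi](x_0)\le0$ whenever $\psi\in C^2(\Omega)$ and $u-\psi$ has a local maximum at $x_0\in\Omega$; a viscosity supersolution if $A[\psi](x_0)\ge0$ whenever $\psi\in C^2(\Omega)$ and $u-\psi$ has a local minimum at $x_0\in\Omega$; a viscosity solution if both. *)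

(* Defs.v *)
From HB Require Import structures.
From mathcomp Require Import all_boot all_order all_algebra.
From mathcomp Require Import all_classical all_reals all_analysis.
Import Order.TTheory GRing.Theory Num.Theory.
Import numFieldNormedType.Exports.

Set Implicit Arguments.
Unset Strict Implicit.
Unset Printing Implicit Defensive.

Local Open Scope classical_set_scope.
Local Open Scope ring_scope.

(* C^k regularity on an open set U.  [differentiable] is Fréchet
   differentiability; V is finite-dimensional in every use below, so the
   directional derivatives being of class C^(k-1) is the usual notion. *)
Fixpoint Ck (R : realType) (V W : normedModType R) (k : nat) (U : set V)
    (g : V -> W) : Prop :=
  match k with
  | 0%N => forall x, U x -> {for x, continuous g}
  | k'.+1 => (forall x, U x -> differentiable g x) /\
             (forall v : V, Ck k' U (fun x => 'D_v g x))
  end.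

Section PartialDerivatives.
Context (R : realType) (m : nat).
Implicit Types (f : 'rV[R]_m -> R) (p : 'rV[R]_m).

Definition partial f (i : 'I_m) p : R := 'D_(delta_mx 0 i) f p.

Definition hessian f p : 'M[R]_m :=
  \matrix_(i, j) partial (partial f j) i p.

Definition strictly_convex f : Prop :=
  exists2 C0 : R, 0 < C0 & forall p (xi : 'rV[R]_m),
    C0 * (\sum_i xi 0 i ^+ 2) <= (xi *m hessian f p *m xi^T) 0 0.

Definition homogeneous_of_degree f (alpha : R) : Prop :=
  forall (t : R) p, 0 < t -> f (t *: p) = t `^ alpha * f p.

End PartialDerivatives.

Section LeftInvariant.
Context (R : realType) (n : nat).
Local Notation V := 'rV[R]_n.

Definition vf_apply (Y : V -> V) (u : V -> R) (x : V) : R := 'D_(Y x) u x.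

Definition vf_bracket (Y Z : V -> V) (x : V) : V :=
  'D_(Y x) Z x - 'D_(Z x) Y x.

(* The left-invariant vector field equal to v at the neutral element 0: the
   image of v under the differential at 0 of the left translation by x. *)
Definition left_field (mul : V -> V -> V) (v x : V) : V := 'D_v (mul x) 0.

Definition lie_bracket (mul : V -> V -> V) (v w : V) : V :=
  vf_bracket (left_field mul v) (left_field mul w) 0.

(* Z is the linear span of { br x y : x in U, y in W }. *)
Definition bracket_span (br : V -> V -> V) (U W Z : {vspace V}) : Prop :=
  (forall x y, x \in U -> y \in W -> br x y \in Z) /\
  (forall Z' : {vspace V},
     (forall x y, x \in U -> y \in W -> br x y \in Z') -> (Z <= Z')%VS).

End LeftInvariant.

(* A Carnot group of step r, of dimension n, read in exponential coordinates:
   the underlying manifold is its Lie algebra R^n (so that it is simply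
   connected), and the exponential map is the identity, which is what [cg_exp]
   says: the lines t |-> t x are the one-parameter subgroups.
   [cg_layer j] is V^j for 1 <= j <= r; other indices are irrelevant.
   "Of step r" includes V^r <> 0, which excludes the one-point group. *)
Record carnot_group (R : realType) (n r : nat) := CarnotGroup {
  cg_mul : 'rV[R]_n -> 'rV[R]_n -> 'rV[R]_n;
  cg_mulA : associative cg_mul;
  cg_mul0x : left_id 0 cg_mul;
  cg_mulx0 : right_id 0 cg_mul;
  cg_mulNx : left_inverse 0 -%R cg_mul;
  cg_smooth : forall k : nat,
    Ck k [set: 'rV[R]_n * 'rV[R]_n] (fun z => cg_mul z.1 z.2);
  cg_exp : forall (x : 'rV[R]_n) (s t : R),
    cg_mul (s *: x) (t *: x) = (s + t) *: x;
  cg_layer : nat -> {vspace 'rV[R]_n};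
  cg_step_gt0 : (0 < r)%N;
  cg_direct : directv (\sum_(j < r) cg_layer j.+1)%VS;
  cg_full : (\sum_(j < r) cg_layer j.+1)%VS = fullv;
  cg_top_neq0 : cg_layer r != 0%VS;
  cg_generate : forall j : nat, (1 <= j <= r.-1)%N ->
    bracket_span (lie_bracket cg_mul) (cg_layer 1) (cg_layer j)
      (cg_layer j.+1);
  cg_nilpotent : forall j : nat, (1 <= j <= r)%N ->
    forall x y, x \in cg_layer j -> y \in cg_layer r ->
      lie_bracket cg_mul x y = 0
}.

Section Horizontal.
Context (R : realType) (n r m : nat) (G : carnot_group R n r).
Local Notation V := 'rV[R]_n.

Definition qdot (Q : 'M[R]_n) (x y : V) : R := (x *m Q *m y^T) 0 0.

(* Q is the Gram matrix of a Euclidean inner product on the Lie algebra making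
   the layers mutually orthogonal. *)
Definition adapted_inner_product (Q : 'M[R]_n) : Prop :=
  [/\ Q^T = Q,
      forall x : V, x != 0 -> 0 < qdot Q x x
    & forall i j : nat, (1 <= i <= r)%N -> (1 <= j <= r)%N -> i <> j ->
      forall x y, x \in cg_layer G i -> y \in cg_layer G j -> qdot Q x y = 0].

(* Since e is a basis of V^1, m = dim V^1. *)
Definition horizontal_frame (Q : 'M[R]_n) (e : m.-tuple V) : Prop :=
  basis_of (cg_layer G 1) e /\
  forall i j : 'I_m, qdot Q (tnth e i) (tnth e j) = (i == j)%:R.

Variable e : m.-tuple V.

Definition Xf (i : 'I_m) : V -> V := left_field (cg_mul G) (tnth e i).

Definition hgrad (u : V -> R) (x : V) : 'rV[R]_m :=
  \row_i vf_apply (Xf i) u x.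

Definition hhess (u : V -> R) (x : V) : 'M[R]_m :=
  \matrix_(i, j) (2^-1 * (vf_apply (Xf i) (vf_apply (Xf j) u) x +
                          vf_apply (Xf j) (vf_apply (Xf i) u) x)).

Definition abs_continuous (a b : R) (g : R -> V) : Prop :=
  forall eps : R, 0 < eps -> exists2 d : R, 0 < d &
    forall (k : nat) (s t : 'I_k -> R),
      (forall i, [/\ a <= s i, s i <= t i & t i <= b]) ->
      (forall i j, i != j -> t i <= s j \/ t j <= s i) ->
      \sum_i (t i - s i) < d ->
      \sum_i `|g (t i) - g (s i)| < eps.

(* Measurability of the controls a is automatic: the X_i are smooth and
   pointwise linearly independent. *)
Definition horizontal_curve (delta : R) (g : R -> V) : Prop :=
  abs_continuous 0 delta g /\
  {ae lebesgue_measure, forall t : R, t \in `]0, delta[ ->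
     exists2 a : 'rV[R]_m, \sum_i a 0 i ^+ 2 <= 1 &
       is_derive t 1 g (\sum_i a 0 i *: Xf i (g t))}.

(* By the Chow-Rashevskii theorem the set is nonempty, so the real-valued
   infimum is the genuine one. *)
Definition dcc (p q : V) : R :=
  inf [set delta : R | 0 < delta /\
    exists g : R -> V, [/\ g 0 = p, g delta = q & horizontal_curve delta g]].

(* W^{1,oo}_cc(Omega), as the space of functions on Omega that are Lipschitz
   for the Carnot-Caratheodory metric. *)
Definition W1oo_cc (Omega : set V) (phi : V -> R) : Prop :=
  exists L : R, forall x y, Omega x -> Omega y ->
    `|phi x - phi y| <= L * dcc x y.

Variable f : 'rV[R]_m -> R.

Definition aronsson (u : V -> R) (x : V) : R :=
  - \sum_i \sum_j partial f i (hgrad u x) * partial f j (hgrad u x)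
                  * hhess u x i j.

Definition viscosity_subsolution (Omega : set V) (u : V -> R) : Prop :=
  forall (psi : V -> R) (x0 : V), Ck 2 Omega psi -> Omega x0 ->
    (\forall x \near x0, u x - psi x <= u x0 - psi x0) ->
    aronsson psi x0 <= 0.

Definition viscosity_supersolution (Omega : set V) (u : V -> R) : Prop :=
  forall (psi : V -> R) (x0 : V), Ck 2 Omega psi -> Omega x0 ->
    (\forall x \near x0, u x0 - psi x0 <= u x - psi x) ->
    0 <= aronsson psi x0.

Definition viscosity_solution (Omega : set V) (u : V -> R) : Prop :=
  viscosity_subsolution Omega u /\ viscosity_supersolution Omega u.

(* u agrees on the boundary of the open set Omega with the continuous
   extension of phi to the closure; phi is only considered on Omega. *)
Definition boundary_values (Omega : set V) (phi u : V -> R) : Prop :=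
  forall x, (closure Omega `\` Omega) x ->
    phi y @[y --> within Omega (nbhs x)] --> u x.

(* Only the values of u on the closure of Omega matter. *)
Definition dirichlet_solution (Omega : set V) (phi u : V -> R) : Prop :=
  [/\ {within closure Omega, continuous u},
      viscosity_solution Omega u
    & boundary_values Omega phi u].

End Horizontal.

Definition bounded_domain (R : realType) (n : nat) (Omega : set 'rV[R]_n) :
    Prop :=
  [/\ open Omega, connected Omega, Omega !=set0 & bounded_set Omega].

(* Main.v *)
(** By homogeneity, D^2 f(s p) = s^(alpha - 2) D^2 f(p); as f is C^2 at 0 and
    D^2 f(0) is positive definite, alpha = 2 and f(p) = <p, p> / 2 for the inner
    product <p, q> = p S q^T, S being the symmetrised Hessian at 0.  Hence the
    equation is the infinity-Laplace equation of the norm |.| of S, and c in R^m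
    is the step c S E along the horizontal frame E, of length |c|.

    Let K_t be the closure of the products of horizontal steps of total length
    at most t.  The key point is that a subsolution u satisfies
    2 max_(x K_t) u <= u(x) + max_(x K_2t) u.  Otherwise, for a concave parabola
    g, u(x h k) - g(t) - tau |h|^2 with k in K_t has an interior maximum.  Left
    translations by h commute with the X_i, so the penalty is unchanged when
    both variables move along the same horizontal path.  Prolonging k by a step,
    or shortening it by its last piece, bounds u from above near x h k; the
    bounds force that last piece to be almost straight, in the direction of the
    horizontal gradient, and produce a paraboloid which touches u from above and
    whose second derivative along its own horizontal gradient is that of g,
    hence negative.

    Given the key point for u and -v, the argument of Armstrong and Smart
    applies: at a point maximising max_(x K_t) u - min_(x K_t) v and, among
    these, max_(x K_t) u, both functions are constant on x K_t, so that this set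
    of points is stable under right translation by a horizontal step and leaves
    the bounded domain. *)

Require Import Defs.
From HB Require Import structures.
From mathcomp Require Import all_boot all_order all_algebra.
From mathcomp Require Import all_classical all_reals all_analysis.
From mathcomp Require Import ring lra.
Import Order.TTheory GRing.Theory Num.Theory.
Import numFieldNormedType.Exports.
Local Open Scope classical_set_scope.
Local Open Scope ring_scope.

Set Implicit Arguments.
Unset Strict Implicit.
Unset Printing Implicit Defensive.

(** * Calculus *)

Section Calculus.
Context {R : realType}.

(** The obstacle is that [u] has no derivatives and that the two bounds at the interior maximum are
    unequal: prolonging is allowed in every direction [c], shortening only by the last piece [q] of
    some chain, whose shape is unknown and changes with its length [s]. At first order the two
    bounds force the gradient P of the penalty to satisfy |P| = b, the slope of g. Then <csum q, P>,
    the first-order gain along [q], misses its Cauchy-Schwarz bound b s by O(s^2) only, and since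
    the norm is Euclidean, [q] deviates from a straight step by o(s) in total. Such an error alone
    would swamp the curvature of g. But at first order it acts with a favourable sign, because <csum
    q, P> <= b s, and everywhere else it is multiplied by a distance of order s + |y|. It therefore
    costs d (s^2 + s |y|) with d as small as desired, which the curvature of g absorbs. This
    accounting needs remainders that compare two nearby points, not one point with the centre; hence
    [quad_approx] for both the group law and the penalty. *)

Lemma Ck_subset {V W : normedModType R} k (A B : set V) (g : V -> W) :
  A `<=` B -> Ck k B g -> Ck k A g.
Proof.
move=> AB; elim: k g => [|k IH] g /=; first by move=> h x /AB/h.
by move=> [h1 h2]; split=> [x /AB/h1//|v]; exact: IH.
Qed.

Lemma Ck_cst {V W : normedModType R} k (A : set V) (c : W) :
  Ck k A (fun _ => c).
Proof.
elim: k c => [|k IH] c /=; first by move=> x _; exact: cvg_cst.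
split=> [x _|v]; first exact: differentiable_cst.
by under eq_fun do rewrite derive_cst; exact: IH.
Qed.

Lemma Ck_le {V W : normedModType R} k (A : set V) (g : V -> W) :
  Ck k.+1 A g -> Ck k A g.
Proof.
elim: k g => [|k IH] g /=.
  by move=> [h _] x /h; exact: differentiable_continuous.
by move=> [h1 h2]; split=> // v; exact: IH.
Qed.

Lemma CkD {V W : normedModType R} k (f g : V -> W) :
  Ck k setT f -> Ck k setT g -> Ck k setT (fun x => f x + g x).
Proof.
elim: k f g => [|k IH] f g /=.
  by move=> hf hg x _; apply: continuousD; [exact: hf|exact: hg].
move=> [hf1 hf2] [hg1 hg2]; split=> [x _|v].
  by apply: differentiableD; [exact: hf1|exact: hg1].
rewrite [X in Ck k setT X](_ : _ = fun x => 'D_v f x + 'D_v g x).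
  exact: IH.
by apply/funext => x; apply: deriveD; apply: diff_derivable;
  [exact: hf1|exact: hg1].
Qed.

Lemma CkM {V : normedModType R} k (f g : V -> R) :
  Ck k setT f -> Ck k setT g -> Ck k setT (fun x => f x * g x).
Proof.
elim: k f g => [|k IH] f g.
  by move=> hf hg x _; apply: continuousM; [exact: hf|exact: hg].
move=> hf hg; have [hf1 hf2] := hf; have [hg1 hg2] := hg; split=> [x _|v].
  exact: (differentiableM (hf1 _ I) (hg1 _ I)).
rewrite [X in Ck k setT X](_ : _ = fun x => f x * 'D_v g x + g x * 'D_v f x).
  by apply: CkD; apply: IH; [exact: Ck_le|exact: hg2|exact: Ck_le|exact: hf2].
by apply/funext => x; rewrite (deriveM (diff_derivable (hf1 _ I))
  (diff_derivable (hg1 _ I))).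
Qed.

Lemma Ck_sum {V W : normedModType R} k N (f : 'I_N -> V -> W) :
  (forall i, Ck k setT (f i)) -> Ck k setT (fun x => \sum_i f i x).
Proof.
elim: N f => [|N IH] f hf.
  by under eq_fun do rewrite big_ord0; exact: Ck_cst.
by under eq_fun do rewrite big_ord_recl; apply: CkD => //; exact: IH.
Qed.

Lemma differentiable_mx_coord {V : normedModType R} m n (g : V -> 'M[R]_(m, n))
    x i j : differentiable g x -> differentiable (fun x => g x i j) x.
Proof.
by move=> h; exact: (differentiable_comp h (differentiable_coord _ i j)).
Qed.

Lemma derive_mx_coord {V : normedModType R} m n (g : V -> 'M[R]_(m, n))
    x v i j : derivable g x v -> 'D_v (fun x => g x i j) x = 'D_v g x i j.
Proof. by move=> /derive_mx ->; rewrite mxE. Qed.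

Lemma Ck_coord {V : normedModType R} m n k (g : V -> 'M[R]_(m, n)) i j :
  Ck k setT g -> Ck k setT (fun x => g x i j).
Proof.
elim: k g => [|k IH] g.
  by move=> h x _; exact: (continuous_comp (h x I) (@coord_continuous _ _ _ i j _)).
move=> [h1 h2]; split=> [x _|v]; first exact/differentiable_mx_coord/h1.
rewrite [X in Ck k setT X](_ : _ = fun x => 'D_v g x i j).
  exact: (IH _ (h2 v)).
by apply/funext => x; apply: derive_mx_coord; exact/diff_derivable/h1.
Qed.

Lemma derive_pairr {V W Z : normedModType R} (g : V * W -> Z) a y v :
  'D_v (fun y => g (a, y)) y = 'D_((0, v) : V * W) g (a, y).
Proof.
rewrite /derive.
suff -> : (fun h : R => h^-1 *: (((fun y => g (a, y)) \o shift y) (h *: v)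
      - g (a, y))) = (fun h => h^-1 *: ((g \o shift (a, y))
      (h *: ((0, v) : V * W)) - g (a, y))) by [].
apply/funext => h /=; congr (_ *: (g _ - _)).
by rewrite /shift /= -[RHS]/(h *: 0 + a, h *: v + y) scaler0 add0r.
Qed.

Lemma Ck_pairr {V W Z : normedModType R} k (g : V * W -> Z) a :
  Ck k setT g -> Ck k setT (fun y => g (a, y)).
Proof.
elim: k g => [|k IH] g.
  move=> h y _; apply: (@continuous_comp _ _ _ (fun y => (a, y)) g); last exact: h.
  by apply: cvg_pair => //=; exact: cvg_cst.
move=> [h1 h2]; split=> [y _|v].
  apply: (@differentiable_comp _ _ _ _ (fun y => (a, y)) g); last exact: h1.
  exact: differentiable_pair.
rewrite [X in Ck k setT X](_ : _ = fun y => 'D_((0, v) : V * W) g (a, y)).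
  exact: (IH _ (h2 _)).
by apply/funext => y; exact: derive_pairr.
Qed.

Lemma is_derive_line {V W : normedModType R} (g : V -> W) x v t :
  differentiable g (x + t *: v) ->
  is_derive t 1 (fun s => g (x + s *: v)) ('D_v g (x + t *: v)).
Proof.
move=> /(@diff_derivable _ _ _ _ _ v) dg.
have E : (fun h : R => h^-1 *: (((fun s => g (x + s *: v)) \o shift t) (h *: 1)
      - g (x + t *: v))) =
    (fun h => h^-1 *: ((g \o shift (x + t *: v)) (h *: v) - g (x + t *: v))).
  apply/funext => h /=; congr (_ *: (g _ - _)).
  by rewrite [h%:A]mulr1 scalerDl addrCA addrA.
by split; rewrite /derivable /derive /= E.
Qed.

Lemma differentiable_locally_lipschitz {V W : normedModType R} (g : V -> W) x0 :
  differentiable g x0 ->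
  exists C rho, [/\ 0 <= C, 0 < rho &
    forall z, `|z - x0| <= rho -> `|g z - g x0| <= C * `|z - x0|].
Proof.
move=> dg; have [k k0 hk] := linear_lipschitz (@diff_continuous _ _ _ _ _ dg).
have E := diff_locallyx dg.
have [rho rho0 hr] : exists2 rho : R, 0 < rho & forall h, `|h| <= rho ->
   `|g (h + x0) - g x0 - 'd g x0 h| <= `|h|.
  move: E => /=; set o := (X in forall h, _ = _ + X h) => E.
  have : \forall h \near (0 : V), `|o h| <= 1 * `|h|.
    exact: (littleoP [littleo of o]).
  move=> /nbhs_ballP [e /= e0 he]; exists (e / 2); first by rewrite divr_gt0.
  move=> h hh; rewrite E.
  have -> : forall a b c : W, a + b + c - a - b = c.
    by move=> a b c; rewrite [a + b + c]addrC [a + b]addrC addrA !addrK.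
    rewrite -[leRHS]mul1r; apply: he; rewrite -ball_normE /= sub0r normrN.
  by rewrite (le_lt_trans hh)// ltr_pdivrMr// ltr_pMr// ltr1n.
exists (k + 1), rho; split=> //; first by rewrite addr_ge0// ltW.
move=> z hz; have := hr _ hz; rewrite subrK => h1.
rewrite -(subrK ('d g x0 (z - x0)) (g z - g x0)).
rewrite (le_trans (ler_normD _ _))// mulrDl mul1r addrC lerD//.
Qed.

(* Differentiability at [x0] with the uniformity of a C^2 map: the remainder of
   two nearby points is controlled by their distance times the distance to
   [x0]. *)
Definition quad_approx {V W : normedModType R} (g : V -> W) (x0 : V)
    (L : {linear V -> W}) :=
  exists K C rho : R, [/\ 0 <= K, 0 <= C, 0 < rho,
    forall v, `|L v| <= K * `|v| &
    forall r p p', r <= rho -> `|p - x0| <= r -> `|p' - x0| <= r ->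
      `|g p - g p' - L (p - p')| <= C * r * `|p - p'|].

(** The mean value theorem on the segment from [p'] to [p] leaves the variation of the first
    derivatives between a point of the ball and [x0]; their differentiability at [x0] bounds it by
    the radius. The coordinates are abstract so that the lemma also serves on products. *)
Lemma C2_quad_approx {V : normedModType R} N (e : 'I_N -> V)
    (phi : 'I_N -> V -> R) (g : V -> R) x0 :
  (forall v, v = \sum_i phi i v *: e i) ->
  (forall i v, `|phi i v| <= `|v|) ->
  Ck 2 setT g -> quad_approx g x0 ('d g x0).
Proof.
move=> He Hphi [dg ddg].
have [K K0 hK] := linear_lipschitz (@diff_continuous _ _ _ _ _ (dg x0 I)).
have [C [rho [C0 rho0 HC]]] : exists C rho, [/\ 0 <= C, 0 < rho &
    forall z i, `|z - x0| <= rho -> `|'D_(e i) g z - 'D_(e i) g x0| <= C * `|z - x0|].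
  have H i : {Crho : R * R | [/\ 0 <= Crho.1, 0 < Crho.2 &
    forall z, `|z - x0| <= Crho.2 ->
      `|'D_(e i) g z - 'D_(e i) g x0| <= Crho.1 * `|z - x0|]}.
    apply: cid; have [_ ] := ddg (e i).
    have [C [rho h]] := differentiable_locally_lipschitz ((ddg (e i)).1 x0 I).
    by exists (C, rho).
  pose s i := sval (H i).
  have s0 i : 0 <= (s i).1 by rewrite /s; case: (H i) => ? [].
  exists (\sum_i (s i).1), (\big[Num.min/1]_i (s i).2); split.
  - by apply: sumr_ge0 => i _; exact: s0.
  - by apply: lt_bigmin => // i _; rewrite /s; case: (H i) => ? [].
  move=> z i hz; have [h1 h2 h3] := svalP (H i).
  have hzi : `|z - x0| <= (s i).2 by rewrite (le_trans hz)// bigmin_le.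
  have hsi : (s i).1 <= \sum_j (s j).1.
    by rewrite (bigD1 i)//= lerDl; apply: sumr_ge0 => j _; exact: s0.
  exact: le_trans (h3 z hzi) (ler_wpM2r (normr_ge0 _) hsi).
have Dlin z v : 'D_v g z = \sum_i phi i v * 'D_(e i) g z.
  rewrite (deriveE _ (dg z I)) {1}[v]He linear_sum; apply: eq_bigr => i _.
  by rewrite linearZ (deriveE _ (dg z I)).
exists K, (N%:R * C), rho; split=> //; first exact: ltW.
  by rewrite mulr_ge0.
move=> r p p' hr hp hp'.
have cg : {within `[0, 1], continuous (fun s : R => g (p' + s *: (p - p')))}.
  apply: derivable_within_continuous => x _.
  exact: (@ex_derive _ _ _ _ _ _ _ (is_derive_line (dg _ I))).
have [c hc E] := MVT ltr01 (fun x _ => is_derive_line (dg _ I)) cg.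
move: E; rewrite scale1r scale0r addr0 subrKC subr0 mulr1 => ->.
rewrite -(deriveE _ (dg x0 I)) !Dlin -sumrB.
set z := p' + _.
have hz : `|z - x0| <= r.
  move: hc; rewrite in_itv /= => /andP[c0 c1].
  rewrite (_ : z - x0 = (1 - c) *: (p' - x0) + c *: (p - x0)); last first.
    rewrite /z addrAC scalerBl scale1r -[RHS]addrA (addrC (- _)) -scalerBr.
    by rewrite opprB [X in _ = _ + c *: X]addrA subrK.
  rewrite (le_trans (ler_normD _ _))// !normrZ (gtr0_norm c0) gtr0_norm ?subr_gt0//.
  rewrite (_ : r = (1 - c) * r + c * r); last by ring.
  by rewrite lerD// ler_wpM2l// ltW ?subr_gt0.
rewrite (le_trans (ler_norm_sum _ _ _))//.
rewrite -mulrA -mulrA mulr_natl -[N in leRHS]card_ord -sumr_const ler_sum// => i _.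
rewrite -mulrBr normrM mulrC mulrA ler_pM//.
by rewrite (le_trans (HC _ _ _))// ?(le_trans hz)// ler_wpM2l.
Qed.

Lemma quad_approx_comp {U V W : normedModType R} (f : U -> V) (g : V -> W) x0
    (L : {linear U -> V}) (L' : {linear V -> W}) :
  quad_approx f x0 L -> quad_approx g (f x0) L' ->
  quad_approx (g \o f) x0 (L' \o L).
Proof.
move=> [K [C [rho [K0 C0 r0 h1 h2]]]] [K' [C' [rho' [K0' C0' r0' h1' h2']]]].
(* [M] is a Lipschitz constant of [f] on the ball of radius [rho]; below the radius [rho' / (M + 1)]
   the images stay where [g] is controlled, the [+ 1] keeping the divisor positive. *)
pose M := K + C * rho.
have M0 : 0 <= M by rewrite addr_ge0// mulr_ge0// ltW.
have hM r p p' : r <= rho -> `|p - x0| <= r -> `|p' - x0| <= r ->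
    `|f p - f p'| <= M * `|p - p'|.
  move=> hr hp hp'; have := h2 _ _ _ hr hp hp'.
  rewrite -{2}(subrK (L (p - p')) (f p - f p')) => h.
  rewrite (le_trans (ler_normD _ _))// mulrDl addrC lerD//.
  by rewrite (le_trans h)// ler_wpM2r// ler_wpM2l.
exists (K' * K), (K' * C + C' * M * M), (Num.min rho (rho' / (M + 1))).
have M1 : 0 < M + 1 by rewrite ltr_wpDl.
split; rewrite ?addr_ge0// ?mulr_ge0//.
- by rewrite lt_min r0 divr_gt0.
- by move=> v /=; rewrite (le_trans (h1' _))// -mulrA ler_wpM2l.
move=> r p p'; rewrite le_min => /andP[hr hr'] hp hp' /=.
have r_ge0 : 0 <= r by exact: le_trans hp.
have hMr : M * r <= rho'.
  move: hr'; rewrite ler_pdivlMr// => /(le_trans _); apply.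
  by rewrite mulrC ler_wpM2l// lerDl.
have e1 : `|f p - f x0| <= M * r.
  by rewrite (le_trans (hM r _ _ _ _ _)) ?ler_wpM2l// subrr normr0.
have e2 : `|f p' - f x0| <= M * r.
  by rewrite (le_trans (hM r _ _ _ _ _)) ?ler_wpM2l// subrr normr0.
have e3 := h2' _ _ _ hMr e1 e2.
rewrite (_ : _ - _ = (g (f p) - g (f p') - L' (f p - f p')) +
  L' (f p - f p' - L (p - p'))); last first.
  by rewrite [L' (_ - L _)]linearB addrA subrK.
rewrite (le_trans (ler_normD _ _))// addrC !mulrDl lerD//.
  rewrite (le_trans (h1' _))// -!mulrA ler_wpM2l// mulrA; exact: h2.
rewrite (le_trans e3)// -!mulrA ler_wpM2l//.
rewrite (_ : M * (M * _) = M * r * (M * `|p - p'|) - M * r * (M * `|p - p'|) +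
  M * (M * (r * `|p - p'|))); last by rewrite subrr add0r.
rewrite [X in _ <= X](_ : _ = M * (r * (M * `|p - p'|))); last by ring.
by rewrite ler_wpM2l// ler_wpM2l//; exact: hM hr hp hp'.
Qed.

End Calculus.

(** * Second-order approximation in coordinates *)

Section RowVectors.
Context {R : realType}.

Lemma rV_coord_le n (v : 'rV[R]_n) i : `|v 0 i| <= `|v|.
Proof.
rewrite [leRHS]/Num.Def.normr/= mx_normrE.
exact: (le_bigmax _ (fun ij : 'I_1 * 'I_n => `|v ij.1 ij.2|) (0, i)).
Qed.

Lemma rV_norm_le n (v : 'rV[R]_n) c :
  0 <= c -> (forall i, `|v 0 i| <= c) -> `|v| <= c.
Proof.
move=> c0 h; rewrite [leLHS]/Num.Def.normr/= mx_normrE bigmax_le// => -[j i] _.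
by rewrite (ord1 j); exact: h.
Qed.

Definition coord_system {V : normedModType R} N (e : 'I_N -> V)
    (phi : 'I_N -> V -> R) :=
  (forall v, v = \sum_i phi i v *: e i) /\ (forall i v, `|phi i v| <= `|v|).

Lemma rV_coord_system n :
  coord_system (fun i : 'I_n => delta_mx 0 i : 'rV[R]_n) (fun i v => v 0 i).
Proof. by split=> [v|i v]; [exact: row_sum_delta|exact: rV_coord_le]. Qed.

Lemma pair_coord_system (V W : normedModType R) N1 N2 (e1 : 'I_N1 -> V) phi1
    (e2 : 'I_N2 -> W) phi2 :
  coord_system e1 phi1 -> coord_system e2 phi2 ->
  coord_system (fun k : 'I_(N1 + N2) =>
      match fintype.split k with inl i => (e1 i, 0) | inr j => (0, e2 j) end)
    (fun k v => match fintype.split k with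
      inl i => phi1 i v.1 | inr j => phi2 j v.2 end).
Proof.
move=> [h1 h1'] [h2 h2']; split=> [[v w]|k [v w]] /=; last first.
  by case: fintype.split => i; rewrite prod_normE/= le_max ?h1' ?h2' ?orbT.
rewrite big_split_ord /=.
under eq_bigr do rewrite (unsplitK (inl _)).
under [X in _ = _ + X]eq_bigr do rewrite (unsplitK (inr _)).
have E1 : \sum_i phi1 i v *: ((e1 i, 0) : V * W) = (v, 0).
  rewrite {2}(h1 v); elim/big_ind2 : _ => //= [a b c d -> ->|i _].
    by rewrite -[LHS]/(_ + _, 0 + 0) addr0.
  by rewrite -[LHS]/(_ *: _, _ *: _) scaler0.
have E2 : \sum_i phi2 i w *: ((0, e2 i) : V * W) = (0, w).
  rewrite {2}(h2 w); elim/big_ind2 : _ => //= [a b c d -> ->|i _].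
    by rewrite -[LHS]/(0 + 0, _ + _) addr0.
  by rewrite -[LHS]/(_ *: _, _ *: _) scaler0.
by rewrite E1 E2 -[RHS]/(v + 0, 0 + w) addr0 add0r.
Qed.

Lemma C2_quad_approx_rV {V : normedModType R} N (e : 'I_N -> V) phi n
    (g : V -> 'rV[R]_n) x0 :
  coord_system e phi -> Ck 2 setT g -> quad_approx g x0 ('d g x0).
Proof.
move=> [he hphi] hg.
have H i : {KCr : R * R * R | [/\ 0 <= KCr.1.2, 0 < KCr.2 &
   forall r p p', r <= KCr.2 -> `|p - x0| <= r -> `|p' - x0| <= r ->
    `|(g p - g p' - 'd g x0 (p - p')) 0 i| <= KCr.1.2 * r * `|p - p'|]}.
  apply: cid.
  have [K [C [rho [K0 C0 r0 h1 h2]]]] :=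
    C2_quad_approx x0 he hphi (Ck_coord 0 i hg).
  exists (K, C, rho); split=> //= r p p' hr hp hp'.
  have := h2 _ _ _ hr hp hp'; rewrite !mxE.
  rewrite -deriveE; last exact: differentiable_mx_coord (hg.1 _ I).
  by rewrite derive_mx_coord ?deriveE//; [exact: (hg.1 _ I)|
    exact: diff_derivable (hg.1 _ I)].
have [K K0 hK] := linear_lipschitz (@diff_continuous _ _ _ _ _ (hg.1 x0 I)).
pose s i := sval (H i).
have s0 i : 0 <= (s i).1.2 by rewrite /s; case: (H i) => ? [].
exists K, (\sum_i (s i).1.2), (\big[Num.min/1]_i (s i).2); split=> //.
- exact: ltW.
- by apply: sumr_ge0 => i _.
- by apply: lt_bigmin => // i _; rewrite /s; case: (H i) => ? [].
move=> r p p' hr hp hp'; apply: rV_norm_le => [|i].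
  by rewrite !mulr_ge0// ?sumr_ge0// (le_trans _ hp).
have [_ _ h3] := svalP (H i).
rewrite (le_trans (h3 r _ _ _ hp hp'))//; first by rewrite (le_trans hr)// bigmin_le.
rewrite -!mulrA ler_wpM2r//; first by rewrite mulr_ge0// (le_trans _ hp).
by rewrite (bigD1 i)//= lerDl sumr_ge0.
Qed.

Lemma Ck_id {V : normedModType R} k : Ck k setT (@id V).
Proof.
case: k => [|k] /=; first by move=> x _; exact: cvg_id.
split=> [x _|v]; first exact: ex_diff.
by rewrite (_ : derive _ ^~ _ = cst v);
  [exact: Ck_cst|apply/funext => x; exact: derive_id].
Qed.

(** The norm of row vectors is the max norm, which is not smooth; this Euclidean square replaces it
    in the penalty and in the test functions. *)
Definition sqn {n} (v : 'rV[R]_n) : R := \sum_i v 0 i ^+ 2.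

Lemma sqn_ge0 n (v : 'rV[R]_n) : 0 <= sqn v.
Proof. by apply: sumr_ge0 => i _; exact: sqr_ge0. Qed.

Lemma sqr_norm_le_sqn n (v : 'rV[R]_n) : `|v| ^+ 2 <= sqn v.
Proof.
rewrite -[leRHS]sqr_sqrtr ?sqn_ge0// ler_pXn2r ?nnegrE ?sqrtr_ge0//.
apply: rV_norm_le; first exact: sqrtr_ge0.
move=> i; rewrite -sqrtr_sqr ler_sqrt ?sqn_ge0// /sqn (bigD1 i)//= lerDl.
by apply: sumr_ge0 => j _; exact: sqr_ge0.
Qed.

Lemma Ck_sqn {V : normedModType R} k n (g : V -> 'rV[R]_n) :
  Ck k setT g -> Ck k setT (fun x => sqn (g x)).
Proof.
move=> hg; apply: Ck_sum => i; apply: CkM; exact: Ck_coord.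
Qed.

End RowVectors.

Section Group.
Context {R : realType} {n r : nat} (G : carnot_group R n r).
Local Notation V := 'rV[R]_n.
Local Notation mul := (cg_mul G).

Lemma cg_mulxN (x : V) : mul x (- x) = 0.
Proof. by have := cg_mulNx G (- x); rewrite opprK. Qed.

Lemma cg_mulKx (x y : V) : mul (- x) (mul x y) = y.
Proof. by rewrite cg_mulA cg_mulNx cg_mul0x. Qed.

Lemma cg_mulNKx (x y : V) : mul x (mul (- x) y) = y.
Proof. by rewrite cg_mulA cg_mulxN cg_mul0x. Qed.

Lemma cg_mulxK (x y : V) : mul (mul x y) (- y) = x.
Proof. by rewrite -cg_mulA cg_mulxN cg_mulx0. Qed.

Lemma cg_mulxNK (x y : V) : mul (mul x (- y)) y = x.
Proof. by rewrite -cg_mulA cg_mulNx cg_mulx0. Qed.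

Lemma cg_oppM (x y : V) : - mul x y = mul (- y) (- x).
Proof.
rewrite -[RHS](cg_mulKx (mul x y)) [mul (mul x y) (mul _ _)]cg_mulA.
by rewrite cg_mulxK cg_mulxN cg_mulx0.
Qed.

Lemma Ck_mulx k (a : V) : Ck k setT (mul a).
Proof. exact: Ck_pairr (cg_smooth G k). Qed.

Lemma cg_mul_continuous : continuous (fun z : V * V => mul z.1 z.2).
Proof. by move=> z; exact: (cg_smooth G 0 z I). Qed.

End Group.

(** * The group law near the identity and chains of horizontal steps *)

Section LocalGroup.
Context {R : realType} {n r : nat} (G : carnot_group R n r).
Local Notation V := 'rV[R]_n.
Local Notation mul := (cg_mul G).

Lemma derive_pairl {U W Z : normedModType R} (g : U * W -> Z) b y v :
  'D_v (fun y => g (y, b)) y = 'D_((v, 0) : U * W) g (y, b).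
Proof.
rewrite /derive.
suff -> : (fun h : R => h^-1 *: (((fun y => g (y, b)) \o shift y) (h *: v)
      - g (y, b))) = (fun h => h^-1 *: ((g \o shift (y, b))
      (h *: ((v, 0) : U * W)) - g (y, b))) by [].
apply/funext => h /=; congr (_ *: (g _ - _)).
by rewrite /shift /= -[RHS]/(h *: v + y, h *: 0 + b) scaler0 add0r.
Qed.

Lemma Ck_pairl {U W Z : normedModType R} k (g : U * W -> Z) b :
  Ck k setT g -> Ck k setT (fun y => g (y, b)).
Proof.
elim: k g => [|k IH] g.
  move=> h y _; apply: (@continuous_comp _ _ _ (fun y => (y, b)) g); last exact: h.
  by apply: cvg_pair => //=; exact: cvg_cst.
move=> [h1 h2]; split=> [y _|v].
  apply: (@differentiable_comp _ _ _ _ (fun y => (y, b)) g); last exact: h1.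
  exact: differentiable_pair.
rewrite [X in Ck k setT X](_ : _ = fun y => 'D_((v, 0) : U * W) g (y, b)).
  exact: (IH _ (h2 _)).
by apply/funext => y; exact: derive_pairl.
Qed.

Lemma Ck_mulxr k (b : V) : Ck k setT (fun x => mul x b).
Proof. exact: (Ck_pairl b (cg_smooth G k)). Qed.

(** A linear map on a product is determined on the two factors, where multiplication by the neutral
    element is the identity. *)
Lemma diff_mul0 (u v : V) :
  'd (fun z : V * V => mul z.1 z.2) (0, 0) (u, v) = u + v.
Proof.
have dm : differentiable (fun z : V * V => mul z.1 z.2) (0, 0).
  exact: ((cg_smooth G 1).1 _ I).
have -> : (u, v) = (u, 0) + (0, v) :> V * V.
  by rewrite -[RHS]/(u + 0, 0 + v) addr0 add0r.
rewrite linearD -!deriveE// -derive_pairl -derive_pairr /=.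
under eq_fun do rewrite cg_mulx0.
under [X in _ + derive X _ _ = _]eq_fun do rewrite cg_mul0x.
by rewrite !derive_id.
Qed.

(** The first-order part of the group law at [(0, 0)] is addition. Exchanging products for sums thus
    costs the size of the points times the displacement, a second-order quantity. *)
Lemma mul_expand : exists C rho, [/\ 0 <= C, 0 < rho &
  forall s x x' y y', s <= rho -> `|x| <= s -> `|x'| <= s -> `|y| <= s ->
    `|y'| <= s ->
    `|mul x y - mul x' y' - (x - x') - (y - y')| <=
      C * s * (`|x - x'| + `|y - y'|)].
Proof.
have [K [C [rho [K0 C0 r0 h1 h2]]]] := C2_quad_approx_rV (0, 0)
  (pair_coord_system (rV_coord_system n) (rV_coord_system n)) (cg_smooth G 2).
exists C, rho; split=> // s x x' y y' hs hx hx' hy hy'.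
have := h2 s (x, y) (x', y') hs; rewrite !subr0 /= !prod_normE /=.
rewrite !ge_max hx hx' hy hy' => /(_ isT isT).
rewrite -[(x, y) - (x', y')]/(x - x', y - y') diff_mul0 opprD addrA.
move=> /le_trans; apply; rewrite ler_wpM2l//.
  by rewrite mulr_ge0// (le_trans _ hx).
by rewrite ge_max lerDl lerDr !normr_ge0.
Qed.

End LocalGroup.

Section Chains.
Context {R : realType} {n r m : nat} (G : carnot_group R n r).
Local Notation V := 'rV[R]_n.
Local Notation mul := (cg_mul G).
Variables (S : 'M[R]_m) (M : 'M[R]_(m, n)).

Definition ip (c d : 'rV[R]_m) : R := (c *m S *m d^T) 0 0.
Definition cnorm (c : 'rV[R]_m) : R := Num.sqrt (ip c c).

(** In exponential coordinates [c *m M] is the time-one point of the one-parameter subgroup that it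
    spans. For the [M] used later a chain is the endpoint of a piecewise straight horizontal path
    from 0. *)
Definition chain (s : seq 'rV[R]_m) : V :=
  foldr (fun c y => mul (c *m M) y) 0 s.
Definition clen (s : seq 'rV[R]_m) : R := \sum_(c <- s) cnorm c.

Lemma ipDl c c' d : ip (c + c') d = ip c d + ip c' d.
Proof. by rewrite /ip !mulmxDl mxE. Qed.

Lemma ipZl k c d : ip (k *: c) d = k * ip c d.
Proof. by rewrite /ip -!scalemxAl mxE. Qed.

Lemma ipDr c d d' : ip c (d + d') = ip c d + ip c d'.
Proof. by rewrite /ip linearD mulmxDr mxE. Qed.

Lemma ipZr k c d : ip c (k *: d) = k * ip c d.
Proof. by rewrite /ip linearZ/= -!scalemxAr mxE. Qed.

Lemma ip0l d : ip 0 d = 0.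
Proof. by rewrite /ip !mul0mx mxE. Qed.

Lemma ip0r d : ip d 0 = 0.
Proof. by rewrite /ip trmx0 mulmx0 mxE. Qed.

Lemma cnorm_ge0 c : 0 <= cnorm c. Proof. exact: sqrtr_ge0. Qed.

Lemma cnorm0 : cnorm 0 = 0.
Proof. by rewrite /cnorm ip0l sqrtr0. Qed.

Lemma cnormZ k c : cnorm (k *: c) = `|k| * cnorm c.
Proof.
by rewrite /cnorm ipZl ipZr mulrA -expr2 sqrtrM ?sqr_ge0// sqrtr_sqr.
Qed.

Lemma cnormN c : cnorm (- c) = cnorm c.
Proof. by rewrite -scaleN1r cnormZ normrN1 mul1r. Qed.

Lemma clen_ge0 s : 0 <= clen s.
Proof. by apply: sumr_ge0 => i _; exact: cnorm_ge0. Qed.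

Lemma clen_cons c s : clen (c :: s) = cnorm c + clen s.
Proof. by rewrite /clen big_cons. Qed.

Lemma chain_cat s1 s2 : chain (s1 ++ s2) = mul (chain s1) (chain s2).
Proof.
elim: s1 => [|c s1 IH] /=; first by rewrite cg_mul0x.
by rewrite IH cg_mulA.
Qed.

Lemma clen_cat s1 s2 : clen (s1 ++ s2) = clen s1 + clen s2.
Proof. by rewrite /clen big_cat. Qed.

Lemma chain1 c : chain [:: c] = c *m M.
Proof. by rewrite /= cg_mulx0. Qed.

Lemma chain_opp s : exists s', chain s' = - chain s /\ clen s' = clen s.
Proof.
elim: s => [|c s [s' [h1 h2]]]; first by exists [::]; rewrite oppr0.
exists (s' ++ [:: - c]); rewrite chain_cat h1 chain1 mulNmx /= cg_oppM.
by split=> //; rewrite clen_cat h2 !clen_cons /clen big_nil addr0 cnormN addrC.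
Qed.

(** The step during which the length [a] is reached is cut into two collinear pieces, whose product
    is that step by [cg_exp]. This is how a chain is shortened by a last piece of prescribed
    length. *)
Lemma chain_split a b s : 0 <= a -> 0 <= b -> clen s <= a + b ->
  exists s1 s2, [/\ chain s = mul (chain s1) (chain s2), clen s1 <= a &
    clen s2 <= b].
Proof.
elim: s a => [|c s IH] a a0 b0.
  by move=> _; exists [::], [::]; rewrite /= cg_mulx0 /clen big_nil.
rewrite clen_cons => h; have [hca|hac] := leP (cnorm c) a.
  have [||s1 [s2 [e1 e2 e3]]] := IH (a - cnorm c) _ b0.
  - by rewrite subr_ge0.
  - by lra.
  exists (c :: s1), s2; rewrite /= e1 cg_mulA; split=> //.
  by rewrite clen_cons; lra.
have c0 : 0 < cnorm c by exact: le_lt_trans hac.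
pose t := a / cnorm c.
have t0 : 0 <= t by rewrite divr_ge0// ltW.
have t1 : t <= 1 by rewrite ler_pdivrMr// mul1r ltW.
exists [:: t *: c], ((1 - t) *: c :: s); split.
- rewrite /= cg_mulx0 cg_mulA -!scalemxAl cg_exp.
  by rewrite addrC subrK scale1r.
- by rewrite clen_cons /clen big_nil addr0 cnormZ ger0_norm// /t divfK// gt_eqF.
- rewrite clen_cons cnormZ ger0_norm ?subr_ge0// mulrBl mul1r /t divfK ?gt_eqF//.
  by lra.
Qed.

Definition csum (s : seq 'rV[R]_m) : 'rV[R]_m := \sum_(c <- s) c.

Variables (C rho L : R).
Hypotheses (C0 : 0 <= C) (rho0 : 0 < rho) (L0 : 0 <= L).
Hypothesis hC : forall s x x' y y', s <= rho -> `|x| <= s -> `|x'| <= s ->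
  `|y| <= s -> `|y'| <= s ->
  `|mul x y - mul x' y' - (x - x') - (y - y')| <=
      C * s * (`|x - x'| + `|y - y'|).
Hypothesis hCrho : C * rho <= 1.
Hypothesis hL : forall c, `|c *m M| <= L * cnorm c.

Lemma mul_norm_le x y : `|x| <= rho -> `|y| <= rho ->
  `|mul x y| <= 2 * `|x| + `|y|.
Proof.
move=> hx hy; have := @hC rho x 0 y y (lexx _) hx _ hy hy.
rewrite normr0 ltW// => /(_ isT); rewrite cg_mul0x !subrr !subr0 normr0 addr0.
move=> h; rewrite (_ : mul x y = (mul x y - y - x) + (x + y)); last first.
  by rewrite addrA !subrK.
rewrite (le_trans (ler_normD _ _))//.
have hx' : C * rho * `|x| <= `|x| by rewrite ler_piMl.
by have := ler_normD x y; lra.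
Qed.

(** The factor 2 of [mul_norm_le] falls on the left factor, here the new step, so the induction does
    not compound it. *)
Lemma chain_norm_le s : 2 * L * clen s <= rho -> `|chain s| <= 2 * L * clen s.
Proof.
elim: s => [|c s IH]; first by rewrite /= normr0 /clen big_nil mulr0.
rewrite clen_cons /= => h.
have := mulr_ge0 L0 (clen_ge0 s); have := mulr_ge0 L0 (cnorm_ge0 c) => a1 a2.
have h1 := hL c; have /IH h2 : 2 * L * clen s <= rho by lra.
have : `|mul (c *m M) (chain s)| <= 2 * `|c *m M| + `|chain s|.
  by apply: mul_norm_le; lra.
by lra.
Qed.

(* Replacing the steps one at a time by collinear ones keeps the error linear
   in the total deviation, with the size of the chain as a factor. *)
Lemma chain_straight (z : V) sigma s :
  0 <= sigma -> `|z| <= L -> 4 * L * (sigma + clen s) <= rho ->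
  `|mul (sigma *: z) (chain s) - sigma *: z - csum s *m M| <=
    12 * C * L * (sigma + clen s) * \sum_(c <- s) `|c *m M - cnorm c *: z|.
Proof.
move=> sig0 hz; elim: s sigma sig0 => [|c s IH] sigma sig0.
  by rewrite /csum /clen !big_nil mul0mx subr0 /= cg_mulx0 subrr normr0 mulr0.
rewrite clen_cons => h.
have a1 := mulr_ge0 L0 (clen_ge0 s).
have a2 := mulr_ge0 L0 (cnorm_ge0 c).
have a3 := mulr_ge0 L0 sig0.
have cn0 := cnorm_ge0 c.
have {IH}IH := IH (sigma + cnorm c) (addr_ge0 sig0 cn0).
rewrite addrA in h *; have {IH}IH := IH h.
pose a := c *m M; pose d := cnorm c *: z; pose T := chain s.
pose x := sigma *: z; pose tot := sigma + cnorm c + clen s.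
have hx : `|x| <= L * sigma.
  by rewrite normrZ ger0_norm// mulrC ler_wpM2r.
have hd : `|d| <= L * cnorm c by rewrite normrZ ger0_norm// mulrC ler_wpM2r.
have ha : `|a| <= L * cnorm c by exact: hL.
have hT : `|T| <= 2 * L * clen s by apply: chain_norm_le; lra.
have e0 : 2 * L * tot = 2 * (L * sigma) + 2 * (L * cnorm c) + 2 * (L * clen s).
  by rewrite /tot; ring.
have htot : 2 * L * tot <= rho by lra.
have X1 : `|mul x a| <= 2 * L * tot.
  have : `|mul x a| <= 2 * `|x| + `|a| by apply: mul_norm_le; lra.
  by lra.
have X2 : `|mul x d| <= 2 * L * tot.
  have : `|mul x d| <= 2 * `|x| + `|d| by apply: mul_norm_le; lra.
  by lra.
have h1 : `|mul x a - mul x d - (a - d)| <= C * (2 * L * tot) * `|a - d|.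
  have := @hC (2 * L * tot) x x a d htot; rewrite !subrr subr0 normr0 add0r.
  by apply; lra.
have h2 : `|mul (mul x a) T - mul (mul x d) T - (mul x a - mul x d)| <=
    C * (2 * L * tot) * `|mul x a - mul x d|.
  have := @hC (2 * L * tot) (mul x a) (mul x d) T T htot.
  by rewrite !subrr subr0 normr0 addr0; apply; lra.
have hC1 : C * (2 * L * tot) <= 1.
  by rewrite (le_trans _ hCrho)// ler_wpM2l.
have h3 : `|mul x a - mul x d| <= 2 * `|a - d|.
  rewrite -(subrK (a - d) (mul x a - mul x d)) (le_trans (ler_normD _ _))//.
  have : C * (2 * L * tot) * `|a - d| <= 1 * `|a - d| by rewrite ler_wpM2r.
  by lra.
have h4 : `|mul (mul x a) T - mul (mul x d) T - (a - d)| <=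
    12 * C * L * tot * `|a - d|.
  rewrite -(subrK (mul x a - mul x d) (mul (mul x a) T - mul (mul x d) T)).
  rewrite -addrA (le_trans (ler_normD _ _))//.
  have : C * (2 * L * tot) * `|mul x a - mul x d| <=
      C * (2 * L * tot) * (2 * `|a - d|).
    by rewrite ler_wpM2l// !mulr_ge0//; rewrite /tot !addr_ge0// clen_ge0.
  have := normr_ge0 (a - d) => p1.
  have : 0 <= C * (2 * L * tot) * `|a - d|.
    by rewrite !mulr_ge0//; rewrite /tot !addr_ge0// clen_ge0.
  by nra.
rewrite /csum !big_cons mulmxDl mulrDr /= -/a -/d -/x -/T.
(* Collinear steps multiply exactly, so the replaced prefix is again a multiple of [z] and the
   induction hypothesis applies with [sigma + cnorm c]. *)
have E : mul x d = (sigma + cnorm c) *: z by exact: cg_exp.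
move: IH; rewrite -{1}E scalerDl -/d -/x -/T => IH.
rewrite cg_mulA (_ : _ - _ = (mul (mul x a) T - mul (mul x d) T - (a - d)) +
  (mul (mul x d) T - (x + d) - csum s *m M)); last first.
  move: (mul (mul x a) T) (mul (mul x d) T) (csum s *m M) => A B w.
  by apply/rowP => i; rewrite !mxE; ring.
by rewrite (le_trans (ler_normD _ _))// lerD.
Qed.

End Chains.

(** * Chains that nearly realise the speed of the touching function *)

Section InnerProduct.
Context {R : realType} {m : nat} (S : 'M[R]_m).
Hypotheses (S_sym : S^T = S).
Hypothesis S_pos : forall c, c != 0 -> 0 < ip S c c.
Local Notation ip := (ip S).
Local Notation cnorm := (cnorm S).

Lemma ipC c d : ip c d = ip d c.
Proof.
by rewrite /ip -[c *m S *m d^T]trmxK mxE !trmx_mul trmxK S_sym mulmxA.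
Qed.

Lemma ip_ge0 c : 0 <= ip c c.
Proof.
have [->|/S_pos/ltW//] := eqVneq c 0.
by rewrite ip0l.
Qed.

Lemma sqr_cnorm c : cnorm c ^+ 2 = ip c c.
Proof. by rewrite sqr_sqrtr ?ip_ge0. Qed.

Lemma cnorm_eq0 c : cnorm c = 0 -> c = 0.
Proof.
move=> h; apply/eqP; apply: contraT => /S_pos.
by rewrite -sqr_cnorm h expr0n ltxx.
Qed.

Lemma ipBB c d : ip (c - d) (c - d) = ip c c - 2 * ip c d + ip d d.
Proof.
rewrite -scaleN1r !(ipDl, ipDr, ipZl, ipZr) (ipC d c).
by ring.
Qed.

Lemma ip_le c d : ip c d <= cnorm c * cnorm d.
Proof.
have [/cnorm_eq0->|c0] := eqVneq (cnorm c) 0.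
  by rewrite cnorm0 mul0r ip0l.
have [/cnorm_eq0->|d0] := eqVneq (cnorm d) 0.
  by rewrite cnorm0 mulr0 ip0r.
have := ip_ge0 (cnorm d *: c - cnorm c *: d).
rewrite ipBB !(ipZl, ipZr) -!sqr_cnorm.
have : 0 < cnorm c * cnorm d by rewrite mulr_gt0// lt_def ?cnorm_ge0 ?c0 ?d0.
set x := cnorm c; set y := cnorm d => xy h.
by rewrite -subr_ge0 -(pmulr_rge0 _ xy); lra.
Qed.

End InnerProduct.

Section Core.
Context {R : realType} {n r m : nat} (G : carnot_group R n r).
Local Notation V := 'rV[R]_n.
Local Notation mul := (cg_mul G).
Variables (S : 'M[R]_m) (M : 'M[R]_(m, n)).
Hypotheses (S_sym : S^T = S) (S_pos : forall c, c != 0 -> 0 < ip S c c).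
Local Notation ip := (ip S).
Local Notation cnorm := (cnorm S).
Local Notation chain := (chain G M).
Local Notation clen := (clen S).
Variables (C rho L K : R).
Hypotheses (C0 : 0 <= C) (rho0 : 0 < rho) (L0 : 0 <= L) (K0 : 0 <= K).
Hypothesis hC : forall s x x' y y', s <= rho -> `|x| <= s -> `|x'| <= s ->
  `|y| <= s -> `|y'| <= s ->
  `|mul x y - mul x' y' - (x - x') - (y - y')| <=
      C * s * (`|x - x'| + `|y - y'|).
Hypothesis hCrho : C * rho <= 1.
Hypothesis hL : forall c, `|c *m M| <= L * cnorm c.
Variables (F : V -> R) (l : {linear V -> R}) (P : 'rV[R]_m).
Hypothesis hF : forall s p p', s <= rho -> `|p| <= s -> `|p'| <= s ->
  `|F p - F p' - l (p - p')| <= C * s * `|p - p'|.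
Hypothesis hK : forall v, `|l v| <= K * `|v|.
Hypothesis F0 : F 0 = 0.
Hypothesis hP : forall c, l (c *m M) = ip c P.
(** Later [omega y] is [u (mul x0 y) - u x0] at the contact point, [b] and [- kappa] are the slope
    and half the second derivative of the parabola there, and [F] is the increment of the penalty.
    In [bw] one [q] serves all [y]: its direction is detected at [y = 0] and exploited elsewhere.
    The term [s ^+ 3] is room for approximating a point of a closure by a chain. *)
Variables (omega : V -> R) (b kappa : R).
Hypotheses (b0 : 0 < b) (kappa0 : 0 < kappa) (omega0 : omega 0 = 0).
Variable r0 : R.
Hypothesis r0_gt0 : 0 < r0.
Hypothesis fw : forall c y, cnorm c <= r0 -> `|y| <= r0 ->
  omega y <= b * cnorm c - kappa * cnorm c ^+ 2 + F (mul y (- (c *m M))).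
Hypothesis bw : forall s, 0 < s -> s <= r0 -> exists q, clen q <= s /\
  forall y, `|y| <= r0 ->
    omega y <= - (b * s) - kappa * s ^+ 2 + F (mul y (chain q)) + s ^+ 3.

Lemma first_order_le p : `|p| <= rho -> F p <= l p + C * `|p| ^+ 2.
Proof.
move=> hp; have := @hF `|p| p 0 hp (lexx _); rewrite normr0 => /(_ (normr_ge0 _)).
rewrite F0 !subr0 ler_norml => /andP[_]; rewrite expr2 mulrA => h.
by lra.
Qed.

Lemma csum_mulM q : csum q *m M = \sum_(c <- q) c *m M.
Proof. by rewrite /csum mulmx_suml. Qed.

Lemma ip_csum q d : ip (csum q) d = \sum_(c <- q) ip c d.
Proof.
rewrite /csum; elim: q => [|c q IH].
  by rewrite !big_nil ip0l.
by rewrite !big_cons ipDl IH.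
Qed.

Lemma ip_csum_le q : ip (csum q) P <= clen q * cnorm P.
Proof.
rewrite ip_csum mulr_suml ler_sum// => c _; exact: ip_le.
Qed.

Lemma chain_csum q : 4 * L * clen q <= rho ->
  `|chain q - csum q *m M| <= 12 * C * L ^+ 2 * clen q ^+ 2.
Proof.
move=> hq; have q0 := clen_ge0 S q.
have := @chain_straight _ _ _ _ _ _ _ _ _ _ C0 rho0 L0 hC hCrho hL 0 0 q (lexx _).
rewrite normr0 scaler0 cg_mul0x subr0 add0r => /(_ L0 hq) /le_trans; apply.
have : \sum_(c <- q) `|c *m M - cnorm c *: 0| <= L * clen q.
  by rewrite mulr_sumr ler_sum// => c _; rewrite scaler0 subr0.
move=> h; rewrite [leRHS](_ : _ = 12 * C * L * clen q * (L * clen q)); last ring.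
by rewrite ler_wpM2l// !mulr_ge0.
Qed.

(** First term: the remainder of [F] at a point of norm at most [2 * L * s]. Second term: [K] times
    the error of [chain_csum]. *)
Let A := 4 * C * L ^+ 2 + 12 * K * C * L ^+ 2.

Lemma A_ge0 : 0 <= A.
Proof. by rewrite addr_ge0// !mulr_ge0// sqr_ge0. Qed.

(** At [y = 0] the backward bound says that [F (chain q)] is at least b s up to second order, and
    the first-order part of [F (chain q)] is <csum q, P>. The assumption [s <= kappa] lets the
    curvature term pay for [s ^+ 3]. *)
Lemma backward_chain_ip s q : 0 < s -> s <= kappa -> s <= r0 -> 4 * L * s <= rho ->
  clen q <= s ->
  omega 0 <= - (b * s) - kappa * s ^+ 2 + F (mul 0 (chain q)) + s ^+ 3 ->
  b * s - A * s ^+ 2 <= ip (csum q) P.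
Proof.
move=> s0 hsk hsr hs hq; rewrite omega0 cg_mul0x => h.
have q0 := clen_ge0 S q.
have hLq : L * clen q <= L * s by rewrite ler_wpM2l.
have a1 := mulr_ge0 L0 q0.
have hv : `|chain q| <= 2 * L * clen q.
  by apply: (chain_norm_le rho0 L0 hC hCrho hL); lra.
have hv2 : `|chain q| <= 2 * L * s by lra.
have hFv : F (chain q) <= l (chain q) + C * `|chain q| ^+ 2.
  by apply: first_order_le; lra.
have hCv : C * `|chain q| ^+ 2 <= C * (2 * L * s) ^+ 2.
  rewrite ler_wpM2l// ler_pXn2r// nnegrE//; lra.
have hlv : l (chain q) <= ip (csum q) P + K * (12 * C * L ^+ 2 * s ^+ 2).
  rewrite -hP -lerBlDl -linearB; apply: le_trans (ler_norm _) _.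
  apply: le_trans (hK _) _; rewrite ler_wpM2l//.
  apply: le_trans (chain_csum _) _; first by lra.
  by rewrite ler_wpM2l ?mulr_ge0 ?sqr_ge0// ler_pXn2r// nnegrE// ltW.
have hs3 : s ^+ 3 <= kappa * s ^+ 2 by rewrite exprS ler_wpM2r// sqr_ge0.
by rewrite /A; lra.
Qed.

(** The forward bound at [y = 0] with [c = t *: P] reads 0 <= t |P| (b - |P|) + O(t^2); let t tend
    to 0. *)
Lemma cnorm_P_le : cnorm P <= b.
Proof.
have [->|P0] := eqVneq (cnorm P) 0; first exact: ltW.
have cP : 0 < cnorm P by rewrite lt_def P0 cnorm_ge0.
apply/ler_addgt0Pl => e e0; rewrite -lerBlDl.
pose c1 := C * L ^+ 2.
have c10 : 0 <= c1 by rewrite mulr_ge0// sqr_ge0.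
pose t := Num.min (r0 / cnorm P) (Num.min (rho / ((L + 1) * cnorm P))
  (e / ((c1 + 1) * cnorm P))).
have t0 : 0 < t.
  by rewrite !lt_min !divr_gt0// mulr_gt0// ltr_wpDl.
have [ht1 ht2 ht3] : [/\ t * cnorm P <= r0, t * ((L + 1) * cnorm P) <= rho &
    t * ((c1 + 1) * cnorm P) <= e].
  by split; rewrite -ler_pdivlMr ?mulr_gt0 ?ltr_wpDl// /t !ge_min lexx ?orbT.
have nt : cnorm (t *: P) = t * cnorm P by rewrite cnormZ gtr0_norm.
have := @fw (t *: P) 0; rewrite nt normr0 => /(_ ht1 (ltW r0_gt0)).
rewrite omega0 cg_mul0x => h.
have hy := hL (t *: P); rewrite nt in hy.
have tP : 0 < t * cnorm P by rewrite mulr_gt0.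
have hFy : F (- (t *: P *m M)) <= l (- (t *: P *m M)) + C * `|t *: P *m M| ^+ 2.
  rewrite -normrN; apply: first_order_le; rewrite normrN (le_trans hy)//.
  rewrite (le_trans _ ht2)// mulrCA ler_wpM2l ?(ltW t0)//.
  by rewrite ler_wpM2r ?cnorm_ge0// lerDl.
have hCy : C * `|t *: P *m M| ^+ 2 <= c1 * (t * cnorm P) ^+ 2.
  rewrite /c1 -mulrA -exprMn ler_wpM2l// ler_pXn2r// nnegrE//.
  by rewrite mulr_ge0// ltW.
rewrite linearN/= hP ipZl -(sqr_cnorm S_pos) in hFy.
have hk : 0 <= kappa * (t * cnorm P) ^+ 2 by rewrite mulr_ge0 ?sqr_ge0// ltW.
have h2 : 0 <= t * cnorm P * (b - cnorm P + c1 * (t * cnorm P)) by lra.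
move: h2; rewrite pmulr_rge0// => h2.
by nra.
Qed.

(** By Cauchy-Schwarz <csum q, P> <= s |P|, against the lower bound b s - A s^2 of
    [backward_chain_ip]; let s tend to 0. *)
Lemma le_cnorm_P : b <= cnorm P.
Proof.
apply/ler_addgt0Pl => e e0; rewrite -lerBlDl.
pose s := Num.min r0 (Num.min kappa (Num.min (rho / (4 * L + 1)) (e / (A + 1)))).
have A1 : 0 < A + 1 by rewrite ltr_wpDl// A_ge0.
have L1 : 0 < 4 * L + 1 by rewrite ltr_wpDl// mulr_ge0.
have s0 : 0 < s by rewrite !lt_min r0_gt0 kappa0 !divr_gt0.
have [hs1 hs2 hs3 hs4] : [/\ s <= r0, s <= kappa, s * (4 * L + 1) <= rho &
    s * (A + 1) <= e].
  split; rewrite -?ler_pdivlMr//; by rewrite /s !ge_min lexx ?orbT.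
have [q [hq hy]] := bw s0 hs1.
have := hy 0; rewrite normr0 => /(_ (ltW r0_gt0)) h0.
have := backward_chain_ip s0 hs2 hs1 _ hq h0.
have -> : 4 * L * s <= rho by lra.
move=> /(_ isT) h; have := ip_csum_le q => h'.
have h'' : clen q * cnorm P <= s * cnorm P by rewrite ler_wpM2r ?cnorm_ge0.
have : 0 <= s * (cnorm P - b + A * s) by lra.
by rewrite pmulr_rge0// => h3; have := ltW s0; lra.
Qed.

Lemma cnorm_P : cnorm P = b.
Proof. by apply/eqP; rewrite eq_le cnorm_P_le le_cnorm_P. Qed.

Let xi := b^-1 *: P.
Let z := xi *m M.

Let b_neq0 : b != 0. Proof. by rewrite gt_eqF. Qed.

Lemma cnorm_xi : cnorm xi = 1.
Proof. by rewrite cnormZ gtr0_norm ?invr_gt0// cnorm_P mulVf. Qed.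

Lemma linear_z : l z = b.
Proof.
by rewrite hP ipZl -(sqr_cnorm S_pos) cnorm_P expr2 mulrA mulVf// mul1r.
Qed.

Lemma norm_z_le : `|z| <= L.
Proof. by rewrite (le_trans (hL _))// cnorm_xi mulr1. Qed.

(** AM-GM with weight [d] bounds the deviation of one step by d/2 times its length plus 1/d times
    its deficit |c| - <c, xi>. The deficits add up to at most A s^2 / b, which after division by [d]
    is still of order d s for small [s]. *)
Lemma chain_deviation d s q : 0 < d -> 0 < s -> clen q <= s ->
  b * s - A * s ^+ 2 <= ip (csum q) P -> 2 * A * s <= d ^+ 2 * b ->
  \sum_(c <- q) `|c *m M - cnorm c *: z| <= L * d * s.
Proof.
move=> d0 s0 hq hip hA.
have step c : `|c *m M - cnorm c *: z| <=
    L * (d / 2 * cnorm c + d^-1 * (cnorm c - ip c xi)).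
  rewrite /z; move: xi cnorm_xi => x x1.
  rewrite scalemxAl -mulmxBl (le_trans (hL _))// ler_wpM2l//.
  have h := ip_le S_sym S_pos c x; rewrite x1 mulr1 -subr_ge0 in h.
  have c0 := cnorm_ge0 S c.
  rewrite -ler_sqr ?nnegrE ?cnorm_ge0//; last first.
    by rewrite addr_ge0// mulr_ge0// ?invr_ge0 ?divr_ge0// ltW.
  rewrite sqr_cnorm// ipBB// !(ipZl, ipZr) -!sqr_cnorm// x1 expr1n mulr1.
  move: (cnorm c) (ip c x) => a i in h c0 *.
  (* AM-GM: |c - |c| xi|^2 = 2 |c| (|c| - <c, xi>) *)
  rewrite -subr_ge0 [leRHS](_ : _ = (d / 2 * a - d^-1 * (a - i)) ^+ 2).
    exact: sqr_ge0.
  by field; rewrite gt_eqF.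
rewrite (le_trans (ler_sum _ (fun c _ => step c)))// -mulr_sumr -mulrA ler_wpM2l//.
rewrite big_split/= -!mulr_sumr sumrB -/(clen q) -ip_csum.
have -> : ip (csum q) xi = b^-1 * ip (csum q) P by rewrite ipZr.
have h1 : clen q - b^-1 * ip (csum q) P <= b^-1 * A * s ^+ 2.
  have : b^-1 * (b * s - A * s ^+ 2) <= b^-1 * ip (csum q) P.
    by rewrite ler_wpM2l// invr_ge0 ltW.
  by rewrite mulrBr !mulrA mulVf// mul1r; lra.
have h2 : d^-1 * (clen q - b^-1 * ip (csum q) P) <= d^-1 * (b^-1 * A * s ^+ 2).
  by rewrite ler_wpM2l// invr_ge0 ltW.
have h3 : d^-1 * (b^-1 * A * s ^+ 2) <= d / 2 * s.
  rewrite (_ : d^-1 * (b^-1 * A * s ^+ 2) = (d * b)^-1 / 2 * s * (2 * A * s)).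
    rewrite (_ : d / 2 * s = (d * b)^-1 / 2 * s * (d ^+ 2 * b)).
      by rewrite ler_wpM2l// !mulr_ge0 ?invr_ge0// ?mulr_ge0// ltW.
    by field; rewrite b_neq0 gt_eqF.
  by field; rewrite b_neq0 gt_eqF.
have h4 : d / 2 * clen q <= d / 2 * s by rewrite ler_wpM2l// divr_ge0// ltW.
by lra.
Qed.

(** [B * d * s] bounds the distance from [chain q] to [s *: z]. In [D] the terms pay for replacing
    the chain by its sum, for non-commutativity together with the remainder of [F], and, with the
    final 1, for [s ^+ 3]. *)
Let B := 12 * C * L ^+ 2 + 2 * L.
Let D := 12 * K * C * L ^+ 2 + (K + 4) * C * B * (1 + 2 * L) + 1.

(** Although [chain q - s *: z] is only O(d s), its image under [l] is at most O(d s^2):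
    [l (csum q *m M)] is <csum q, P> <= b s, which is [l (s *: z)]. All other errors carry a factor
    [|y| + 2 * L * s]. *)
Lemma straighten_chain_le y q s d : 0 < s -> 0 < d -> d <= 1 -> clen q <= s ->
  b * s - A * s ^+ 2 <= ip (csum q) P -> 2 * A * s <= d ^+ 2 * b ->
  A * s <= d * b -> s <= d -> s <= 1 ->
  2 * (`|y| + 2 * L * s) <= rho -> 4 * L * s <= rho ->
  F (mul y (chain q)) <= F (mul y (s *: z)) + D * d * (s ^+ 2 + s * `|y|) - s ^+ 3.
Proof.
move=> s0 d0 d1 hq hip hA hA' hsd hs1 hy hs.
have q0 := clen_ge0 S q.
have hLq : L * clen q <= L * s by rewrite ler_wpM2l.
have a1 := mulr_ge0 L0 q0.
have hdev := chain_deviation d0 s0 hq hip hA.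
pose v := chain q; pose w := csum q *m M.
have hv : `|v| <= 2 * L * s.
  have : `|v| <= 2 * L * clen q.
    by apply: (chain_norm_le rho0 L0 hC hCrho hL); lra.
  by lra.
have hsz : `|s *: z| <= L * s.
  by rewrite normrZ gtr0_norm// mulrC ler_wpM2r ?norm_z_le// ltW.
have CL0 : 0 <= 12 * C * L * s by rewrite !mulr_ge0// ltW.
have hvw : `|v - w| <= 12 * C * L ^+ 2 * d * s ^+ 2.
  have := @chain_straight _ _ _ _ _ _ _ _ _ _ C0 rho0 L0 hC hCrho hL z 0 q
    (lexx _) norm_z_le.
  rewrite scale0r cg_mul0x subr0 add0r -/v -/w => /(_ _)/le_trans; apply; first by lra.
  rewrite [leRHS](_ : _ = 12 * C * L * s * (L * d * s)); last by ring.
  rewrite ler_pM//; rewrite ?sumr_ge0 ?mulr_ge0// ler_wpM2l// !mulr_ge0//.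
(* Near maximality also forces [q] to use almost all of its allowed length: b (s - clen q) <= A
   s^2. *)
have hlen : `|clen q *: z - s *: z| <= L * d * s.
  rewrite -scalerBl normrZ mulrC -mulrA ler_pM// ?norm_z_le//.
  rewrite ler_norml; have := ip_csum_le q; rewrite cnorm_P => h.
  have : b * (s - clen q) <= A * s * s by lra.
  have hh : A * s * s <= d * b * s by rewrite ler_wpM2r// ltW.
  move=> /le_trans/(_ hh); rewrite (mulrC d) -mulrA ler_pM2l// => h3.
  by apply/andP; split; [lra|rewrite (le_trans _ (ltW (mulr_gt0 d0 s0)))// subr_le0].
have hwl : `|w - clen q *: z| <= L * d * s.
  rewrite /w csum_mulM /clen scaler_suml -sumrB.
  exact: le_trans (ler_norm_sum _ _ _) hdev.
pose t := `|v - s *: z|.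
have ht : t <= B * d * s.
  have E : v - s *: z = (v - w) + (w - clen q *: z) + (clen q *: z - s *: z).
    by rewrite !addrA !subrK.
  have h1 := ler_normD (v - w + (w - clen q *: z)) (clen q *: z - s *: z).
  have h2 := ler_normD (v - w) (w - clen q *: z).
  rewrite -E -/t in h1.
  have : 12 * C * L ^+ 2 * d * s ^+ 2 <= 12 * C * L ^+ 2 * d * s.
    have c0 : 0 <= 12 * C * L ^+ 2 * d by rewrite !mulr_ge0 ?sqr_ge0 ?(ltW d0).
    by rewrite ler_wpM2l// expr2 ler_piMl// ltW.
  by rewrite /B; lra.
have t0 : 0 <= t by exact: normr_ge0.
have y0 := normr_ge0 y.
have Ls0 : 0 <= L * s by rewrite mulr_ge0// ltW.
pose N := `|y| + 2 * L * s.
have hN0 : 0 <= N by rewrite /N; lra.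
have Nr : N <= rho by rewrite /N; lra.
have yN : `|y| <= N by rewrite lerDl -mulrA mulr_ge0.
have vN : `|v| <= N by rewrite (le_trans hv)// lerDr.
have szN : `|s *: z| <= N.
  by rewrite (le_trans hsz)// /N; lra.
pose p := mul y v; pose p' := mul y (s *: z).
have hpp : `|p - p' - (v - s *: z)| <= C * N * t.
  have := @hC N y y v (s *: z) Nr; rewrite subrr subr0 normr0 add0r.
  exact.
have hCN : C * N * t <= t.
  by rewrite ler_piMl// (le_trans _ hCrho)// ler_wpM2l.
have hp2 : `|p - p'| <= 2 * t.
  by have := ler_normD (p - p' - (v - s *: z)) (v - s *: z); rewrite subrK -/t; lra.
have hp : `|p| <= 2 * N.
  have : `|p| <= 2 * `|y| + `|v|.
    exact: (mul_norm_le rho0 hC hCrho (le_trans yN Nr) (le_trans vN Nr)).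
  by rewrite /N; lra.
have hp' : `|p'| <= 2 * N.
  have : `|p'| <= 2 * `|y| + `|s *: z|.
    exact: (mul_norm_le rho0 hC hCrho (le_trans yN Nr) (le_trans szN Nr)).
  by rewrite /N; lra.
have := hF hy hp hp'; rewrite ler_norml => /andP[_ hFpp].
have hFpp2 : C * (2 * N) * `|p - p'| <= 4 * C * (N * t).
  rewrite [leRHS](_ : _ = C * (2 * N) * (2 * t)); last by ring.
  by rewrite ler_wpM2l// !mulr_ge0.
have hl1 : l (p - p') <= l (v - s *: z) + K * C * (N * t).
  rewrite -lerBlDl -linearB; apply: le_trans (ler_norm _) _.
  apply: le_trans (hK _) _; rewrite -mulrA ler_wpM2l// mulrA//.
have hl2 : l (v - s *: z) <= K * (12 * C * L ^+ 2 * d * s ^+ 2).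
  have -> : v - s *: z = (v - w) + (w - s *: z) by rewrite addrA subrK.
  have -> : l (v - w + (w - s *: z)) = l (v - w) + (ip (csum q) P - s * b).
    by rewrite linearD [l (w - _)]linearB [l (s *: z)]linearZ linear_z hP.
  have h1 : l (v - w) <= K * (12 * C * L ^+ 2 * d * s ^+ 2).
    apply: le_trans (ler_norm _) _; apply: le_trans (hK _) _.
    by rewrite ler_wpM2l.
  have := ip_csum_le q; rewrite cnorm_P.
  have : clen q * b <= s * b by rewrite ler_wpM2r// ltW.
  by lra.
have hNt : N * t <= B * (1 + 2 * L) * d * (s ^+ 2 + s * `|y|).
  have B0 : 0 <= B by rewrite /B addr_ge0 ?mulr_ge0 ?sqr_ge0.
  apply: (@le_trans _ _ (N * (B * d * s))); first by rewrite ler_wpM2l.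
  rewrite (_ : N * (B * d * s) = (B * d) * (N * s)); last by ring.
  rewrite (_ : B * _ * _ * _ =
    (B * d) * ((1 + 2 * L) * (s ^+ 2 + s * `|y|))); last by ring.
  rewrite ler_wpM2l ?mulr_ge0 ?(ltW d0)// /N.
  rewrite -subr_ge0 [leRHS](_ : _ = s ^+ 2 + 2 * L * (s * `|y|)); last by ring.
  by rewrite addr_ge0 ?sqr_ge0// !mulr_ge0 ?(ltW s0).
have hs3 : s ^+ 3 <= d * s ^+ 2 by rewrite exprS ler_wpM2r ?sqr_ge0.
have sy0 : 0 <= s * `|y| by rewrite mulr_ge0 ?(ltW s0).
have hNt2 : (K + 4) * C * (N * t) <=
    (K + 4) * C * (B * (1 + 2 * L) * d * (s ^+ 2 + s * `|y|)).
  by rewrite ler_wpM2l// mulr_ge0// addr_ge0.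
have h9 : 0 <= 12 * K * C * L ^+ 2 * d * (s * `|y|).
  by rewrite !mulr_ge0 ?sqr_ge0 ?(ltW d0) ?(ltW s0).
have h10 : 0 <= d * (s * `|y|) by rewrite mulr_ge0 ?(ltW d0).
rewrite -/v -/p -/p'.
have -> : D * d * (s ^+ 2 + s * `|y|) = K * (12 * C * L ^+ 2 * d * s ^+ 2) +
    12 * K * C * L ^+ 2 * d * (s * `|y|) +
    (K + 4) * C * (B * (1 + 2 * L) * d * (s ^+ 2 + s * `|y|)) +
    (d * s ^+ 2 + d * (s * `|y|)) by rewrite /D; ring.
have eNt : (K + 4) * C * (N * t) = K * C * (N * t) + 4 * C * (N * t) by ring.
clear -hs3 hNt2 h9 h10 hl1 hl2 hFpp hFpp2 eNt.
move: (F p) (F p') (l (p - p')) (l (v - s *: z)) hs3 hNt2 h9 h10 hl1 hl2 hFpp hFpp2 eNt.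
move: (K * C * (N * t)) (4 * C * (N * t)) ((K + 4) * C * (N * t)).
move: (K * (12 * C * L ^+ 2 * d * s ^+ 2)) (d * s ^+ 2) (d * (s * `|y|)).
move: (C * (2 * N) * `|p - p'|) (12 * K * C * L ^+ 2 * d * (s * `|y|)) (s ^+ 3).
move: ((K + 4) * C * (B * (1 + 2 * L) * d * (s ^+ 2 + s * `|y|))).
by move=> *; lra.
Qed.

Lemma backward_straight d : 0 < d -> exists s1, 0 < s1 /\ forall s y, 0 < s ->
  s <= s1 -> `|y| <= s1 ->
  omega y <= - (b * s) - kappa * s ^+ 2 + F (mul y (s *: z)) +
    d * (s ^+ 2 + s * `|y|).
Proof.
move=> d0.
have B0 : 0 <= B by rewrite /B addr_ge0 ?mulr_ge0 ?sqr_ge0.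
have D1 : 1 <= D.
  by rewrite /D lerDr addr_ge0 ?mulr_ge0 ?sqr_ge0 ?addr_ge0 ?mulr_ge0.
have D0 : 0 < D by exact: lt_le_trans D1.
have [e [e0 e1 De]] : exists e, [/\ 0 < e, e <= 1 & D * e <= d].
  exists (Num.min 1 (d / D)); split; first by rewrite lt_min ltr01 divr_gt0.
    by rewrite ge_min lexx.
  by rewrite mulrC -ler_pdivlMr// ge_min lexx orbT.
have A1 : 0 < 2 * A + 1 by rewrite ltr_wpDl// mulr_ge0// A_ge0.
have L1 : 0 < 2 + 4 * L by rewrite ltr_wpDr// mulr_ge0.
pose s1 := Num.min r0 (Num.min kappa (Num.min e (Num.min
  (rho / (2 + 4 * L)) (Num.min (e ^+ 2 * b / (2 * A + 1)) (e * b / (2 * A + 1)))))).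
have s10 : 0 < s1 by rewrite !lt_min r0_gt0 kappa0 e0 !divr_gt0// !mulr_gt0// exprn_gt0.
have [h1 h2 h3 h4] : [/\ s1 <= r0, s1 <= kappa, s1 <= e & s1 * (2 + 4 * L) <= rho].
  by split; rewrite -?ler_pdivlMr// /s1 !ge_min lexx ?orbT.
have [h5 h6] : s1 * (2 * A + 1) <= e ^+ 2 * b /\ s1 * (2 * A + 1) <= e * b.
  by split; rewrite -?ler_pdivlMr// /s1 !ge_min lexx ?orbT.
exists s1; split=> // s y s0 hs hy.
have [q [hq hqy]] := bw s0 (le_trans hs h1).
have Ls : L * s <= L * s1 by rewrite ler_wpM2l.
have L_s0 : 0 <= L * s by rewrite mulr_ge0// ltW.
have As : A * s <= A * s1 by rewrite ler_wpM2l// A_ge0.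
have As0 : 0 <= A * s by rewrite mulr_ge0 ?A_ge0// ltW.
have hy0 := normr_ge0 y.
have hip : b * s - A * s ^+ 2 <= ip (csum q) P.
  apply: backward_chain_ip hq (hqy 0 _) => //; rewrite ?normr0 ?(ltW r0_gt0)//; lra.
have := @straighten_chain_le y q s e s0 e0 e1 hq hip.
have [[k1 k2 k3 k4] [k5 k6]] :
    [/\ 2 * A * s <= e ^+ 2 * b, A * s <= e * b, s <= e & s <= 1] /\
    (2 * (`|y| + 2 * L * s) <= rho /\ 4 * L * s <= rho).
  by split; [split|split]; lra.
move=> /(_ k1 k2 k3 k4 k5 k6) hF2.
have hD : D * e * (s ^+ 2 + s * `|y|) <= d * (s ^+ 2 + s * `|y|).
  by rewrite ler_wpM2r// addr_ge0 ?sqr_ge0// mulr_ge0 ?(ltW s0).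
apply: le_trans (hqy y (le_trans hy h1)) _.
rewrite -[leLHS]addrA -[leRHS]addrA lerD2l -lerBrDr.
by apply: le_trans hF2 _; rewrite lerD2r lerD2l.
Qed.

Lemma forward_straight t y : 0 <= t -> t <= r0 -> `|y| <= r0 ->
  omega y <= b * t - kappa * t ^+ 2 + F (mul y (- (t *: z))).
Proof.
move=> t0 ht hy; have := @fw (t *: xi) y.
by rewrite cnormZ cnorm_xi mulr1 ger0_norm// -scalemxAl; apply.
Qed.

End Core.

(** * From straight steps to a paraboloid touching from above *)

Section Paraboloid.
Context {R : realType} {n r : nat} (G : carnot_group R n r).
Local Notation V := 'rV[R]_n.
Local Notation mul := (cg_mul G).
Variables (C rho L K : R).
Hypotheses (C0 : 0 <= C) (rho0 : 0 < rho) (L0 : 0 <= L) (K0 : 0 <= K).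
Hypothesis hC : forall s x x' y y', s <= rho -> `|x| <= s -> `|x'| <= s ->
  `|y| <= s -> `|y'| <= s ->
  `|mul x y - mul x' y' - (x - x') - (y - y')| <=
      C * s * (`|x - x'| + `|y - y'|).
Hypothesis hCrho : C * rho <= 1.
Variables (F : V -> R) (l : {linear V -> R}).
Hypothesis hF : forall s p p', s <= rho -> `|p| <= s -> `|p'| <= s ->
  `|F p - F p' - l (p - p')| <= C * s * `|p - p'|.
Hypothesis hK : forall v, `|l v| <= K * `|v|.
Hypothesis F0 : F 0 = 0.
Variables (omega : V -> R) (b kappa : R) (z : V).
Hypotheses (b0 : 0 < b) (kappa0 : 0 < kappa) (hz : `|z| <= L) (lz : l z = b).
Variable r0 : R.
Hypothesis r0_gt0 : 0 < r0.
Hypothesis fw : forall t y, 0 <= t -> t <= r0 -> `|y| <= r0 ->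
  omega y <= b * t - kappa * t ^+ 2 + F (mul y (- (t *: z))).
Hypothesis bw : forall d, 0 < d -> exists s1, 0 < s1 /\ forall s y, 0 < s ->
  s <= s1 -> `|y| <= s1 ->
  omega y <= - (b * s) - kappa * s ^+ 2 + F (mul y (s *: z)) +
    d * (s ^+ 2 + s * `|y|).

(** [y - t *: z] lies in the kernel of [l], so [F] has no first-order part there. Comparing
    [mul y (- (t *: z))] with [mul (t *: z) (- (t *: z)) = 0] makes every error vanish together with
    [y - t *: z]. *)
Lemma transverse_le t y : l y = b * t -> `|y| + L * `|t| <= rho ->
  2 * `|y - t *: z| <= rho ->
  F (mul y (- (t *: z))) <= 2 * K * C * L * (`|t| * `|y - t *: z|) +
    (K * C + 4 * C) * `|y - t *: z| ^+ 2.
Proof.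
move=> hly hN hy'.
set y' := y - t *: z in hy' *.
have htz : `|t *: z| <= L * `|t| by rewrite normrZ mulrC ler_wpM2r.
have t0 := normr_ge0 t; have y0 := normr_ge0 y; have y'0 := normr_ge0 y'.
have Lt0 : 0 <= L * `|t| by rewrite mulr_ge0.
pose N := `|y| + L * `|t|.
pose h := mul y (- (t *: z)).
have h1 : `|h - y'| <= C * N * `|y'|.
  have := @hC N y (t *: z) (- (t *: z)) (- (t *: z)) hN.
  rewrite cg_mulxN subrr normr0 addr0 !subr0 normrN; apply; rewrite /N; lra.
have N0 : 0 <= N by rewrite /N addr_ge0.
have hCN : C * N * `|y'| <= 1 * `|y'|.
  by rewrite ler_wpM2r// (le_trans _ hCrho)// ler_wpM2l.
have h2 : `|h| <= 2 * `|y'| by have := ler_normD (h - y') y'; rewrite subrK; lra.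
have h3 : F h <= l h + C * `|h| ^+ 2.
  have := @hF `|h| h 0 (le_trans h2 hy') (lexx _).
  rewrite normr0 => /(_ (normr_ge0 _)).
  rewrite F0 !subr0 ler_norml => /andP[_]; rewrite expr2 mulrA => h4.
  by lra.
have h4 : C * `|h| ^+ 2 <= 4 * C * `|y'| ^+ 2.
  rewrite [leRHS](_ : _ = C * (2 * `|y'|) ^+ 2); last by ring.
  by rewrite ler_wpM2l// ler_pXn2r// nnegrE// mulr_ge0.
have ly' : l y' = 0 by rewrite linearB linearZ/= lz hly [_ *: _]mulrC subrr.
have h5 : l h <= K * (C * N * `|y'|).
  rewrite -(subr0 (l h)) -ly' -linearB; apply: le_trans (ler_norm _) _.
  by apply: le_trans (hK _) _; rewrite ler_wpM2l.
have hNN : N <= `|y'| + 2 * L * `|t|.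
  have := ler_normD y' (t *: z); rewrite subrK /N; lra.
have h6 : K * (C * N * `|y'|) <= K * (C * (`|y'| + 2 * L * `|t|) * `|y'|).
  by rewrite ler_wpM2l// ler_wpM2r// ler_wpM2l.
by lra.
Qed.

(** With [t = l y / b], right multiplication by [- (t *: z)] brings [y] into the kernel of [l] to
    first order. This uses the forward bound if t >= 0 and the backward bound of length -t if t < 0.
    Half of [kappa] survives: a quarter is spent on the error with coefficient [d], a quarter on
    absorbing the mixed term in |t| and |y'| by AM-GM. *)
Lemma paraboloid_above : exists C', exists2 rr, 0 < rr & forall y, `|y| <= rr ->
  omega y <= l y - kappa / 2 * (l y / b) ^+ 2 +
    C' * `|y - (l y / b) *: z| ^+ 2.
Proof.
have L1 : 0 < 1 + L by rewrite ltr_pwDl.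
pose d := kappa / (4 * (1 + L)).
have d0 : 0 < d by rewrite divr_gt0// mulr_gt0.
have [s1 [s10 hbw]] := bw d0.
pose Q := K / b.
have Q0 : 0 <= Q by rewrite divr_ge0// ltW.
pose e := Num.min r0 (Num.min s1 (rho / 2)).
have e0 : 0 < e by rewrite !lt_min r0_gt0 s10 divr_gt0.
have [e1 e2 e3] : [/\ e <= r0, e <= s1 & e <= rho / 2].
  by split; rewrite /e !ge_min lexx ?orbT.
have QL : 0 < (1 + Q) * (1 + L) by rewrite mulr_gt0// ltr_pwDl.
pose rr := e / ((1 + Q) * (1 + L)).
have rr0 : 0 < rr by rewrite divr_gt0.
have hrr : rr * ((1 + Q) * (1 + L)) = e by rewrite /rr divfK// gt_eqF.
pose C1 := 2 * K * C * L + d.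
exists (K * C + 4 * C + C1 ^+ 2 / kappa), rr => // y hy.
set t := l y / b; set y' := y - t *: z.
have hly : l y = b * t by rewrite /t mulrC divfK// gt_eqF.
have ht : `|t| <= Q * rr.
  rewrite /t normrM normfV (gtr0_norm b0) ler_pdivrMr// /Q.
  rewrite mulrAC divfK ?gt_eqF// (le_trans (hK _))// ler_wpM2l//.
have p1 : 0 <= Q * rr by rewrite mulr_ge0// ltW.
have p2 : 0 <= L * rr by rewrite mulr_ge0// ltW.
have p3 : 0 <= L * (Q * rr) by rewrite mulr_ge0.
have hLt : L * `|t| <= L * (Q * rr) by rewrite ler_wpM2l.
have y'le : `|y'| <= `|y| + L * `|t|.
  rewrite (le_trans (ler_normB _ _))// lerD2l normrZ mulrC ler_wpM2r//.
have hN : `|y| + L * `|t| <= e by lra.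
have := @transverse_le t y hly.
rewrite -/y' => /(_ _ _)/wrap[|| hFt]; [lra|lra|].
have y'0 := normr_ge0 y'; have t0 := normr_ge0 t.
have hyL : `|y| <= `|y'| + L * `|t|.
  have := ler_normD y' (t *: z); rewrite subrK => /le_trans; apply.
  by rewrite lerD2l normrZ mulrC ler_wpM2r.
have sqt : `|t| ^+ 2 = t ^+ 2 by rewrite real_normK// num_real.
have key : omega y <= b * t - kappa * t ^+ 2 + F (mul y (- (t *: z))) +
    d * (`|t| ^+ 2 + `|t| * `|y|).
  have [tge0|tlt0] := leP 0 t.
    have : 0 <= d * (`|t| ^+ 2 + `|t| * `|y|).
      by rewrite mulr_ge0 ?(ltW d0)// addr_ge0 ?sqr_ge0 ?mulr_ge0.
    have := @fw t y tge0; rewrite (ger0_norm tge0) in ht.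
    by move=> /(_ _ _)/wrap[||]; [lra|lra|lra].
  have := @hbw (- t) y; rewrite oppr_gt0 => /(_ tlt0).
  rewrite scaleNr (ltr0_norm tlt0) in ht *.
  by move=> /(_ _ _)/wrap[||]; [lra|lra|lra].
have hd : d * (`|t| ^+ 2 + `|t| * `|y|) <= kappa / 4 * t ^+ 2 + d * (`|t| * `|y'|).
  have : `|t| * `|y| <= `|t| * (`|y'| + L * `|t|) by rewrite ler_wpM2l.
  move=> h; have : d * (`|t| ^+ 2 + `|t| * `|y|) <=
      d * (`|t| ^+ 2 + `|t| * (`|y'| + L * `|t|)).
    by rewrite ler_wpM2l ?(ltW d0)// lerD2l.
  move=> /le_trans; apply; rewrite -sqt le_eqVlt; apply/orP; left; apply/eqP.
  by rewrite /d; field; rewrite gt_eqF.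
have amgm : C1 * (`|t| * `|y'|) <=
    kappa / 4 * t ^+ 2 + C1 ^+ 2 / kappa * `|y'| ^+ 2.
  rewrite -sqt -subr_ge0 [leRHS](_ : _ =
    kappa * (`|t| / 2 - C1 * `|y'| / kappa) ^+ 2).
    by rewrite mulr_ge0 ?sqr_ge0 ?(ltW kappa0).
  by field; rewrite gt_eqF.
rewrite hly; rewrite /C1 in amgm *.
by lra.
Qed.

End Paraboloid.

(** * Left-invariant fields and quadratic test functions *)

Section Lines.
Context {R : realType}.

Lemma derive_line {V W : normedModType R} (g : V -> W) x v :
  'D_v g x = 'D_1 (fun h : R => g (x + h *: v)) 0.
Proof.
rewrite /derive.
suff -> : (fun h : R => h^-1 *: ((g \o shift x) (h *: v) - g x)) =
  (fun h : R => h^-1 *: (((fun h : R => g (x + h *: v)) \o shift 0) (h *: 1)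
    - g (x + 0 *: v))) by [].
apply/funext => h /=; rewrite scale0r !addr0 [h%:A]mulr1 [x + _]addrC //.
Qed.

Lemma is_derive_poly2 (a b c t : R) :
  is_derive t 1 (fun h : R => a + b * h + c * h ^+ 2) (b + 2 * c * t).
Proof.
have h1 : is_derive t 1 (fun h : R => h) 1 by exact: is_derive_id.
have h2 : is_derive t 1 (fun h : R => h ^+ 2) (2%:R *: t ^+ 1 *: 1).
  exact: (DeriveDef (@exprn_derivable _ 2 t 1) (@exp_derive _ 2 t 1)).
have h3 := is_deriveD (is_deriveD (is_derive_cst a t 1) (is_deriveZ b h1))
  (is_deriveZ c h2).
have E : 0 + b *: 1 + c *: (2%:R *: t ^+ 1 *: 1) = b + 2 * c * t :> R.
  rewrite add0r -[b *: 1]/(b * 1) -[c *: _]/(c * (2 * t ^+ 1 * 1)) expr1; ring.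
by rewrite E in h3.
Qed.

Lemma derive_poly2 (a b c t : R) (g : R -> R) :
  (forall h, g h = a + b * h + c * h ^+ 2) -> 'D_1 g t = b + 2 * c * t.
Proof.
move=> /funext ->; exact: (@derive_val _ _ _ _ _ _ _ (is_derive_poly2 a b c t)).
Qed.

Lemma differentiable_near {V W : normedModType R} (f g : V -> W) x :
  (\forall y \near x, f y = g y) -> differentiable f x -> differentiable g x.
Proof.
move=> fg /diff_locallyP[cdf Ef].
have E : g \o shift x = cst (g x) + 'd f x +o_ 0 id.
  apply/eqaddoP => eps eps0; move/eqaddoP : Ef => /(_ _ eps0).
  have fgx : f x = g x by exact: nbhs_singleton fg.
  have : \forall h \near (0 : V), f (h + x) = g (h + x).
    have c : h + x @[h --> (0 : V)] --> x.
      rewrite -{2}(add0r x); apply: cvgD; [exact: cvg_id|exact: cvg_cst].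
    exact: (c _ fg).
  apply: filterS2 => h E1 /=.
  by rewrite !fctE /= -E1 -fgx.
by apply/diff_locallyP; rewrite (diff_unique cdf E).
Qed.

Lemma Ck_ext {V W : normedModType R} k (A : set V) (f g : V -> W) : open A ->
  (forall x, A x -> f x = g x) -> Ck k A f -> Ck k A g.
Proof.
move=> oA; elim: k f g => [|k IH] f g fg.
  move=> hf x Ax B; rewrite -(fg x Ax) => /(hf x Ax) hB.
  have hA : \forall y \near x, A y by apply: open_nbhs_nbhs; split.
  by apply: filterS2 hA hB => y Ay /=; rewrite fg.
move=> [h1 h2]; have near_fg x : A x -> \forall y \near x, f y = g y.
  move=> Ax; have : \forall y \near x, A y by apply: open_nbhs_nbhs; split.
  by apply: filterS => y; exact: fg.
split=> [x Ax|v]; first exact: differentiable_near (near_fg x Ax) (h1 x Ax).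
by apply: IH (h2 v) => x Ax; apply: near_eq_derive; exact: near_fg.
Qed.

Lemma CkN {V W : normedModType R} k (A : set V) (f : V -> W) : open A ->
  Ck k A f -> Ck k A (fun x => - f x).
Proof.
move=> oA; elim: k f => [|k IH] f.
  by move=> hf x Ax; apply: cvgN; exact: hf.
move=> [h1 h2]; split=> [x Ax|v]; first exact: differentiableN (h1 x Ax).
apply: (Ck_ext oA _ (IH _ (h2 v))) => x Ax.
by rewrite (deriveN (diff_derivable (h1 x Ax))).
Qed.

End Lines.

Section LeftInvariantFields.
Context {R : realType} {n r : nat} (G : carnot_group R n r).
Local Notation V := 'rV[R]_n.
Local Notation mul := (cg_mul G).

Lemma differentiable_mul (x y : V) : differentiable (mul x) y.
Proof. exact: ((Ck_mulx G 1 x).1 y I). Qed.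

Lemma left_fieldE (v x : V) : left_field mul v x = 'd (mul x) 0 v.
Proof. by rewrite /left_field deriveE//; exact: differentiable_mul. Qed.

(** Chain rule along [t |-> mul x (t *: v)], whose velocity at 0 is the value of the field at [x].
    Derivatives along fields become derivatives in one real variable. *)
Lemma vf_apply_left (phi : V -> R) (v x : V) : differentiable phi x ->
  vf_apply (left_field mul v) phi x = 'D_1 (fun t : R => phi (mul x (t *: v))) 0.
Proof.
move=> dphi; pose g (t : R) := mul x (t *: v).
have g0 : g 0 = x by rewrite /g scale0r cg_mulx0.
have dg : differentiable g 0.
  apply: (@differentiable_comp _ _ _ _ (fun t : R => t *: v) (mul x)).
    exact: ex_diff.
  exact: differentiable_mul.
rewrite -[RHS]/('D_1 (phi \o g) 0) deriveE; last first.
  by apply: differentiable_comp => //; rewrite g0.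
rewrite diff_comp ?g0// /= /vf_apply deriveE//; congr ('d _ _ _).
rewrite -(deriveE (1 : R) dg) /left_field (derive_line (mul x) 0).
by under eq_fun do rewrite add0r.
Qed.

Lemma vf_apply_left_sum N (c : 'I_N -> R) (v : 'I_N -> V) (phi : V -> R) x :
  differentiable phi x ->
  \sum_i c i * vf_apply (left_field mul (v i)) phi x =
  vf_apply (left_field mul (\sum_i c i *: v i)) phi x.
Proof.
move=> dphi; rewrite /vf_apply (deriveE _ dphi) left_fieldE !linear_sum.
by apply: eq_bigr => i _; rewrite (deriveE _ dphi) left_fieldE !linearZ.
Qed.

Lemma Ck_left_field (v : V) : Ck 1 setT (left_field mul v).
Proof.
have -> : left_field mul v = fun x => 'D_((0, v) : V * V)
    (fun z : V * V => mul z.1 z.2) (x, 0).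
  by apply/funext => y; rewrite /left_field -derive_pairr.
apply: (@Ck_pairl R V V V 1 (fun w => 'D_((0, v) : V * V)
  (fun z : V * V => mul z.1 z.2) w) 0).
exact: ((cg_smooth G 2).2 (0, v)).
Qed.

Lemma vf_apply_differentiable (A : set V) (v : V) (phi : V -> R) x : open A ->
  Ck 2 A phi -> A x -> differentiable (vf_apply (left_field mul v) phi) x.
Proof.
move=> oA [dphi ddphi] Ax.
pose g (y : V) := \sum_(i < n) (left_field mul v y 0 i * 'D_(delta_mx 0 i) phi y).
have E : \forall y \near x, g y = vf_apply (left_field mul v) phi y.
  have : \forall y \near x, A y by apply: open_nbhs_nbhs; split.
  apply: filterS => y Ay; rewrite /vf_apply deriveE; last exact: dphi.
  rewrite /g {2}[left_field mul v y]row_sum_delta linear_sum.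
  by apply: eq_bigr => i _; rewrite linearZ deriveE//; exact: dphi.
apply: (differentiable_near E).
rewrite /g (_ : (fun y => _) = \sum_(i < n)
  ((fun y => left_field mul v y 0 i) * 'D_(delta_mx 0 i) phi)); last first.
  by apply/funext => y; rewrite fct_sumE.
apply: differentiable_sum => i; apply: differentiableM.
  exact: ((Ck_coord 0 i (Ck_left_field v)).1 x I).
exact: ((ddphi _).1 x Ax).
Qed.

End LeftInvariantFields.

(** * Quadratic test functions and the Aronsson operator on them *)

Section TestFunction.
Context {R : realType} {n r m : nat} (G : carnot_group R n r).
Local Notation V := 'rV[R]_n.
Local Notation mul := (cg_mul G).
Variables (e : m.-tuple V) (S : 'M[R]_m) (f : 'rV[R]_m -> R).
Hypotheses (S_sym : S^T = S) (hf : forall p, f p = 2^-1 * ip S p p).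

Definition frame_mx : 'M[R]_(m, n) := \matrix_(i < m) tnth e i.

Lemma partial_quadratic i p : partial f i p = (p *m S) 0 i.
Proof.
rewrite /partial derive_line (derive_poly2 (a := 2^-1 * ip S p p)
  (b := ip S p (delta_mx 0 i)) (c := 2^-1 * ip S (delta_mx 0 i) (delta_mx 0 i))).
  by rewrite mulr0 addr0 /ip trmx_delta -colE mxE.
move=> h; rewrite hf !(ipDl, ipDr, ipZl, ipZr) (ipC S_sym (delta_mx 0 i) p).
by field.
Qed.

Variables (x0 : V) (u0 : R) (l : {linear V -> R}) (z : V) (k1 k2 : R).

(** It is used with [l z = 1], when [y - l y *: z] is the projection of [y] onto the kernel of [l]
    along [z]. *)
Definition paraboloid (y : V) : R :=
  l y - k1 * l y ^+ 2 + k2 * sqn (y - l y *: z).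

Definition test_function (x : V) : R := u0 + paraboloid (mul (- x0) x).

Lemma paraboloid_line v t : paraboloid (t *: v) =
  0 + l v * t + (- k1 * l v ^+ 2 + k2 * sqn (v - l v *: z)) * t ^+ 2.
Proof.
rewrite /paraboloid.
have -> : l (t *: v) = t * l v by rewrite linearZ.
have -> : sqn (t *: v - (t * l v) *: z) = t ^+ 2 * sqn (v - l v *: z).
  rewrite /sqn mulr_sumr; apply: eq_bigr => i _; rewrite !mxE; ring.
by ring.
Qed.

Lemma Ck_linear {U : normedModType R} k (g : U -> V) :
  Ck k setT g -> Ck k setT (fun x => l (g x)).
Proof.
move=> hg.
have -> : (fun x => l (g x)) = fun x => \sum_(i < n) (g x 0 i * l (delta_mx 0 i)).
  apply/funext => x; rewrite {1}[g x]row_sum_delta linear_sum.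
  by apply: eq_bigr => i _; rewrite linearZ.
apply: Ck_sum => i; apply: CkM; [exact: Ck_coord|exact: Ck_cst].
Qed.

Lemma Ck_test_function k : Ck k setT test_function.
Proof.
have hg := Ck_mulx G k (- x0); have hl := Ck_linear hg.
apply: CkD; first exact: Ck_cst.
apply: CkD.
  apply: CkD => //.
  rewrite (_ : (fun x => - _) = fun x => - k1 * (l (mul (- x0) x) * l (mul (- x0) x))).
    by apply: CkM; [exact: Ck_cst|exact: CkM].
  by apply/funext => x; rewrite expr2 mulNr.
apply: CkM; first exact: Ck_cst.
have hi i : Ck k setT (fun x => mul (- x0) x 0 i + l (mul (- x0) x) * - z 0 i).
  apply: CkD; first exact: Ck_coord.
  by apply: CkM => //; exact: Ck_cst.
rewrite (_ : (fun x => sqn _) = fun x => \sum_(i < n)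
  ((mul (- x0) x 0 i + l (mul (- x0) x) * - z 0 i) *
   (mul (- x0) x 0 i + l (mul (- x0) x) * - z 0 i))).
  by apply: Ck_sum => i; exact: CkM.
apply/funext => x; rewrite /sqn; apply: eq_bigr => i _.
by rewrite !mxE mulrN expr2.
Qed.

Lemma differentiable_test_function x : differentiable test_function x.
Proof. exact: ((Ck_test_function 1).1 x I). Qed.

Let P : 'rV[R]_m := \row_i l (tnth e i).

Lemma hgrad_test_function : hgrad G e test_function x0 = P.
Proof.
apply/rowP => i; rewrite !mxE /Xf vf_apply_left; last first.
  exact: differentiable_test_function.
have E h : test_function (mul x0 (h *: tnth e i)) = u0 + l (tnth e i) * h +
    (- k1 * l (tnth e i) ^+ 2 + k2 * sqn (tnth e i - l (tnth e i) *: z)) * h ^+ 2.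
  by rewrite /test_function cg_mulKx paraboloid_line add0r addrA.
by rewrite (derive_poly2 0 E) mulr0 addr0.
Qed.

(** Along a one-parameter subgroup through [x0] the test function is exactly a quadratic polynomial
    in [t], because exponential coordinates make the subgroup a line; no bracket terms appear. *)
Lemma vf_apply2_test_function v :
  vf_apply (left_field mul v) (vf_apply (left_field mul v) test_function) x0 =
  2 * (- k1 * l v ^+ 2 + k2 * sqn (v - l v *: z)).
Proof.
rewrite vf_apply_left; last first.
  by apply: (@vf_apply_differentiable _ _ _ _ setT) => //;
    [exact: openT|exact: Ck_test_function].
set c := - k1 * _ + _.
have E t : vf_apply (left_field mul v) test_function (mul x0 (t *: v)) =
    l v + (2 * c) * t + 0 * t ^+ 2.
  rewrite vf_apply_left; last exact: differentiable_test_function.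
  have F h : test_function (mul (mul x0 (t *: v)) (h *: v)) =
      (u0 + l v * t + c * t ^+ 2) + (l v + 2 * c * t) * h + c * h ^+ 2.
    rewrite -cg_mulA cg_exp /test_function cg_mulKx paraboloid_line -/c.
    by ring.
  by rewrite (derive_poly2 0 F) mulr0 addr0 mul0r addr0.
by rewrite (derive_poly2 0 E) mulr0 addr0.
Qed.

(** At [x0] the coefficients f_{p_i} are the numbers (P S)_i, so the operator is minus the second
    derivative along the one left-invariant field with value [zeta] at 0. Symmetrising the
    horizontal Hessian does not change its quadratic form. *)
Lemma aronsson_test_function :
  let zeta := P *m (S *m frame_mx) in
  aronsson G e f test_function x0 =
    - (2 * (- k1 * l zeta ^+ 2 + k2 * sqn (zeta - l zeta *: z))).
Proof.
move=> zeta; rewrite -vf_apply2_test_function /aronsson hgrad_test_function.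
congr (- _).
pose a i := (P *m S) 0 i.
pose X i := vf_apply (left_field mul (tnth e i)).
have hzeta : zeta = \sum_i a i *: tnth e i.
  rewrite /zeta mulmxA mulmx_sum_row; apply: eq_bigr => i _.
  by rewrite rowK.
pose H i j := X i (X j test_function) x0.
pose A := \sum_i \sum_j a i * (a j * H i j).
pose B := \sum_i \sum_j a i * (a j * H j i).
have -> : vf_apply (left_field mul zeta)
    (vf_apply (left_field mul zeta) test_function) x0 = A.
  have -> : vf_apply (left_field mul zeta) test_function =
      (fun x => \sum_i a i * X i test_function x).
    apply/funext => x; rewrite hzeta -vf_apply_left_sum//.
    exact: differentiable_test_function.
  have dX i : differentiable (X i test_function) x0.
    by apply: (@vf_apply_differentiable _ _ _ _ setT) => //;
    [exact: openT|exact: Ck_test_function].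
  rewrite {1}hzeta -vf_apply_left_sum; last first.
    rewrite (_ : (fun x => _) = \sum_i (a i *: X i test_function)).
      by apply: differentiable_sum => i; exact: differentiableZ.
    by apply/funext => x; rewrite fct_sumE.
  apply: eq_bigr => i _; rewrite -mulr_sumr; congr (_ * _).
  rewrite (_ : (fun x => _) = \sum_i (a i *: X i test_function)); last first.
    by apply/funext => x; rewrite fct_sumE.
  rewrite /vf_apply derive_sum; last first.
    by move=> j; apply: derivableZ; exact: diff_derivable.
  apply: eq_bigr => j _; rewrite deriveZ//; exact: diff_derivable.
have AB : B = A.
  rewrite /B exchange_big /=; apply: eq_bigr => i _; apply: eq_bigr => j _.
  by rewrite mulrCA.
apply: (@eq_trans _ _ (2^-1 * (A + B))); last first.
  by rewrite AB; clear; move: A => A; field.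
rewrite /A /B -big_split mulr_sumr; apply: eq_bigr => i _ /=.
rewrite -big_split mulr_sumr; apply: eq_bigr => j _ /=.
have -> : hhess G e test_function x0 i j = 2^-1 * (H i j + H j i) by rewrite mxE.
rewrite !partial_quadratic -/(a i) -/(a j).
by move: (H i j) (H j i) (a i) (a j) => *; ring.
Qed.

End TestFunction.

Section NoTouch.
Context {R : realType} {n r m : nat} (G : carnot_group R n r).
Local Notation V := 'rV[R]_n.
Local Notation mul := (cg_mul G).
Variables (e : m.-tuple V) (S : 'M[R]_m) (f : 'rV[R]_m -> R).
Hypotheses (S_sym : S^T = S) (hf : forall p, f p = 2^-1 * ip S p p).
Hypothesis (S_pos : forall c, c != 0 -> 0 < ip S c c).
Let M := S *m frame_mx e.
Variable L : R.
Hypotheses (L0 : 0 <= L) (hL : forall c, `|c *m M| <= L * cnorm S c).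
Variables (Omega : set V) (u : V -> R).
Hypothesis usub : viscosity_subsolution G e f Omega u.

(** Here [zeta] is [P *m M], a multiple of the axis [zz] of the paraboloid, so the transverse term
    vanishes however large its coefficient. What remains is 2 k1 b^4 = kappa b^2 > 0, against the
    subsolution property. *)
Lemma subsolution_not_touched (x0 : V) (F : V -> R) (l : {linear V -> R})
    (b kappa r0 : R) :
  Omega x0 -> quad_approx F 0 l -> F 0 = 0 -> 0 < b -> 0 < kappa -> 0 < r0 ->
  (forall c y, cnorm S c <= r0 -> `|y| <= r0 ->
    u (mul x0 y) - u x0 <=
      b * cnorm S c - kappa * cnorm S c ^+ 2 + F (mul y (- (c *m M)))) ->
  (forall s, 0 < s -> s <= r0 -> exists q, clen S q <= s /\
    forall y, `|y| <= r0 -> u (mul x0 y) - u x0 <=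
      - (b * s) - kappa * s ^+ 2 + F (mul y (chain G M q)) + s ^+ 3) ->
  False.
Proof.
move=> Ox0 [K [C1 [rho1 [K0 C10 rho10 hK hF]]]] F0 b0 k0 r00 fw bw.
have [C2 [rho2 [C20 rho20 hC]]] := mul_expand G.
pose C := Num.max C1 C2.
have CC1 : C1 <= C by rewrite le_max lexx.
have CC2 : C2 <= C by rewrite le_max lexx orbT.
have C0 : 0 <= C by rewrite (le_trans C10).
have C1' : 0 < C + 1 by rewrite ltr_wpDl.
have [rho [rho0 h1 h2 hCrho]] : exists rho, [/\ 0 < rho, rho <= rho1,
    rho <= rho2 & C * rho <= 1].
  exists (Num.min rho1 (Num.min rho2 (C + 1)^-1)); split.
  - by rewrite !lt_min rho10 rho20 invr_gt0.
  - by rewrite ge_min lexx.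
  - by rewrite !ge_min lexx !orbT.
  rewrite (@le_trans _ _ (C * (C + 1)^-1))//.
    by rewrite ler_wpM2l// !ge_min lexx !orbT.
  by rewrite ler_pdivrMr// mul1r lerDl.
have hC' s x x' y y' : s <= rho -> `|x| <= s -> `|x'| <= s -> `|y| <= s ->
    `|y'| <= s -> `|mul x y - mul x' y' - (x - x') - (y - y')| <=
      C * s * (`|x - x'| + `|y - y'|).
  move=> hs hx hx' hy hy'; have := hC s _ _ _ _ (le_trans hs h2) hx hx' hy hy'.
  move=> /le_trans; apply; rewrite ler_wpM2r ?addr_ge0// ler_wpM2r//.
  exact: le_trans hx.
have hF' s p p' : s <= rho -> `|p| <= s -> `|p'| <= s ->
    `|F p - F p' - l (p - p')| <= C * s * `|p - p'|.
  move=> hs hp hp'; have := hF s p p' (le_trans hs h1).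
  rewrite !subr0 => /(_ hp hp')/le_trans; apply; rewrite ler_wpM2r// ler_wpM2r//.
  exact: le_trans hp.
pose P : 'rV[R]_m := \row_i l (tnth e i).
(* This is why a step is [c *m S *m frame_mx e]: its pairing with the gradient becomes the inner
   product of [S]. *)
have hP c : l (c *m M) = ip S c P.
  rewrite /M mulmxA mulmx_sum_row linear_sum /ip mxE; apply: eq_bigr => i _.
  by rewrite linearZ rowK !mxE.
pose om y := u (mul x0 y) - u x0.
have om0 : om 0 = 0 by rewrite /om cg_mulx0 subrr.
have nP := cnorm_P S_sym S_pos C0 rho0 L0 K0 hC' hCrho hL hF' hK F0 hP b0 k0 om0
  r00 fw bw.
have := @paraboloid_above _ _ _ G C rho L K C0 rho0 L0 K0 hC' hCrho F l hF' hK F0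
  om b kappa (b^-1 *: P *m M) b0 k0.
have hz := norm_z_le S_sym S_pos C0 rho0 L0 K0 hC' hCrho hL hF' hK F0 hP b0 k0 om0
  r00 fw bw.
have lz := linear_z S_sym S_pos C0 rho0 L0 K0 hC' hCrho hL hF' hK F0 hP b0 k0 om0
  r00 fw bw.
have bws := backward_straight S_sym S_pos C0 rho0 L0 K0 hC' hCrho hL hF' hK F0 hP b0 k0 om0
  r00 fw bw.
have fws := forward_straight S_sym S_pos C0 rho0 L0 K0 hC' hCrho hL hF' hK F0 hP b0 k0 om0
  r00 fw bw.
move=> /(_ hz lz r0 r00 fws bws) [k2 [rr rr0 hpar]].
pose zz := b^-1 *: (b^-1 *: P *m M).
pose k1 := kappa / 2 / b ^+ 2.
(* The absolute value makes the transverse coefficient nonnegative, so that the max norm of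
   [paraboloid_above] may be enlarged to [sqn]. *)
pose psi := test_function G x0 (u x0) l zz k1 `|k2|.
have psi0 : psi x0 = u x0.
  rewrite /psi /test_function cg_mulNx -(scale0r 0) paraboloid_line.
  by rewrite !(mulr0, expr0n, addr0).
have near_max : \forall x \near x0, u x - psi x <= u x0 - psi x0.
  have : \forall x \near x0, `|mul (- x0) x| < rr.
    have cm : {for x0, continuous (mul (- x0))} by exact: (Ck_mulx G 0 (- x0) x0 I).
    by have := cvgr_norm_lt _ cm; rewrite cg_mulNx normr0; apply.
  apply: filterS => x hx; rewrite psi0 subrr subr_le0 /psi /test_function.
  rewrite -lerBlDl.
  have := hpar _ (ltW hx); rewrite /om cg_mulNKx => /le_trans; apply.
  rewrite /paraboloid.
  set y := mul (- x0) x.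
  have -> : (l y / b) *: (b^-1 *: P *m M) = l y *: zz by rewrite scalerA.
  have -> : kappa / 2 * (l y / b) ^+ 2 = k1 * l y ^+ 2.
    by rewrite /k1; field; rewrite gt_eqF.
  rewrite lerD2l (@le_trans _ _ (`|k2| * `|y - l y *: zz| ^+ 2))//.
    by rewrite ler_wpM2r ?sqr_ge0// ler_norm.
  by rewrite ler_wpM2l// sqr_norm_le_sqn.
have psi_C2 : Ck 2 Omega psi.
  exact: Ck_subset (@subsetT _ _) (Ck_test_function G x0 (u x0) l zz k1 _ 2).
have := usub psi_C2 Ox0 near_max.
rewrite (@aronsson_test_function _ _ _ _ G e S f S_sym hf)/=.
have lzeta : l (P *m M) = b ^+ 2 by rewrite hP -nP sqr_cnorm.
rewrite -/P -/M lzeta.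
have -> : b ^+ 2 *: zz = P *m M.
  rewrite /zz -scalemxAl !scalerA (_ : _ * _ = 1) ?scale1r//.
  by field; rewrite gt_eqF.
rewrite subrr.
have -> : sqn (0 : V) = 0 by rewrite /sqn big1// => i _; rewrite mxE expr0n.
rewrite mulr0 addr0 mulNr mulrN opprK leNgt => /negP; apply.
by rewrite !mulr_gt0 ?exprn_gt0 ?invr_gt0// exprn_gt0.
Qed.

End NoTouch.

(** * Reachable sets *)

Section Topology.
Context {R : realType}.

Lemma closure_sub_closed (T : topologicalType) (A D : set T) :
  closed D -> A `<=` D -> closure A `<=` D.
Proof. by move=> cD AD x /(closureS AD)/cD. Qed.

Lemma compact_norm_le n (c : R) : compact [set v : 'rV[R]_n | `|v| <= c].
Proof.
apply: bounded_closed_compact.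
  exists c; split; first exact: num_real.
  by move=> d cd v /= /le_trans; apply; exact: ltW.
apply: (@closed_comp _ _ (fun v : 'rV[R]_n => `|v|) [set x | x <= c]).
  by move=> v _; exact: norm_continuous.
exact: closed_le.
Qed.

Lemma cvg_sqn {T : Type} {F : set_system T} {FF : Filter F} n (g : T -> 'rV[R]_n) a :
  g x @[x --> F] --> a -> sqn (g x) @[x --> F] --> sqn a.
Proof.
move=> h; apply: (cvg_comp g (fun v => sqn v)); first exact: h.
exact: (Ck_sqn (@Ck_id _ _ 0) (a) I).
Qed.

Lemma cvg_cg_mul {T : Type} {F : set_system T} {FF : Filter F} n r
    (G : carnot_group R n r) (g h : T -> 'rV[R]_n) a b :
  g x @[x --> F] --> a -> h x @[x --> F] --> b ->
  cg_mul G (g x) (h x) @[x --> F] --> cg_mul G a b.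
Proof.
move=> ga hb.
have gh : (g x, h x) @[x --> F] --> (a, b).
  exact: (cvg_pair ga hb).
exact: (cvg_comp _ _ gh (@cg_mul_continuous _ _ _ G (a, b))).
Qed.

End Topology.

Section Reachable.
Context {R : realType} {n r m : nat} (G : carnot_group R n r).
Local Notation V := 'rV[R]_n.
Local Notation mul := (cg_mul G).
Variables (S : 'M[R]_m) (M : 'M[R]_(m, n)) (L rho : R).
Hypotheses (rho0 : 0 < rho) (L0 : 0 <= L).
Hypothesis chain_le : forall s, 2 * L * clen S s <= rho ->
  `|chain G M s| <= 2 * L * clen S s.

(** It plays the role of the closed ball of radius [t] about 0 for the length [cnorm]. The closure
    makes it compact when small, so that maxima are attained. *)
Definition reach (t : R) : set V :=
  closure [set k | exists2 s, clen S s <= t & k = chain G M s].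

Lemma chain_reach s t : clen S s <= t -> reach t (chain G M s).
Proof. by move=> hs; apply: subset_closure; exists s. Qed.

Lemma reach_le t k : 2 * L * t <= rho -> reach t k -> `|k| <= 2 * L * t.
Proof.
move=> ht; apply: (closure_sub_closed (D := [set k | `|k| <= 2 * L * t])).
  apply: (@closed_comp _ _ (fun v : V => `|v|) [set x | x <= _]).
    by move=> v _; exact: norm_continuous.
  exact: closed_le.
move=> _ [s hs ->] /=.
have hs' : 2 * L * clen S s <= 2 * L * t by rewrite ler_wpM2l// mulr_ge0.
by rewrite (le_trans (chain_le _))// (le_trans hs').
Qed.

Lemma reach_compact t : 2 * L * t <= rho -> compact (reach t).
Proof.
move=> ht; apply: (subclosed_compact _ (@compact_norm_le R n (2 * L * t))).
  exact: closed_closure.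
by move=> k; exact: reach_le.
Qed.

(* The closure is taken jointly in time and position, so that the doubled
   function attains its maximum over both. *)
Definition timed_reach (T : R) : set (R * V) :=
  closure [set p | [/\ 0 <= p.1, p.1 <= T &
    exists2 s, clen S s <= p.1 & p.2 = chain G M s]].

Lemma timed_reach_itv T t k : timed_reach T (t, k) -> 0 <= t <= T.
Proof.
have : closed [set p : R * V | 0 <= p.1 <= T].
  rewrite (_ : [set _ | _] = fst @^-1` [set x : R | 0 <= x] `&`
      fst @^-1` [set x : R | x <= T]).
    apply: closedI; apply: closed_comp; try exact: closed_ge; try exact: closed_le.
      by move=> p _; exact: cvg_fst.
    by move=> p _; exact: cvg_fst.
  by apply/seteqP; split=> p /= => [/andP[]|[-> ->]].
move=> cD h; apply: (closure_sub_closed cD _ h).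
by move=> p [h1 h2 _] /=; rewrite h1 h2.
Qed.

Lemma timed_reach_norm T t k : 2 * L * T <= rho -> timed_reach T (t, k) ->
  `|k| <= 2 * L * t.
Proof.
move=> hT.
have cD : closed [set p : R * V | `|p.2| - 2 * L * p.1 <= 0].
  apply: (@closed_comp _ _ (fun p : R * V => `|p.2| - 2 * L * p.1) [set x | x <= 0]).
    move=> p _; apply: cvgB; first by apply: cvg_norm; exact: cvg_snd.
    by apply: cvgM; [exact: cvg_cst|exact: cvg_fst].
  exact: closed_le.
move=> h; rewrite -subr_le0; apply: (closure_sub_closed cD _ h).
move=> [t' k'] /= [h1 h2 [s hs ->]].
have h3 : 2 * L * clen S s <= 2 * L * t' by rewrite ler_wpM2l// mulr_ge0.
have h4 : 2 * L * t' <= 2 * L * T by rewrite ler_wpM2l// mulr_ge0.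
by rewrite subr_le0 (le_trans (chain_le _))// (le_trans h3)// (le_trans h4).
Qed.

Lemma timed_reach_reach T t k : timed_reach T (t, k) -> reach T k.
Proof.
have cD : closed [set p : R * V | reach T p.2].
  apply: (@closed_comp _ _ snd (reach T)); last exact: closed_closure.
  by move=> p _; exact: cvg_snd.
move=> h; apply: (closure_sub_closed cD _ h).
by move=> [t' k'] /= [h1 h2 [s hs ->]]; apply: chain_reach; exact: le_trans h2.
Qed.

Lemma timed_reach_compact T : 2 * L * T <= rho -> compact (timed_reach T).
Proof.
move=> hT.
apply: (subclosed_compact _ (compact_setX (@segment_compact R 0 T) (reach_compact hT))).
  exact: closed_closure.
move=> [t k] h; split=> /=; last exact: timed_reach_reach h.
by rewrite in_itv /=; exact: timed_reach_itv h.
Qed.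

(** The inequality is strict because the approximating pairs may have a slightly larger time, which
    must still leave room for the step. *)
Lemma timed_reach_step T t k c : timed_reach T (t, k) -> t + cnorm S c < T ->
  timed_reach T (t + cnorm S c, mul k (c *m M)).
Proof.
move=> h htT B hB.
have hB' : nbhs (t, k) [set p : R * V | B (p.1 + cnorm S c, mul p.2 (c *m M)) /\
    p.1 + cnorm S c < T].
  have c1 : (p.1 + cnorm S c) @[p --> (t, k)] --> t + cnorm S c.
    by apply: cvgD; [exact: cvg_fst|exact: cvg_cst].
  have c2 : mul p.2 (c *m M) @[p --> (t, k)] --> mul k (c *m M).
    by apply: cvg_cg_mul; [exact: cvg_snd|exact: cvg_cst].
  have c12 : (p.1 + cnorm S c, mul p.2 (c *m M)) @[p --> (t, k)] -->
      (t + cnorm S c, mul k (c *m M)) by exact: (cvg_pair c1 c2).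
  apply: filterI; first exact: c12.
  exact: (cvgr_lt _ c1).
have [[t' k'] [/= [h1 h2 [s hs ->]] [h3 h4]]] := h _ hB'.
exists (t' + cnorm S c, mul (chain G M s) (c *m M)); split=> //=; split.
- by rewrite addr_ge0// cnorm_ge0.
- exact: ltW.
- exists (s ++ [:: c]); first by rewrite clen_cat clen_cons /clen big_nil addr0 lerD2r.
  by rewrite chain_cat chain1.
Qed.

Lemma chain_timed_reach T t s : 0 <= t -> t <= T -> clen S s <= t ->
  timed_reach T (t, chain G M s).
Proof. by move=> t0 tT hs; apply: subset_closure; split=> //; exists s. Qed.

End Reachable.

(** * Midpoint convexity of maxima over reachable sets *)

Lemma quad_approx_penalty {R : realType} {n r : nat} (G : carnot_group R n r)
    (z k : 'rV[R]_n) (tau : R) (c : R) :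
  exists l : {linear 'rV[R]_n -> R},
    quad_approx (fun y => tau * sqn (cg_mul G (cg_mul G z y) k) - c) 0 l.
Proof.
have h1 := C2_quad_approx_rV 0 (rV_coord_system n) (Ck_mulx G 2 z).
pose g (x : 'rV[R]_n) := tau * sqn (cg_mul G x k) - c.
have hg : Ck 2 setT g.
  apply: CkD; last exact: Ck_cst.
  apply: CkM; first exact: Ck_cst.
  by apply: Ck_sqn; exact: Ck_mulxr.
have h2 := C2_quad_approx (cg_mul G z 0) (rV_coord_system n).1 (rV_coord_system n).2 hg.
by eexists; exact: (quad_approx_comp h1 h2).
Qed.

(** The midpoint inequality for endpoints of actual chains; points of the closure follow by
    continuity in [subsolution_convex]. *)
Lemma reach_convex {R : realType} {n r m : nat} (G : carnot_group R n r)
    (e : m.-tuple 'rV[R]_n) (S : 'M[R]_m) (f : 'rV[R]_m -> R) (L rho : R)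
    (Omega : set 'rV[R]_n) (u : 'rV[R]_n -> R) (x : 'rV[R]_n) (T b : R) s :
  let M := S *m frame_mx e in
  S^T = S -> (forall p, f p = 2^-1 * ip S p p) ->
  (forall c, c != 0 -> 0 < ip S c c) ->
  0 <= L -> (forall c, `|c *m M| <= L * cnorm S c) -> 0 < rho ->
  (forall s, 2 * L * clen S s <= rho -> `|chain G M s| <= 2 * L * clen S s) ->
  (forall x y, `|x| <= rho -> `|y| <= rho -> `|cg_mul G x y| <= 2 * `|x| + `|y|) ->
  viscosity_subsolution G e f Omega u -> open Omega ->
  (forall x, Omega x -> {for x, continuous u}) ->
  0 < T -> 2 * L * T <= rho ->
  (forall k, reach G S M T k -> Omega (cg_mul G x k)) ->
  (forall k, reach G S M T k -> u (cg_mul G x k) <= b) ->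
  clen S s <= T / 2 -> 2 * u (cg_mul G x (chain G M s)) <= u x + b.
Proof.
move=> M S_sym hf S_pos L0 hL rho0 chain_le mul_le usub Oopen ucont T0 hLT xO xb hs.
rewrite leNgt; apply/negP => hlt.
have T2 : 0 < T / 2 by rewrite divr_gt0.
have TT : T / 2 <= T by lra.
set beta := u (cg_mul G x (chain G M s)) in hlt.
pose a0 := u x.
have hsT : reach G S M T (chain G M s) by apply: chain_reach; exact: le_trans TT.
have bb := xb _ hsT; rewrite -/beta in bb.
pose D := beta - (a0 + b) / 2.
have D0 : 0 < D by rewrite /D /a0; lra.
(* With kappa T^2 = D, the parabola exceeds the midpoint of its chord by D/4, so [beta] still beats
   [g (T / 2)] by 3D/4. The slope at [T] is (b - a0 - D) / T, still positive. *)
pose kappa := D / T ^+ 2.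
have T20 : 0 < T ^+ 2 by rewrite exprn_gt0.
have k0 : 0 < kappa by rewrite divr_gt0.
have kT : kappa * T ^+ 2 = D by rewrite /kappa divfK// gt_eqF.
(* [g] is the concave parabola with [g 0 = u x] and [g T = b]. *)
pose b1 := (b - a0) / T + kappa * T.
have b1T : b1 * T = b - a0 + D.
  by rewrite /b1 mulrDl divfK ?gt_eqF// -kT; ring.
pose g t := a0 + b1 * t + - kappa * t ^+ 2.
have gT : g T = b by rewrite /g b1T mulNr kT; lra.
have gT2 : g (T / 2) = (a0 + b) / 2 + D / 4.
  rewrite /g (_ : b1 * (T / 2) = b1 * T / 2); last by field.
  rewrite b1T (_ : - kappa * (T / 2) ^+ 2 = - (kappa * T ^+ 2) / 4); last by field.
  by rewrite kT; field.
have g0 : g 0 = a0 by rewrite /g expr0n !mulr0 !addr0.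
have bD : D < b - a0 by rewrite /D in D0 *; lra.
have dg t : t <= T -> 0 < b1 - 2 * kappa * t.
  move=> tT; have h : 0 < (b1 - 2 * kappa * T) * T.
    by rewrite mulrBl b1T (_ : 2 * kappa * T * T = 2 * D) -?kT; [lra|ring].
  rewrite pmulr_lgt0// in h.
  have : kappa * t <= kappa * T by rewrite ler_wpM2l// ltW.
  by lra.
have gshift t h : g (t + h) = g t + (b1 - 2 * kappa * t) * h - kappa * h ^+ 2.
  by rewrite /g; ring.
have gge t : 0 <= t -> t <= T -> a0 <= g t.
  move=> t0 tT; rewrite -{1}g0 -subr_ge0.
  rewrite [leRHS](_ : _ = t * (b1 - kappa * t)); last by rewrite /g; ring.
  rewrite mulr_ge0//; have := dg _ tT; have := mulr_ge0 (ltW k0) t0; lra.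
have gcont t : {for t, continuous g}.
  apply: differentiable_continuous; apply/derivable1_diffP.
  exact: (@ex_derive _ _ _ _ _ _ _ (is_derive_poly2 a0 b1 (- kappa) t)).
have Kcpt := reach_compact L0 chain_le hLT.
(* Compactness of [reach] gives one radius for all [k], within which a left shift by [h] stays in
   [Omega] and raises [u] by less than D/2. *)
have [rh rh0 tube] : exists2 rh, 0 < rh & forall h k, `|h| <= rh -> reach G S M T k ->
    Omega (cg_mul G x (cg_mul G h k)) /\
    u (cg_mul G x (cg_mul G h k)) - u (cg_mul G x k) < D / 2.
  pose Pr (h k : 'rV[R]_n) :=
    Omega (cg_mul G x (cg_mul G h k)) /\
    u (cg_mul G x (cg_mul G h k)) - u (cg_mul G x k) < D / 2.
  have pre k : reach G S M T k -> \forall k' \near k & h \near (0 : 'rV[R]_n), Pr h k'.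
    move=> Kk.
    have c1 : cg_mul G x (cg_mul G p.2 p.1) @[p --> (k, (0 : 'rV[R]_n))] -->
        cg_mul G x (cg_mul G 0 k).
      apply: cvg_cg_mul; first exact: cvg_cst.
      by apply: cvg_cg_mul; [exact: cvg_snd|exact: cvg_fst].
    have c2 : cg_mul G x p.1 @[p --> (k, (0 : 'rV[R]_n))] --> cg_mul G x k.
      by apply: cvg_cg_mul; [exact: cvg_cst|exact: cvg_fst].
    rewrite cg_mul0x in c1.
    have c3 : u (cg_mul G x (cg_mul G p.2 p.1)) - u (cg_mul G x p.1)
        @[p --> (k, (0 : 'rV[R]_n))] -->
        u (cg_mul G x k) - u (cg_mul G x k).
      apply: cvgB.
        exact: (cvg_comp _ _ c1 (ucont _ (xO _ Kk))).
      exact: (cvg_comp _ _ c2 (ucont _ (xO _ Kk))).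
    have n1 : \forall p \near (k, (0 : 'rV[R]_n)),
        Omega (cg_mul G x (cg_mul G p.2 p.1)).
      by apply: c1; apply: open_nbhs_nbhs; split=> //; exact: xO.
    have n2 : \forall p \near (k, (0 : 'rV[R]_n)),
        u (cg_mul G x (cg_mul G p.2 p.1)) - u (cg_mul G x p.1) < D / 2.
      by apply: (cvgr_lt _ c3); rewrite subrr divr_gt0.
    exact: filterS2 n1 n2.
  have := (compact_near_coveringP _).1 Kcpt _ (nbhs (0 : 'rV[R]_n)) Pr _ pre.
  move=> /(_ _)/nbhs_ballP[d /= d0 hd]; exists (d / 2); first by rewrite divr_gt0.
  move=> h k hh; apply: (hd h); rewrite -ball_normE /= sub0r normrN.
  by rewrite (le_lt_trans hh)// ltr_pdivrMr// ltr_pMr// ltr1n.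
(* At |h| = rh the penalty is at least b - a0 + 1, more than [u - g] can gain, so the maximiser has
   |h1| < rh. *)
pose tau := (b - a0 + 1) / rh ^+ 2.
have rh20 : 0 < rh ^+ 2 by rewrite exprn_gt0.
have tau0 : 0 < tau by rewrite divr_gt0//; lra.
pose Phi (p : 'rV[R]_n * (R * 'rV[R]_n)) :=
  u (cg_mul G x (cg_mul G p.1 p.2.2)) - g p.2.1 - tau * sqn p.1.
pose A := [set h : 'rV[R]_n | `|h| <= rh] `*` timed_reach G S M T.
have Acpt : compact A.
  apply: compact_setX; first exact: compact_norm_le.
  exact: (timed_reach_compact L0 chain_le hLT).
have hts : timed_reach G S M T (T / 2, chain G M s).
  by apply: chain_timed_reach => //; exact: ltW.
have p0A : A (0, (T / 2, chain G M s)).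
  split=> /=; first by rewrite normr0 ltW.
  exact: hts.
have Phic : {within A, continuous Phi}.
  apply: continuous_in_subspaceT => -[h [t k]]; rewrite inE => -[/= hh hk].
  have [Oh _] := tube _ _ hh (timed_reach_reach hk).
  have c1 : cg_mul G x (cg_mul G p.1 p.2.2) @[p --> (h, (t, k))] -->
      cg_mul G x (cg_mul G h k).
    apply: cvg_cg_mul; first exact: cvg_cst.
    apply: cvg_cg_mul; first exact: cvg_fst.
    apply: (cvg_comp (fun p : 'rV[R]_n * (R * 'rV[R]_n) => p.2) snd);
      [exact: cvg_snd|exact: cvg_snd].
  have c2 : g p.2.1 @[p --> (h, (t, k))] --> g t.
    apply: (cvg_comp (fun p : 'rV[R]_n * (R * 'rV[R]_n) => p.2.1) g); last exact: gcont.
    apply: (cvg_comp (fun p : 'rV[R]_n * (R * 'rV[R]_n) => p.2) fst);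
      [exact: cvg_snd|exact: cvg_fst].
  have c3 : sqn p.1 @[p --> (h, (t, k))] --> sqn h.
    by apply: cvg_sqn; exact: cvg_fst.
  apply: cvgB; last by apply: cvgM; [exact: cvg_cst|exact: c3].
  apply: cvgB; last exact: c2.
  exact: (cvg_comp _ _ c1 (ucont _ Oh)).
have [[h1 [t1 k1]] pA pmax] := compact_EVT_max (ex_intro _ _ p0A) Acpt Phic.
move: pA; rewrite inE => -[/= h1rh tk1].
have {}pmax h t k : `|h| <= rh -> timed_reach G S M T (t, k) ->
    u (cg_mul G x (cg_mul G h k)) - g t - tau * sqn h <=
    u (cg_mul G x (cg_mul G h1 k1)) - g t1 - tau * sqn h1.
  by move=> hh hk; apply: (pmax (h, (t, k))); rewrite inE.
have /andP[t10 t1T] := timed_reach_itv tk1.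
have Kk1 := timed_reach_reach tk1.
have [Oz uz] := tube _ _ h1rh Kk1.
have hmax0 : D * (3 / 4) <= u (cg_mul G x (cg_mul G h1 k1)) - g t1 - tau * sqn h1.
  have := pmax 0 (T / 2) (chain G M s).
  rewrite normr0 cg_mul0x => /(_ (ltW rh0)).
  move=> /(_ hts) /(le_trans _); apply.
  have -> : sqn (0 : 'rV[R]_n) = 0 by rewrite /sqn big1// => i _; rewrite mxE expr0n.
  by rewrite mulr0 subr0 -/beta gT2 /D; lra.
have ts0 : 0 <= tau * sqn h1 by rewrite mulr_ge0 ?sqn_ge0// ltW.
have uk1 := xb _ Kk1.
(* At time 0 the position is 0 and at time [T] the parabola equals [b]; in both cases the doubled
   function is below D/2, less than the 3D/4 already achieved. *)
have t1gt0 : 0 < t1.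
  rewrite lt_def t10 andbT; apply/eqP => t1e.
  have : `|k1| <= 2 * L * 0.
    by rewrite -{1}t1e; exact: (timed_reach_norm L0 chain_le hLT tk1).
  rewrite mulr0 normr_le0 => /eqP k10; move: uz hmax0.
  by rewrite k10 !cg_mulx0 t1e g0 /a0; lra.
have t1ltT : t1 < T.
  rewrite lt_def t1T andbT; apply/eqP => t1e.
  by move: hmax0; rewrite -t1e gT; lra.
have h1lt : `|h1| < rh.
  rewrite -(ltr_pXn2r (n := 2)) ?nnegrE// ?(ltW rh0)//.
  rewrite (le_lt_trans (sqr_norm_le_sqn _))// -(ltr_pM2l tau0).
  rewrite {2}/tau divfK ?gt_eqF//.
  have := gge _ t10 t1T; lra.
pose z := cg_mul G h1 k1.
pose x0 := cg_mul G x z.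
(* When the product of the two variables moves from [z = h1 k1] to [z y] while the second stays
   [k1], the first becomes z y k1^-1; [F] is the resulting change of penalty. *)
pose F (y : 'rV[R]_n) := tau * sqn (cg_mul G (cg_mul G z y) (- k1)) - tau * sqn h1.
have [l hl] := quad_approx_penalty G z (- k1) tau (tau * sqn h1).
have F0 : F 0 = 0 by rewrite /F cg_mulx0 cg_mulxK subrr.
pose b' := b1 - 2 * kappa * t1.
have b'0 : 0 < b' by exact: dg.
have [r1 [r10 r1rho near1]] : exists r1, [/\ 0 < r1, r1 <= rho &
    \forall k \near k1, forall w, `|w| <= r1 -> `|cg_mul G (cg_mul G z w) (- k)| <= rh].
  have c1 : cg_mul G (cg_mul G z p.2) (- p.1) @[p --> (k1, (0 : 'rV[R]_n))] -->
      cg_mul G (cg_mul G z 0) (- k1).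
    apply: cvg_cg_mul; last by apply: cvgN; exact: cvg_fst.
    by apply: cvg_cg_mul; [exact: cvg_cst|exact: cvg_snd].
  rewrite cg_mulx0 cg_mulxK in c1.
  have := cvgr_norm_lt _ c1 _ h1lt => -[[B1 B2] /= [hB1 hB2] hB].
  move: hB2 => /nbhs_ballP[d /= d0 hd].
  exists (Num.min rho (d / 2)); split.
  - by rewrite lt_min rho0 divr_gt0.
  - by rewrite ge_min lexx.
  apply: filterS hB1 => k hk w; rewrite le_min => /andP[_ hw].
  apply/ltW/(hB (k, w)); split=> //=; apply: hd; rewrite -ball_normE /= sub0r normrN.
  by rewrite (le_lt_trans hw)// ltr_pdivrMr// ltr_pMr// ltr1n.
have L1 : 0 < 3 + 2 * L by rewrite ltr_pwDl// mulr_ge0.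
have [r0 [r00 e1 e2 e3]] : exists r0, [/\ 0 < r0, r0 * (3 + 2 * L) <= r1,
    r0 <= t1 / 2 & r0 <= (T - t1) / 2].
  exists (Num.min (r1 / (3 + 2 * L)) (Num.min (t1 / 2) ((T - t1) / 2))).
  split; rewrite -?ler_pdivlMr// ?ge_min ?lexx ?orbT//.
  by rewrite !lt_min !divr_gt0// subr_gt0.
have Lr0 : 0 <= L * r0 by rewrite mulr_ge0// ltW.
apply: (@subsolution_not_touched _ _ _ _ G e S f S_sym hf S_pos L L0 hL Omega u usub x0 F l b' kappa r0
  Oz hl F0 b'0 k0 r00).
- move=> c y hc hy.
  have cn0 := cnorm_ge0 S c.
  have hcM : `|- (c *m M)| <= L * r0.
    by rewrite normrN (le_trans (hL c))// ler_wpM2l.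
  (* Chosen so that [h] times the prolonged [k1 c] is [z y]: [u] is evaluated at the desired point,
     and the penalty is that of y c^-1. *)
  pose h := cg_mul G (cg_mul G z (cg_mul G y (- (c *m M)))) (- k1).
  have hh : `|h| <= rh.
    apply: (nbhs_singleton near1).
    have : `|cg_mul G y (- (c *m M))| <= 2 * `|y| + `|- (c *m M)|.
      by apply: mul_le; clear -hy hcM e1 r1rho Lr0 r00; lra.
    by clear -hy hcM e1 Lr0 r00; lra.
  have htr : timed_reach G S M T (t1 + cnorm S c, cg_mul G k1 (c *m M)).
    by apply: timed_reach_step => //; clear -e3 hc r00 t1ltT; lra.
  have hhk : cg_mul G h (cg_mul G k1 (c *m M)) = cg_mul G z y.
    by rewrite /h cg_mulA cg_mulxNK !cg_mulA cg_mulxNK.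
  have := pmax _ _ _ hh htr; rewrite hhk gshift -/b' -/z.
  by rewrite /x0 -(cg_mulA G x z y) /F -/h; clear; lra.
- move=> q0 q00 q0r.
  (* [(t1, k1)] is only a limit of timed chains. A nearby chain changes the penalty and the parabola
     by less than [eta] each, which together give the term [s ^+ 3] of the backward bound. The
     estimate is uniform in [w], so one chain serves all [y]. *)
  pose eta := q0 ^+ 3 / 2.
  have eta0 : 0 < eta by rewrite divr_gt0// exprn_gt0.
  have near2 : \forall k \near k1, forall w, `|w| <= r1 ->
      tau * sqn (cg_mul G (cg_mul G z w) (- k)) -
        tau * sqn (cg_mul G (cg_mul G z w) (- k1)) < eta.
    pose Pr (k w : 'rV[R]_n) :=
      tau * sqn (cg_mul G (cg_mul G z w) (- k)) -
        tau * sqn (cg_mul G (cg_mul G z w) (- k1)) < eta.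
    have pre w : [set v : 'rV[R]_n | `|v| <= r1] w ->
        \forall w' \near w & k \near k1, Pr k w'.
      move=> _.
      have c1 : sqn (cg_mul G (cg_mul G z p.1) (- p.2)) @[p --> (w, k1)] -->
          sqn (cg_mul G (cg_mul G z w) (- k1)).
        apply: cvg_sqn; apply: cvg_cg_mul; last by apply: cvgN; exact: cvg_snd.
        by apply: cvg_cg_mul; [exact: cvg_cst|exact: cvg_fst].
      have c2 : sqn (cg_mul G (cg_mul G z p.1) (- k1)) @[p --> (w, k1)] -->
          sqn (cg_mul G (cg_mul G z w) (- k1)).
        apply: cvg_sqn; apply: cvg_cg_mul; last exact: cvg_cst.
        by apply: cvg_cg_mul; [exact: cvg_cst|exact: cvg_fst].
      have c3 : tau * sqn (cg_mul G (cg_mul G z p.1) (- p.2)) -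
          tau * sqn (cg_mul G (cg_mul G z p.1) (- k1)) @[p --> (w, k1)] -->
          tau * sqn (cg_mul G (cg_mul G z w) (- k1)) -
            tau * sqn (cg_mul G (cg_mul G z w) (- k1)).
        by apply: cvgB; (apply: cvgM; [exact: cvg_cst|]).
      by apply: (cvgr_lt _ c3); rewrite subrr.
    have := (compact_near_coveringP _).1 (@compact_norm_le R n r1) _ (nbhs k1) Pr _ pre.
    by move=> /(_ _); apply: filterS => k hk w hw; exact: hk.
  have near3 : \forall t \near t1, g (t - q0) < g (t1 - q0) + eta /\ t1 / 2 < t.
    have c1 : g (t - q0) @[t --> t1] --> g (t1 - q0).
      apply: (cvg_comp (fun t => t - q0) g); last exact: gcont.
      by apply: cvgB; [exact: cvg_id|exact: cvg_cst].
    have n1 : \forall t \near t1, g (t - q0) < g (t1 - q0) + eta.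
      by apply: (cvgr_lt _ c1); rewrite ltrDl.
    have n2 : \forall t \near t1, t1 / 2 < t.
      by apply: (cvgr_gt _ (@cvg_id _ (nbhs t1))); clear -t1gt0; lra.
    exact: filterS2 n1 n2.
  have hB : nbhs (t1, k1) [set p : R * 'rV[R]_n |
      (g (p.1 - q0) < g (t1 - q0) + eta /\ t1 / 2 < p.1) /\
      (forall w, `|w| <= r1 -> `|cg_mul G (cg_mul G z w) (- p.2)| <= rh) /\
      (forall w, `|w| <= r1 ->
        tau * sqn (cg_mul G (cg_mul G z w) (- p.2)) -
          tau * sqn (cg_mul G (cg_mul G z w) (- k1)) < eta)].
    exists ([set t | g (t - q0) < g (t1 - q0) + eta /\ t1 / 2 < t],
      [set k | (forall w, `|w| <= r1 -> `|cg_mul G (cg_mul G z w) (- k)| <= rh) /\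
      (forall w, `|w| <= r1 ->
        tau * sqn (cg_mul G (cg_mul G z w) (- k)) -
          tau * sqn (cg_mul G (cg_mul G z w) (- k1)) < eta)]).
      by split=> //=; exact: filterI near1 near2.
    by move=> [t k] [].
  have [[t k] [/= [t0 tT [sg hsg ksg]] [[n1 n2] [n3 n4]]]] := tk1 _ hB.
  have hq0t : 0 <= t - q0 by clear -n1 n2 q0r e2; lra.
  have hsg' : clen S sg <= (t - q0) + q0 by rewrite subrK.
  have [s1 [q [hsq hs1 hq]]] := chain_split G M hq0t (ltW q00) hsg'.
  exists q; split=> // y hy.
  have hLq : L * clen S q <= L * r0 by rewrite ler_wpM2l// (le_trans hq).
  have hqn : `|chain G M q| <= 2 * L * r0.
    have : `|chain G M q| <= 2 * L * clen S q.
      by apply: chain_le; clear -hLq e1 r1rho Lr0 r00; lra.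
    by clear -hLq; lra.
  have hw : `|cg_mul G y (chain G M q)| <= r1.
    have : `|cg_mul G y (chain G M q)| <= 2 * `|y| + `|chain G M q|.
      by apply: mul_le; clear -hy hqn e1 r1rho Lr0 r00; lra.
    by clear -hy hqn e1 Lr0 r00; lra.
  pose h := cg_mul G (cg_mul G z (cg_mul G y (chain G M q))) (- k).
  have hh : `|h| <= rh by exact: n3.
  have htr : timed_reach G S M T (t - q0, chain G M s1).
    by apply: chain_timed_reach => //; clear -tT q00; lra.
  have hhk : cg_mul G h (chain G M s1) = cg_mul G z y.
    by rewrite /h ksg hsq cg_oppM !cg_mulA cg_mulxK cg_mulxNK.
  have := pmax _ _ _ hh htr; rewrite hhk -/z.
  have := gshift t1 (- q0); rewrite -/b'.
  have := n4 _ hw; rewrite -/h.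
  have := n1.
  rewrite /x0 -(cg_mulA G x z y) /F /eta; clear.
  move: (g (t - q0)) (g (t1 - q0)) => A1 A2.
  by lra.
Qed.

(** * Quadratic form of f *)

Section Quadratic.
Context {R : realType} {m : nat} (f : 'rV[R]_m -> R) (alpha : R).
Hypotheses (f_C2 : Ck 2 [set: 'rV[R]_m] f) (f_convex : strictly_convex f).
Hypotheses (alpha_ge1 : 1 <= alpha) (f_hom : homogeneous_of_degree f alpha).

Lemma derive_scale (g : 'rV[R]_m -> R) s k v :
  (forall y, differentiable g y) -> (forall y, g (s *: y) = k * g y) ->
  forall y, s * 'D_v g (s *: y) = k * 'D_v g y.
Proof.
move=> dg hg y.
have -> : s * 'D_v g (s *: y) = 'D_(s *: v) g (s *: y).
  by rewrite !deriveE// linearZ.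
have <- : 'D_v (fun y => g (s *: y)) y = k * 'D_v g y.
  under eq_fun do rewrite hg.
  by rewrite (deriveZ _ (diff_derivable (dg y))).
rewrite (derive_line (fun y => g (s *: y)) y v) (derive_line g (s *: y) (s *: v)).
suff -> : (fun h : R => g (s *: (y + h *: v))) =
  (fun h : R => g (s *: y + h *: (s *: v))) by [].
by apply/funext => h; rewrite scalerDr !scalerA mulrC.
Qed.

Lemma derive_sum_partial (g : 'rV[R]_m -> R) v y : differentiable g y ->
  'D_v g y = \sum_i v 0 i * partial g i y.
Proof.
move=> dg; rewrite deriveE// {1}[v]row_sum_delta linear_sum.
by apply: eq_bigr => i _; rewrite linearZ /partial deriveE.
Qed.

Let df y : differentiable f y. Proof. exact: (f_C2.1 y I). Qed.

Let ddf v y : differentiable ('D_v f) y. Proof. exact: ((f_C2.2 v).1 y I). Qed.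

Lemma derive2_hessian p : 'D_p ('D_p f) 0 = ip (hessian f 0) p p.
Proof.
have -> : 'D_p f = \sum_j (p 0 j *: partial f j).
  by apply/funext => y; rewrite fct_sumE derive_sum_partial.
rewrite derive_sum; last first.
  by move=> j; apply: derivableZ; apply: diff_derivable; exact: ddf.
rewrite /ip mxE; apply: eq_bigr => j _.
rewrite deriveZ; last by apply: diff_derivable; exact: ddf.
rewrite derive_sum_partial; last exact: ddf.
by rewrite !mxE [RHS]mulrC; congr (_ * _); apply: eq_bigr => i _; rewrite mxE.
Qed.

Lemma homogeneous_at0 : f 0 = 0.
Proof.
(* Scaling by 2 suffices: alpha >= 1 gives 2^alpha >= 2, hence 2^alpha <> 1. *)
have := f_hom 0 (ltr0Sn R 1); rewrite scaler0 => h.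
have h2 : 2 <= 2 `^ alpha :> R.
  by rewrite -{1}(powRr1 (ler0n R 2)) ler_powR// ler1n.
have : (2 `^ alpha - 1) * f 0 = 0 by rewrite mulrBl mul1r -h subrr.
by move=> /eqP; rewrite mulf_eq0 => /orP[/eqP|/eqP//]; lra.
Qed.

Lemma hessian_pos p : p != 0 -> 0 < ip (hessian f 0) p p.
Proof.
move=> p0; have [C0 C00 hC] := f_convex.
apply: lt_le_trans (hC 0 p); rewrite mulr_gt0//.
apply: lt_le_trans (sqr_norm_le_sqn p).
by rewrite exprn_gt0// normr_gt0.
Qed.

(** The second derivative [h] in the direction [p] scales with exponent alpha - 2. Its nonzero value
    at 0 forces alpha = 2, so it is constant on the open ray through [p]. The constant is 2 f(p),
    and by continuity it is also the value at 0. *)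
Lemma f_quadratic p : f p = 2^-1 * ip (hessian f 0) p p.
Proof.
have [->|p0] := eqVneq p 0; first by rewrite homogeneous_at0 ip0l mulr0.
have h0 := hessian_pos p0.
have [h hE] : exists h, h = 'D_p ('D_p f) by exists ('D_p ('D_p f)).
have h00 : h 0 = ip (hessian f 0) p p by rewrite hE derive2_hessian.
have hs s y : 0 < s -> s * (s * h (s *: y)) = s `^ alpha * h y.
  move=> s0.
  have h1 := derive_scale (s := s) (k := s `^ alpha) p df (fun y => f_hom y s0).
  have h2 z : 'D_p f (s *: z) = s^-1 * s `^ alpha * 'D_p f z.
    by rewrite -mulrA -h1 mulrA mulVf ?mul1r// gt_eqF.
  rewrite hE (derive_scale (s := s) (k := s^-1 * s `^ alpha) p (ddf p) h2).
  by rewrite !mulrA mulfV ?mul1r// gt_eqF.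
(* [hs] at [y = 0], where [h] does not vanish *)
have al s : 0 < s -> s `^ alpha = s ^+ 2.
  move=> s0; have := hs s 0 s0; rewrite [s *: 0]scaler0 h00 mulrA.
  by move=> /(mulIf (lt0r_neq0 h0)) <-; rewrite expr2.
have hconst s : 0 < s -> h (s *: p) = h p.
  move=> s0; have := hs s p s0; rewrite al// mulrA -expr2.
  by apply: mulfI; rewrite gt_eqF// exprn_gt0.
(* On the ray f((t + h) p) = (t + h)^2 f(p) as long as t + h > 0, a polynomial in [h] to be
   differentiated twice. *)
have hp : h p = 2 * f p.
  have e1 t : 0 < t -> 'D_p f (t *: p) = 2 * f p * t.
    move=> t0; rewrite (derive_line f (t *: p) p).
    have E : \forall h \near (0 : R), f (t *: p + h *: p) =
        f p * t ^+ 2 + (2 * f p * t) * h + f p * h ^+ 2.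
      have n1 : \forall h \near (0 : R), - t < h.
        by apply: (cvgr_gt _ (@cvg_id _ (nbhs (0 : R)))); rewrite oppr_lt0.
      apply: filterS n1 => x ht; have th : 0 < t + x by lra.
      by rewrite -scalerDl f_hom// al//; ring.
    rewrite (near_eq_derive _ E) ?oner_neq0//.
    by rewrite (@derive_poly2 _ _ _ _ 0 _ (fun h => erefl)) mulr0 addr0.
  rewrite hE (derive_line ('D_p f) p p).
  have E : \forall h \near (0 : R), 'D_p f (p + h *: p) =
      2 * f p + (2 * f p) * h + 0 * h ^+ 2.
    have n1 : \forall h \near (0 : R), - 1 < h.
      by apply: (cvgr_gt _ (@cvg_id _ (nbhs (0 : R)))); rewrite oppr_lt0.
    apply: filterS n1 => x ht; have th : 0 < 1 + x by lra.
    by rewrite -{1}(scale1r p) -scalerDl e1//; ring.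
  rewrite (near_eq_derive _ E) ?oner_neq0//.
  by rewrite (@derive_poly2 _ _ _ _ 0 _ (fun h => erefl)) mulr0 addr0.
have hcont : {for 0, continuous h} by rewrite hE; exact: ((f_C2.2 p).2 p 0 I).
have c0 : s *: p @[s --> (0 : R)^'+] --> (0 : 'rV[R]_m).
  rewrite -[X in _ --> X](scale0r p); apply: cvgZr_tmp.
  exact: cvg_at_right_filter cvg_id.
have c1 := cvg_comp _ _ c0 hcont.
have c2 : h (s *: p) @[s --> (0 : R)^'+] --> h p.
  apply: cvg_near_cst; near=> s; apply: hconst; near: s.
  exact: nbhs_right_gt.
have E : h 0 = h p by exact: cvg_unique c1 c2.
by rewrite -h00 E hp; field.
Unshelve. all: by end_near. Qed.

(** Symmetrising the Hessian keeps its quadratic form, and makes [S] symmetric without appeal to the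
    equality of mixed partial derivatives. *)
Lemma quadratic_form : exists S : 'M[R]_m, [/\ S^T = S,
  forall p, f p = 2^-1 * ip S p p &
  exists2 C0 : R, 0 < C0 & forall c, C0 * sqn c <= ip S c c].
Proof.
pose H := hessian f 0; pose S := 2^-1 *: (H + H^T).
have E p : ip S p p = ip H p p.
  have ET : ip H^T p p = ip H p p.
    by rewrite /ip -[p *m H *m p^T]trmxK [RHS]mxE !trmx_mul trmxK mulmxA.
  rewrite /S {1}/ip -scalemxAr -scalemxAl mxE mulmxDr mulmxDl mxE.
  by rewrite -/(ip H p p) -/(ip H^T p p) ET; field.
exists S; split.
- by rewrite /S linearZ/= linearD/= trmxK addrC.
- by move=> p; rewrite E f_quadratic.
- by have [C0 C00 hC] := f_convex; exists C0 => // c; rewrite E; exact: hC.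
Qed.

End Quadratic.

(** * Comparison by finite differences *)

Section ReachGroup.
Context {R : realType} {n r m : nat} (G : carnot_group R n r).
Local Notation V := 'rV[R]_n.
Variables (S : 'M[R]_m) (M : 'M[R]_(m, n)).
Local Notation reach := (reach G S M).

Lemma reach_mono s t : s <= t -> reach s `<=` reach t.
Proof.
by move=> st; apply: closureS => _ [c hc ->]; exists c => //; exact: le_trans st.
Qed.

Lemma reach0 t : 0 <= t -> reach t 0.
Proof.
by move=> t0; apply: (@chain_reach _ _ _ _ G S M [::]); rewrite /clen big_nil.
Qed.

Lemma reach_opp t k : reach t k -> reach t (- k).
Proof.
move=> h B hB; have c : - y @[y --> k] --> - k.
  exact: opp_continuous.
have [_ [[s hs ->] hsB]] := h _ (c B hB).
have [s' [e1 e2]] := chain_opp G S M s.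
by exists (- chain G M s); split=> //; exists s'; rewrite ?e1// e2.
Qed.

Lemma reach_mul s t k l : reach s k -> reach t l ->
  reach (s + t) (cg_mul G k l).
Proof.
move=> hk hl B hB.
have [[B1 B2] /= [hB1 hB2] B12] := @cg_mul_continuous _ _ _ G (k, l) B hB.
have [_ [[s1 h1 ->] b1]] := hk _ hB1; have [_ [[s2 h2 ->] b2]] := hl _ hB2.
exists (cg_mul G (chain G M s1) (chain G M s2)); split; last exact: (B12 (_, _)).
by exists (s1 ++ s2); rewrite ?clen_cat ?lerD// chain_cat.
Qed.

End ReachGroup.

Section Comparison.
Context {R : realType} {n r : nat} (G : carnot_group R n r).
Local Notation V := 'rV[R]_n.
Local Notation mul := (cg_mul G).
Variables (K1 K2 A Omega : set V) (u v : V -> R) (m0 : R) (a x1 : V).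
Hypotheses (K1_compact : compact K1) (K1_0 : K1 0).
Hypotheses (K1_opp : forall k, K1 k -> K1 (- k)).
Hypotheses (K11 : forall k l, K1 k -> K1 l -> K2 (mul k l)).
Hypotheses (A_compact : compact A) (OA : Omega `<=` A).
Hypotheses (u_cont : continuous u) (v_cont : continuous v).
Hypothesis u_convex : forall x b, (forall k, K2 k -> Omega (mul x k)) ->
  (forall k l, K1 k -> K1 l -> u (mul x (mul k l)) <= b) ->
  forall k, K1 k -> 2 * u (mul x k) <= u x + b.
Hypothesis v_concave : forall x b, (forall k, K2 k -> Omega (mul x k)) ->
  (forall k l, K1 k -> K1 l -> b <= v (mul x (mul k l))) ->
  forall k, K1 k -> v x + b <= 2 * v (mul x k).
Let D := [set x | A x /\ forall k, K1 k -> A (mul x k)].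
(** It keeps maximisers away from the boundary: their gap is at least [m0], so all of x K2 lies in
    [Omega] and the midpoint inequalities apply there. *)
Hypothesis near_boundary : forall x, D x -> ~ (forall k, K2 k -> Omega (mul x k)) ->
  forall k l, K1 k -> K1 l -> u (mul x k) - v (mul x l) < m0.
Hypotheses (Dx1 : D x1) (x1_m0 : m0 <= u x1 - v x1).
Hypotheses (K1a : K1 a) (exit : forall x, exists j : nat, ~ A (mul x (j%:R *: a))).

Let D_closed : closed D.
Proof.
have Acl : closed A by apply: compact_closed => //; exact: norm_hausdorff.
rewrite /D (_ : [set _ | _] = A `&` \bigcap_(k in K1) [set x | A (mul x k)]).
  apply: closedI => //; apply: closed_bigI => k _.
  apply: (@closed_comp _ _ (fun x => mul x k) A) => // x _.
  exact: (Ck_mulxr G 0 k x I).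
by apply/seteqP; split=> x /=.
Qed.

Let X := [set p : V * (V * V) | D p.1 /\ (K1 p.2.1 /\ K1 p.2.2)].
Let W (p : V * (V * V)) := u (mul p.1 p.2.1) - v (mul p.1 p.2.2).

Let X_compact : compact X.
Proof.
have DC : compact D.
  by apply: (subclosed_compact D_closed A_compact) => x [].
exact: (compact_setX DC (compact_setX K1_compact K1_compact)).
Qed.

Let uk_cont : continuous (fun p : V * (V * V) => u (mul p.1 p.2.1)).
Proof.
move=> [x [k l]].
have c1 : mul p.1 p.2.1 @[p --> (x, (k, l))] --> mul x k.
  apply: cvg_cg_mul; first exact: cvg_fst.
  by apply: (cvg_comp (fun p : V * (V * V) => p.2) fst);
    [exact: cvg_snd|exact: cvg_fst].
exact: (cvg_comp _ _ c1 (@u_cont _)).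
Qed.

Let vl_cont : continuous (fun p : V * (V * V) => v (mul p.1 p.2.2)).
Proof.
move=> [x [k l]].
have c1 : mul p.1 p.2.2 @[p --> (x, (k, l))] --> mul x l.
  apply: cvg_cg_mul; first exact: cvg_fst.
  by apply: (cvg_comp (fun p : V * (V * V) => p.2) snd);
    [exact: cvg_snd|exact: cvg_snd].
exact: (cvg_comp _ _ c1 (@v_cont _)).
Qed.

Let W_cont : continuous W.
Proof. by move=> p; apply: cvgB; [exact: uk_cont|exact: vl_cont]. Qed.

(** The maximum is taken over products p q, so that [x] and x p q both lie in the ball x p K1 and
    the maximality of the gap can be tested at x p. *)
Lemma max_over_K11 (w : V -> R) x : continuous w -> exists p q, [/\ K1 p, K1 q &
  forall k l, K1 k -> K1 l -> w (mul x (mul k l)) <= w (mul x (mul p q))].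
Proof.
move=> cw.
have c1 : {within K1 `*` K1, continuous (fun p : V * V => w (mul x (mul p.1 p.2)))}.
  apply: continuous_subspaceT => -[k l].
  have c1 : mul x (mul p.1 p.2) @[p --> (k, l)] --> mul x (mul k l).
    apply: cvg_cg_mul; first exact: cvg_cst.
    by apply: cvg_cg_mul; [exact: cvg_fst|exact: cvg_snd].
  exact: (cvg_comp _ _ c1 (@cw _)).
have K0 : (K1 `*` K1) !=set0 by exists (0, 0).
have [[p q]] := compact_EVT_max K0 (compact_setX K1_compact K1_compact) c1.
rewrite inE => -[/= hp hq] h; exists p, q; split=> // k l hk hl.
by apply: (h (k, l)); rewrite inE.
Qed.

Lemma comparison_contradiction : False.
Proof.
have X0 : X !=set0 by exists (x1, (0, 0)).
have [p0 Xp0 p0max] := compact_EVT_max X0 X_compact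
  (continuous_subspaceT W_cont).
rewrite inE in Xp0; pose mu := W p0.
have Wle x k l : D x -> K1 k -> K1 l -> u (mul x k) - v (mul x l) <= mu.
  by move=> hx hk hl; apply: (p0max (x, (k, l))); rewrite inE.
have mu0 : m0 <= mu.
  by apply: le_trans x1_m0 _; have := Wle x1 0 0 Dx1 K1_0 K1_0; rewrite !cg_mulx0.
pose E := X `&` [set p | mu <= W p].
have E_compact : compact E.
  apply: compact_closedI => //.
  apply: (@closed_comp _ _ W [set x | mu <= x]); last exact: closed_ge.
  by move=> p _; exact: W_cont.
have E0 : E !=set0 by exists p0; split=> //=; rewrite lexx.
have [[x0 [k0 l0]]] := compact_EVT_max E0 E_compact (continuous_subspaceT uk_cont).
rewrite inE => -[[/= Dx0 [K1k0 K1l0]]]; rewrite /W /= => mule q0max.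
pose al := u (mul x0 k0); pose be := v (mul x0 l0).
have mulE : mu = al - be.
  by apply/eqP; rewrite eq_le mule; exact: Wle.
have ule x k l : D x -> K1 k -> K1 l -> mu <= u (mul x k) - v (mul x l) ->
    u (mul x k) <= al.
  by move=> hx hk hl h; apply: (q0max (x, (k, l))); rewrite inE.
pose F x := exists k l, [/\ D x, K1 k, K1 l, u (mul x k) = al & v (mul x l) = be].
have step x k : F x -> K1 k -> F (mul x k).
  move=> [k' [l' [Dx hk' hl' uk' vl']]] hk.
  have good : forall k, K2 k -> Omega (mul x k).
    apply: contrapT => /(near_boundary Dx)/(_ k' l' hk' hl').
    by rewrite uk' vl' -mulE ltNge mu0.
  have Dxk k1 : K1 k1 -> D (mul x k1).
    move=> hk1; split; first by have [_] := Dx; exact.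
    by move=> k2 hk2; rewrite -cg_mulA; apply/OA/good/K11.
  have [p [q [hp hq hpq]]] := max_over_K11 x u_cont.
  have cNv : continuous (fun y => - v y) by move=> y; exact: (cvgN (@v_cont y)).
  have [p' [q' [hp' hq' hpq']]] := max_over_K11 x cNv.
  have cu := u_convex good hpq hk'; rewrite uk' in cu.
  have vq' k1 k2 : K1 k1 -> K1 k2 ->
      v (mul x (mul p' q')) <= v (mul x (mul k1 k2)).
    by move=> h1 h2; have := hpq' _ _ h1 h2; rewrite lerN2.
  have cv := v_concave good vq' hl'; rewrite vl' in cv.
  (* [x] lies in the balls around [x p] and [x p'], which turns the
     finite-difference inequalities of [u] and [v] into equalities. *)
  have W1 : u (mul x (mul p q)) - v x <= mu.
    have := Wle (mul x p) q (- p) (Dxk _ hp) hq (K1_opp hp).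
    by rewrite cg_mulxK cg_mulA.
  have W2 : u x - v (mul x (mul p' q')) <= mu.
    have := Wle (mul x p') (- p') q' (Dxk _ hp') (K1_opp hp') hq'.
    by rewrite cg_mulxK cg_mulA.
  have Bal : al <= u (mul x (mul p q)).
    by have := hpq _ _ hk' K1_0; rewrite cg_mulx0 uk'.
  have Cbe : v (mul x (mul p' q')) <= be.
    by have := vq' _ _ hl' K1_0; rewrite cg_mulx0 vl'.
  (* Adding the four inequalities shows that the gap at x p, taken between x p q and [x], equals
     [mu]. The second maximisation then bounds [u] at x p q by [al]. *)
  have Bal2 : u (mul x (mul p q)) <= al.
    rewrite cg_mulA; apply: (ule _ _ (- p) (Dxk _ hp) hq (K1_opp hp)).
    by rewrite cg_mulxK -cg_mulA; lra.
  have ux : u x = al by lra.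
  have vx : v x = be by lra.
  (* From x k the step k^-1 leads back to [x], where both extremal values are now attained. *)
  exists (- k), (- k); split; rewrite ?cg_mulxK//;
    [exact: Dxk|exact: K1_opp|exact: K1_opp].
have Fj j : F (mul x0 (j%:R *: a)).
  elim: j => [|j IH].
    by rewrite scale0r cg_mulx0; exists k0, l0; split.
  rewrite -natr1 -(cg_exp G) scale1r cg_mulA; exact: step.
have [j] := exit x0; apply.
by have [k [l [[]]]] := Fj j.
Qed.

End Comparison.

(** * Viscosity solutions and the domain *)

Section Viscosity.
Context {R : realType} {n r m : nat} (G : carnot_group R n r).
Local Notation V := 'rV[R]_n.
Local Notation mul := (cg_mul G).
Variables (e : m.-tuple V) (S : 'M[R]_m) (f : 'rV[R]_m -> R).
Hypotheses (S_sym : S^T = S) (hf : forall p, f p = 2^-1 * ip S p p).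
Variables (Omega : set V).
Hypothesis Omega_open : open Omega.

Lemma viscosity_subsolution_ext (u g : V -> R) :
  (forall x, Omega x -> u x = g x) ->
  viscosity_subsolution G e f Omega u -> viscosity_subsolution G e f Omega g.
Proof.
move=> ug hu psi x0 hpsi Ox0 hmax; apply: (hu psi x0 hpsi Ox0).
have hO : \forall x \near x0, Omega x by apply: open_nbhs_nbhs; split.
by apply: filterS2 hO hmax => x Ox; rewrite !ug.
Qed.

Lemma derive_opp_near (g h : V -> R) x v :
  (\forall y \near x, g y = - h y) -> derivable h x v ->
  'D_v g x = - 'D_v h x.
Proof.
by move=> gh dh; rewrite (near_eq_derive _ gh) deriveN.
Qed.

(** As [f] is quadratic, its gradient is odd: the two gradient factors absorb each other's sign, and
    the Hessian alone changes sign. *)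
Lemma aronsson_opp (psi : V -> R) x : Ck 2 Omega psi -> Omega x ->
  aronsson G e f (fun y => - psi y) x = - aronsson G e f psi x.
Proof.
move=> hpsi Ox.
have vfN (w y : V) : Omega y -> vf_apply (left_field mul w) (fun y => - psi y) y =
    - vf_apply (left_field mul w) psi y.
  move=> Oy; apply: derive_opp_near; first by near=> z.
  by apply: diff_derivable; exact: (hpsi.1 y Oy).
have hO : \forall y \near x, Omega y by apply: open_nbhs_nbhs; split.
have vf2N w1 w2 : vf_apply (left_field mul w1)
      (vf_apply (left_field mul w2) (fun y => - psi y)) x =
    - vf_apply (left_field mul w1) (vf_apply (left_field mul w2) psi) x.
  apply: derive_opp_near; last first.
    by apply: diff_derivable; exact: (vf_apply_differentiable _ _ Omega_open hpsi Ox).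
  by apply: filterS hO => y; exact: vfN.
have gradN : hgrad G e (fun y => - psi y) x = - hgrad G e psi x.
  by apply/rowP => i; rewrite !mxE /Xf vfN.
have hessN i j : hhess G e (fun y => - psi y) x i j = - hhess G e psi x i j.
  have hE (p : V -> R) : hhess G e p x i j = 2^-1 *
      (vf_apply (left_field mul (tnth e i)) (vf_apply (left_field mul (tnth e j)) p) x +
       vf_apply (left_field mul (tnth e j)) (vf_apply (left_field mul (tnth e i)) p) x).
    by rewrite mxE.
  have halfN (a b : R) : 2^-1 * (- a + - b) = - (2^-1 * (a + b)).
    by rewrite -opprD mulrN.
  apply: etrans (hE _) _; apply: etrans (congr1 -%R (esym (hE psi))).
  apply: etrans (halfN _ _).
  exact: (congr2 (fun a b : R => 2^-1 * (a + b)) (vf2N _ _) (vf2N _ _)).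
have partialN i p : partial f i (- p) = - partial f i p.
  by rewrite !(partial_quadratic S_sym hf) mulNmx mxE.
rewrite /aronsson gradN; move: (hgrad G e psi x) => P.
rewrite opprK -sumrN; apply: eq_bigr => i _.
rewrite -sumrN; apply: eq_bigr => j _.
have algN (a b c : R) : - (- a * - b * - c) = a * b * c.
  by rewrite mulrNN mulrN opprK.
apply: etrans (algN _ _ _); congr (- _).
exact: (congr2 *%R (congr2 *%R (partialN i P) (partialN j P)) (hessN i j)).
Unshelve. all: by end_near. Qed.

Lemma supersolution_opp (u : V -> R) : viscosity_supersolution G e f Omega u ->
  viscosity_subsolution G e f Omega (fun x => - u x).
Proof.
move=> hu psi x0 hpsi Ox0 hmax.
have hpsi' : Ck 2 Omega (fun y => - psi y).
  exact: CkN.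
have := hu _ x0 hpsi' Ox0; rewrite aronsson_opp// oppr_ge0; apply.
by apply: filterS hmax => x; lra.
Qed.

End Viscosity.

Section Directions.
Context {R : realType} {n r m : nat} (G : carnot_group R n r).
Local Notation V := 'rV[R]_n.
Variables (e : m.-tuple V) (S : 'M[R]_m).

Lemma coercive_pos (C0 : R) : 0 < C0 -> (forall c, C0 * sqn c <= ip S c c) ->
  forall c : 'rV[R]_m, c != 0 -> 0 < ip S c c.
Proof.
move=> C00 hC c c0; apply: lt_le_trans (hC c); rewrite mulr_gt0//.
by apply: lt_le_trans (sqr_norm_le_sqn c); rewrite exprn_gt0// normr_gt0.
Qed.

Lemma mulmx_cnorm_le (C0 : R) (M : 'M[R]_(m, n)) : 0 < C0 ->
  (forall c, C0 * sqn c <= ip S c c) ->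
  exists2 L, 0 <= L & forall c, `|c *m M| <= L * cnorm S c.
Proof.
move=> C00 hC; pose K := \sum_i `|row i M|.
have K0 : 0 <= K by apply: sumr_ge0.
exists (K / Num.sqrt C0); first by rewrite divr_ge0// sqrtr_ge0.
have s0 : 0 < Num.sqrt C0 by rewrite sqrtr_gt0.
move=> c; have hc : Num.sqrt C0 * `|c| <= cnorm S c.
  rewrite -ler_sqr ?nnegrE ?mulr_ge0 ?sqrtr_ge0//.
  rewrite sqr_cnorm; last exact: coercive_pos hC.
  rewrite exprMn sqr_sqrtr ?(ltW C00)//; apply: le_trans (hC c).
  by rewrite ler_pM2l// sqr_norm_le_sqn.
have : `|c *m M| <= K * `|c|.
  rewrite mulmx_sum_row (le_trans (ler_norm_sum _ _ _))// mulr_suml ler_sum// => i _.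
  by rewrite normrZ mulrC ler_wpM2l// rV_coord_le.
move=> /le_trans; apply; rewrite -mulrA ler_wpM2l//.
by rewrite ler_pdivlMl.
Qed.

(** If V^1 were 0, all brackets with it would vanish and the layers would be 0 one after the other,
    up to V^r. *)
Lemma layer1_neq0 : cg_layer G 1 != 0%VS.
Proof.
apply/eqP => l1; have lj j : (1 <= j <= r)%N -> cg_layer G j = 0%VS.
  elim: j => [//|[|j] IH] /andP[_ hj]; first exact: l1.
  have hj' : (1 <= j.+1 <= r.-1)%N by move: hj; case: (r).
  have [_ /(_ 0%VS)] := cg_generate G hj'.
  rewrite subv0 => h; apply/eqP/h => x y; rewrite l1 memv0 => /eqP -> _.
  rewrite /lie_bracket /vf_bracket.
  have -> : left_field (cg_mul G) 0 = fun=> 0.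
    by apply/funext => z; rewrite /left_field derive0.
  by rewrite derive0 derive_cst subr0 mem0v.
by have := cg_top_neq0 G; rewrite lj ?eqxx// leqnn (cg_step_gt0 G).
Qed.

(** Supplies the horizontal step whose powers leave the bounded domain. The frame is free and
    nonempty and [S] is definite, so a coordinate vector has a nonzero step. *)
Lemma frame_direction (Q : 'M[R]_n) : (forall c : 'rV[R]_m, c != 0 -> 0 < ip S c c) ->
  horizontal_frame G Q e -> exists c : 'rV[R]_m, c *m (S *m frame_mx e) != 0.
Proof.
move=> Spos [/andP[/eqP spanE freeE] _].
have m0 : (0 < m)%N.
  case: m e spanE {Spos freeE} => // e0 sp.
  by have := layer1_neq0; rewrite -sp (tuple0 e0) /= span_nil eqxx.
pose i0 := Ordinal m0; pose p : 'rV[R]_m := delta_mx 0 i0.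
have p0 : p != 0.
  by apply/eqP => /rowP/(_ i0)/eqP; rewrite !mxE !eqxx oner_eq0.
exists p; apply/eqP => h.
have hS : p *m S = 0.
  apply/rowP => i; rewrite [RHS]mxE; move/freeP : freeE => /(_ (fun i => (p *m S) 0 i)).
  apply; rewrite -[RHS]h mulmxA [RHS]mulmx_sum_row; apply: eq_bigr => j _.
  by rewrite rowK (tnth_nth 0).
by have := Spos p p0; rewrite /ip hS mul0mx mxE ltxx.
Qed.

End Directions.

Section Domain.
Context {R : realType} {n : nat}.
Local Notation V := 'rV[R]_n.

(** Take the last time at which the segment is in the closure: if that point were in the open set
    [Omega], the segment could be followed further. This finds a boundary point near [x] at which
    [u] and [v] can be compared. *)
Lemma segment_exits (Omega : set V) (x y : V) : open Omega ->
  closure Omega x -> ~ Omega y ->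
  exists2 z, (closure Omega `\` Omega) z & `|z - x| <= `|y - x|.
Proof.
move=> oO Ax Oy; pose g (t : R) := x + t *: (y - x).
have cg t : {for t, continuous g}.
  apply: cvgD; first exact: cvg_cst.
  by apply: cvgZr_tmp; exact: cvg_id.
pose E := `[0, 1]%classic `&` [set t : R | closure Omega (g t)].
have cE : compact E.
  apply: compact_closedI; first exact: segment_compact.
  apply: (@closed_comp _ _ g (closure Omega)); last exact: closed_closure.
  by move=> t _; exact: cg.
have E0 : E !=set0.
  by exists 0; split; rewrite /= ?in_itv/= ?lexx ?ler01// /g scale0r addr0.
have cid : continuous (fun t : R => t) by move=> t; exact: cvg_id.
have [T TE Tmax] := compact_EVT_max E0 cE (continuous_subspaceT cid).
have [T01 AT] := set_mem TE.
have /andP[T0 T1] : 0 <= T <= 1 by move: T01; rewrite /= in_itv.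
exists (g T); last first.
  by rewrite /g addrC addKr normrZ ger0_norm// ler_piMl.
split=> // OT.
have T1' : T < 1.
  rewrite lt_def T1 andbT; apply/eqP => T1'; apply: Oy.
  by move: OT; rewrite -T1' /g scale1r subrKC.
have : \forall t \near T, Omega (g t).
  by apply: cg; apply: open_nbhs_nbhs; split.
move=> /nbhs_ballP[d /= d0 hd].
pose t := Num.min 1 (T + d / 2).
have tT : T < t by rewrite lt_min T1' ltrDl divr_gt0.
have : t <= T.
  apply: Tmax; apply: mem_set; split=> /=.
    by rewrite in_itv /= ge_min lexx andbT (le_trans T0)// ltW.
  apply/subset_closure/hd; rewrite -ball_normE /= ltr0_norm ?subr_lt0//.
  rewrite opprB ltrBlDl; apply: (@le_lt_trans _ _ (T + d / 2)).
    by rewrite ge_min lexx orbT.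
  by rewrite ltrD2l ltr_pdivrMr// ltr_pMr// ltr1n.
by rewrite leNgt tT.
Qed.

Lemma uniform_near0 (A : set V) (F : V * V -> R) eta : compact A ->
  continuous F -> (forall x, A x -> F (x, 0) = 0) -> 0 < eta ->
  exists2 d, 0 < d & forall x h, A x -> `|h| < d -> F (x, h) < eta.
Proof.
move=> cA cF F0 eta0.
have pre x : A x -> \forall x' \near x & h \near (0 : V), F (x', h) < eta.
  move=> Ax; have h : \forall p \near (x, (0 : V)), F p < eta.
    by apply: (cvgr_lt _ (cF (x, 0))); rewrite F0.
  by apply: filterS h => -[].
have := (compact_near_coveringP _).1 cA _ (nbhs (0 : V))
  (fun h x => F (x, h) < eta) _ pre.
move=> /(_ _)/nbhs_ballP[d /= d0 hd]; exists d => // x h Ax hh.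
by apply: (hd h) => //; rewrite -ball_normE /= sub0r normrN.
Qed.

(** Tietze's theorem: a solution is continuous on the closure of [Omega], while the comparison
    argument takes functions continuous everywhere. *)
Lemma compact_extension (A : set V) (u : V -> R) : compact A ->
  {within A, continuous u} ->
  exists2 g : V -> R, continuous g & forall x, A x -> u x = g x.
Proof.
move=> cA cu.
have [M [_ hM]] := compact_bounded (continuous_compact cu cA).
pose M' := `|M| + 1.
have M0 : 0 < M' by rewrite ltr_wpDl.
have hM' x : A x -> `|u x| <= M'.
  by move=> Ax; apply: (hM M'); [rewrite ltr_pwDr// ler_norm|exists x].
have [g [ug cg _]] := continuous_bounded_extension (@pseudometric_normal R V)
  (compact_closed (@norm_hausdorff _ _) cA) M0 cu hM'.
by exists g => // x Ax; apply: ug; rewrite inE.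
Qed.

End Domain.

(** * Uniqueness *)

Lemma within_closure_proper {T : topologicalType} (A : set T) x :
  closure A x -> ProperFilter (within A (nbhs x)).
Proof.
move=> Ax; split; last exact: within_filter.
by move=> /Ax[y [Ay]]; exact.
Qed.

Section Uniqueness.
Context {R : realType} {n r m : nat} (G : carnot_group R n r).
Local Notation V := 'rV[R]_n.
Local Notation mul := (cg_mul G).
Variables (e : m.-tuple V) (S : 'M[R]_m) (f : 'rV[R]_m -> R).
Hypotheses (S_sym : S^T = S) (hf : forall p, f p = 2^-1 * ip S p p).
Hypothesis S_pos : forall c, c != 0 -> 0 < ip S c c.
Let M := S *m frame_mx e.
Variables (L rho : R).
Hypotheses (L0 : 0 <= L) (hL : forall c, `|c *m M| <= L * cnorm S c).
Hypothesis rho0 : 0 < rho.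
Hypothesis chain_le : forall s, 2 * L * clen S s <= rho ->
  `|chain G M s| <= 2 * L * clen S s.
Hypothesis mul_le : forall x y, `|x| <= rho -> `|y| <= rho ->
  `|mul x y| <= 2 * `|x| + `|y|.
Variable Omega : set V.
Hypotheses (Omega_open : open Omega) (Omega_bounded : bounded_set Omega).
Local Notation A := (closure Omega).
Local Notation reach := (reach G S M).

(** Cutting a chain of length 2 eps in the middle turns a bound on products of two points of the
    eps-ball into a bound on the 2 eps-ball. Both this and the conclusion then extend from chains to
    closures by continuity. *)
Lemma subsolution_convex (u : V -> R) (eps : R) : continuous u ->
  viscosity_subsolution G e f Omega u -> 0 < eps ->
  2 * L * (eps + eps) <= rho ->
  forall x b, (forall k, reach (eps + eps) k -> Omega (mul x k)) ->
  (forall k l, reach eps k -> reach eps l -> u (mul x (mul k l)) <= b) ->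
  forall k, reach eps k -> 2 * u (mul x k) <= u x + b.
Proof.
move=> cu usub eps0 heps x b xO hb.
have cux k : {for k, continuous (fun k => u (mul x k))}.
  exact: (continuous_comp (Ck_mulx G 0 x k I) (@cu _)).
have hb2 k : reach (eps + eps) k -> u (mul x k) <= b.
  apply: (closure_sub_closed (D := [set k | u (mul x k) <= b])).
    apply: (@closed_comp _ _ (fun k => u (mul x k)) [set y : R | y <= b]).
      by move=> y _; exact: cux.
    exact: closed_le.
  move=> _ [s hs ->] /=.
  have [s1 [s2 [-> h1 h2]]] := chain_split G M (ltW eps0) (ltW eps0) hs.
  by apply: hb; exact: chain_reach.
move=> k hk; rewrite mulrC -ler_pdivlMr//; move: k hk.
apply: (closure_sub_closed (D := [set k | u (mul x k) <= (u x + b) / 2])).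
  apply: (@closed_comp _ _ (fun k => u (mul x k)) [set y : R | y <= (u x + b) / 2]).
    by move=> y _; exact: cux.
  exact: closed_le.
move=> _ [s hs ->] /=; rewrite ler_pdivlMr// mulrC.
apply: (reach_convex (L := L) (rho := rho) (Omega := Omega) (T := eps + eps)
  S_sym hf S_pos L0 hL rho0 chain_le mul_le usub Omega_open _ _ heps xO hb2).
- by move=> y _; exact: cu.
- by rewrite addr_gt0.
- by lra.
Qed.

Lemma closure_compact : compact A.
Proof.
apply: bounded_closed_compact; last exact: closed_closure.
have [N [Nr hN]] := Omega_bounded.
exists N; split=> // N' hN'; have hA := hN _ hN'.
apply: closure_sub_closed hA.
apply: (@closed_comp _ _ (fun v : V => `|v|) [set x | x <= N']).
  by move=> v _; exact: norm_continuous.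
exact: closed_le.
Qed.

Lemma subsolution_le (u v : V -> R) (c0 : 'rV[R]_m) : c0 *m M != 0 ->
  continuous u -> continuous v ->
  viscosity_subsolution G e f Omega u ->
  viscosity_subsolution G e f Omega (fun x => - v x) ->
  (forall x, A x -> ~ Omega x -> u x = v x) ->
  forall x, A x -> u x <= v x.
Proof.
move=> c0M cu cv usub vsub uv xs Axs; rewrite leNgt; apply/negP => hlt.
pose m0 := u xs - v xs.
have m00 : 0 < m0 by rewrite subr_gt0.
have m04 : 0 < m0 / 4 by rewrite divr_gt0.
have Oxs : Omega xs.
  by apply: contrapT => /(uv _ Axs) h; rewrite h ltxx in hlt.
have Ac := closure_compact.
have uc (w : V -> R) : continuous w -> exists2 d, 0 < d & forall x y, A x ->
    `|y - x| < d -> `|w y - w x| < m0 / 4.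
  move=> cw; have [|||d d0 hd] := @uniform_near0 _ _ A
      (fun p => `|w (p.1 + p.2) - w p.1|) (m0 / 4) Ac.
  - move=> [x h].
    have c1 : p.1 + p.2 @[p --> (x, h)] --> x + h.
      by apply: cvgD; [exact: cvg_fst|exact: cvg_snd].
    have c2 : p.1 @[p --> (x, h)] --> x by exact: cvg_fst.
    apply: cvg_norm; apply: cvgB.
      exact: (cvg_comp _ _ c1 (@cw _)).
    exact: (cvg_comp _ _ c2 (@cw _)).
  - by move=> x Ax /=; rewrite addr0 subrr normr0.
  - exact: m04.
  - exists d => // x y Ax hxy; have := hd x (y - x) Ax hxy.
    by rewrite /= subrKC.
have [du du0 hdu] := uc _ cu; have [dv dv0 hdv] := uc _ cv.
have [d [d0 d_u d_v]] : exists d, [/\ 0 < d, d <= du & d <= dv].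
  by exists (Num.min du dv); rewrite lt_min du0 dv0 !ge_min !lexx orbT.
have [d1 d10 hd1] : exists2 d1, 0 < d1 & forall x k, A x -> `|k| < d1 ->
    `|mul x k - x| < d / 2.
  have [|||d1 d10 h] := @uniform_near0 _ _ A (fun p => `|mul p.1 p.2 - p.1|) (d / 2) Ac.
  - move=> [x h]; apply: cvg_norm; apply: cvgB; last exact: cvg_fst.
    by apply: cvg_cg_mul; [exact: cvg_fst|exact: cvg_snd].
  - by move=> x _ /=; rewrite cg_mulx0 subrr normr0.
  - exact: divr_gt0.
  - by exists d1.
have [d2 d20 hd2] : exists2 d2, 0 < d2 & forall k, `|k| < d2 -> Omega (mul xs k).
  have : \forall k \near (0 : V), Omega (mul xs k).
    have c := Ck_mulx G 0 xs (0 : V) I; apply: c; rewrite cg_mulx0.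
    by apply: open_nbhs_nbhs; split.
  move=> /nbhs_ballP[d2 /= d20 h]; exists d2 => // k hk.
  by apply: h; rewrite -ball_normE /= sub0r normrN.
have L1 : 0 < 4 * L + 1 by rewrite ltr_wpDl// mulr_ge0.
(* [4 * L * eps] bounds the norm on the 2 eps-ball. It has to lie in the range of the group
   estimates, move points of the closure by less than [d / 2], and keep [xs] inside [Omega]. *)
have [eps [eps0 e1 e2 e3]] : exists eps, [/\ 0 < eps, 4 * L * eps <= rho,
    4 * L * eps < d1 & 4 * L * eps < d2].
  pose q := Num.min rho (Num.min d1 d2).
  have q0 : 0 < q by rewrite !lt_min rho0 d10 d20.
  exists (q / (4 * L + 1)).
  have p0 : 0 < q / (4 * L + 1) by rewrite divr_gt0.
  have hq : 4 * L * (q / (4 * L + 1)) < q.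
    by rewrite -[ltRHS](divfK (lt0r_neq0 L1)) [ltRHS]mulrC ltr_pM2r// ltrDl.
  split=> //; first by rewrite ltW// (lt_le_trans hq)// ge_min lexx.
    by rewrite (lt_le_trans hq)// !ge_min lexx orbT.
  by rewrite (lt_le_trans hq)// !ge_min lexx !orbT.
have heps : 2 * L * (eps + eps) <= rho by lra.
have reach2_norm k : reach (eps + eps) k -> `|k| <= 4 * L * eps.
  by move=> /(reach_le L0 chain_le heps); lra.
have reach12 k : reach eps k -> reach (eps + eps) k.
  by apply: reach_mono; rewrite lerDl ltW.
have reach1_0 : reach eps 0 by exact/reach0/ltW.
pose t := eps / (cnorm S c0 + 1).
have cn0 := cnorm_ge0 S c0.
have t0 : 0 < t by rewrite divr_gt0// ltr_wpDl.
pose a := (t *: c0) *m M.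
have a0 : a != 0 by rewrite /a -scalemxAl scaler_eq0 negb_or c0M andbT gt_eqF.
have reach_a : reach eps a.
  rewrite /a -(chain1 G); apply: chain_reach.
  rewrite clen_cons /clen big_nil addr0 cnormZ gtr0_norm// /t.
  by rewrite mulrAC ler_pdivrMr ?ltr_wpDl// ler_wpM2l ?(ltW eps0)// lerDl.
apply: (@comparison_contradiction _ _ _ G (reach eps) (reach (eps + eps)) A Omega
  u v m0 a xs).
- by apply: (reach_compact L0 chain_le); have := mulr_ge0 L0 (ltW eps0); lra.
- exact: reach1_0.
- exact: reach_opp.
- by move=> k l hk hl; exact: reach_mul.
- exact: Ac.
- exact: subset_closure.
- exact: cu.
- exact: cv.
- exact: subsolution_convex.
- have cNv : continuous (fun y => - v y) by move=> y; exact: (cvgN (@cv y)).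
  move=> x b xO hb k hk.
  have hNb k' l' : reach eps k' -> reach eps l' -> - v (mul x (mul k' l')) <= - b.
    by move=> h1 h2; rewrite lerN2; exact: hb.
  have := subsolution_convex cNv vsub eps0 heps xO hNb hk.
  by lra.
(* The segment to a point outside [Omega] meets the boundary at some [z] within [d / 2] of [x],
   hence within [d] of x k and x l. As [u] and [v] agree at [z] and each varies by less than m0/4,
   the gap is below m0/2. *)
- move=> x [Ax Dx] hx k l hk hl.
  have [k2 hk2 Ok2] : exists2 k2, reach (eps + eps) k2 & ~ Omega (mul x k2).
    apply: contrapT => h; apply: hx => k2 hk2; apply: contrapT => Ok2.
    by apply: h; exists k2.
  have [z [Az Oz] hz] := segment_exits Omega_open Ax Ok2.
  have small k' : reach (eps + eps) k' -> `|mul x k' - x| < d / 2.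
    by move=> h; apply: hd1 => //; apply: le_lt_trans (reach2_norm _ h) e2.
  have near_z k' : reach eps k' -> `|mul x k' - z| < d.
    move=> /reach12/small h1; have h2 := le_lt_trans hz (small _ hk2).
    rewrite -(subrK x (mul x k')) -addrA (le_lt_trans (ler_normD _ _))//.
    by rewrite [ltRHS]splitr ltrD// distrC.
  have := hdu z _ Az (lt_le_trans (near_z _ hk) d_u).
  have := hdv z _ Az (lt_le_trans (near_z _ hl) d_v).
  rewrite (uv z Az Oz) !ltr_norml => /andP[p1 p2] /andP[p3 p4].
  by lra.
- split=> // k hk; apply/subset_closure/hd2.
  by apply: le_lt_trans (reach2_norm _ (reach12 _ hk)) e3.
- exact: lexx.
- exact: reach_a.
(* If all x a^j stayed in the compact closure, left translation by x^-1 would bound the multiples j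
   a of a nonzero vector. *)
- move=> x; apply: contrapT => h.
  have hA j : A (mul x (j%:R *: a)) by apply: contrapT => hj; apply: h; exists j.
  have cm : {within A, continuous (mul (- x))}.
    by apply: continuous_subspaceT => y; exact: (Ck_mulx G 0 (- x) y I).
  have [N [Nr hN]] := compact_bounded (continuous_compact cm Ac).
  have na : 0 < `|a| by rewrite normr_gt0.
  have hj j : `|j%:R *: a| <= `|N| + 1.
    apply: (hN (`|N| + 1)); first by rewrite ltr_pwDr// ler_norm.
    by exists (mul x (j%:R *: a)); rewrite ?cg_mulKx.
  have := hj (Num.truncn ((`|N| + 1) / `|a|)).+1.
  rewrite normrZ normr_nat -ler_pdivlMr// leNgt => /negP; apply.
  by apply: truncnS_gt.
Qed.

End Uniqueness.

Theorem theoremC (R : realType) (n r m : nat) (G : carnot_group R n r)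
    (Q : 'M[R]_n) (e : m.-tuple 'rV[R]_n)
    (hQ : adapted_inner_product G Q) (he : horizontal_frame G Q e)
    (Omega : set 'rV[R]_n) (hOmega : bounded_domain Omega)
    (f : 'rV[R]_m -> R) (alpha : R)
    (f_C2 : Ck 2 [set: 'rV[R]_m] f) (f_ge0 : forall p, 0 <= f p)
    (f_convex : strictly_convex f)
    (alpha_ge1 : 1 <= alpha) (f_hom : homogeneous_of_degree f alpha)
    (f_gt0 : forall p, p <> 0 -> 0 < f p)
    (phi : 'rV[R]_n -> R) (hphi : W1oo_cc G e Omega phi)
    (u v : 'rV[R]_n -> R)
    (hu : dirichlet_solution G e f Omega phi u)
    (hv : dirichlet_solution G e f Omega phi v) :
  forall x, closure Omega x -> u x = v x.
Proof.
have [S [S_sym hf [C0 C00 hC0]]] := quadratic_form f_C2 f_convex alpha_ge1 f_hom.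
have S_pos := coercive_pos C00 hC0.
have [c0 c0M] := frame_direction S_pos he.
pose M := S *m frame_mx e.
have [L L0 hL] := mulmx_cnorm_le M C00 hC0.
have [C [rho1 [C1 rho10 hC]]] := mul_expand G.
have C1' : 0 < C + 1 by rewrite ltr_wpDl.
have [rho [rho0 rho_le hCrho]] : exists rho, [/\ 0 < rho, rho <= rho1 & C * rho <= 1].
  exists (Num.min rho1 (C + 1)^-1); split.
  - by rewrite lt_min rho10 invr_gt0.
  - by rewrite ge_min lexx.
  rewrite (@le_trans _ _ (C * (C + 1)^-1))//.
    by rewrite ler_wpM2l// ge_min lexx orbT.
  by rewrite ler_pdivrMr// mul1r lerDl.
have hC' s x x' y y' : s <= rho -> `|x| <= s -> `|x'| <= s -> `|y| <= s ->
    `|y'| <= s -> `|cg_mul G x y - cg_mul G x' y' - (x - x') - (y - y')| <=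
      C * s * (`|x - x'| + `|y - y'|).
  by move=> hs; apply: hC; exact: le_trans rho_le.
have chain_le := chain_norm_le rho0 L0 hC' hCrho hL.
have mul_le := mul_norm_le rho0 hC' hCrho.
have [Oopen _ _ Obnd] := hOmega.
have Ac := closure_compact Obnd.
have [cu [usub usuper] ub] := hu; have [cv [vsub vsuper] vb] := hv.
have [gu cgu ugu] := compact_extension Ac cu.
have [gv cgv vgv] := compact_extension Ac cv.
have uvb x : closure Omega x -> ~ Omega x -> gu x = gv x.
  move=> Ax Ox; rewrite -ugu// -vgv//.
  (* A point of the closure has a proper trace filter on [Omega], so the limit of [phi] there is
     unique and both solutions equal it. *)
  have PF := within_closure_proper Ax.
  exact: (cvg_unique _ (ub x (conj Ax Ox)) (vb x (conj Ax Ox))).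
have sub := @subset_closure _ Omega.
have gusub : viscosity_subsolution G e f Omega gu.
  by apply: viscosity_subsolution_ext usub => // x /sub; exact: ugu.
have gvsub : viscosity_subsolution G e f Omega gv.
  by apply: viscosity_subsolution_ext vsub => // x /sub; exact: vgv.
have guN : viscosity_subsolution G e f Omega (fun x => - gu x).
  apply: viscosity_subsolution_ext (supersolution_opp S_sym hf Oopen usuper) => //.
  by move=> x /sub Ax; rewrite ugu.
have gvN : viscosity_subsolution G e f Omega (fun x => - gv x).
  apply: viscosity_subsolution_ext (supersolution_opp S_sym hf Oopen vsuper) => //.
  by move=> x /sub Ax; rewrite vgv.
move=> x Ax; rewrite ugu// vgv//; apply/eqP; rewrite eq_le.
apply/andP; split.
  exact: (subsolution_le S_sym hf S_pos L0 hL rho0 chain_le mul_le Oopen Obnd c0M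
    cgu cgv gusub gvN uvb Ax).
apply: (subsolution_le S_sym hf S_pos L0 hL rho0 chain_le mul_le Oopen Obnd c0M
    cgv cgu gvsub guN _ Ax).
by move=> y Ay Oy; rewrite uvb.
Qed.
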